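(* Let $M,N,L\ge1$ be integers, $\alpha_{\rm c},\alpha_{\rm s}>0$, $\mathcal R_0>0$, $\alpha\in[0,1]$, let $\mathbf h_{\rm s}\in\mathbb C^{M\times1}$ be a fixed nonzero vector, and let $\mathbf h_{\rm c}\sim\mathcal{CN}(\mathbf 0,\alpha_{\rm c}\mathbf I)$ in $\mathbb C^{M\times1}$. For $p>0$ let $\mathbf w_\alpha^\star$ (depending on $\mathbf h_{\rm c}$ and $p$) be the optimal beamforming vector of $$\max_{\mathbf w,\mathcal R}\ \mathcal R\quad\text{s.t.}\quad\mathcal R_{\rm s}(\mathbf w)\ge\alpha\mathcal R,\ \ \mathcal R_{\rm c}(\mathbf w)\ge(1-\alpha)\mathcal R,\ \ \lVert\mathbf w\rVert^2=1,$$ where $\mathcal R_{\rm c}(\mathbf w)=\log_2(1+p|\mathbf w^{\mathsf H}\mathbf h_{\rm c}|^2)$ and $\mathcal R_{\rm s}(\mathbf w)=L^{-1}\log_2(1+pNL\alpha_{\rm s}|\mathbf w^{\mathsf H}\mathbf h_{\rm s}|^2)$. Let $\overline{\mathcal R}_{\rm c}^{\alpha}=\mathcal R_{\rm c}(\mathbf w_\alpha^\star)$, $\mathcal R_{\rm c}^\alpha=\mathbb E\{\overline{\mathcal R}_{\rm c}^{\alpha}\}$ and $\mathcal R_{\rm s}^\alpha=\mathbb E\{\mathcal R_{\rm s}(\mathbf w_\alpha^\star)\}$. Then, as $p\to\infty$, $$\mathcal R_{\rm s}^\alpha\approx\mathcal S_{\rm s}^\alpha(\log_2p-\mathcal L_{\rm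 s}^\alpha),\qquad \mathcal R_{\rm c}^\alpha\approx\mathcal S_{\rm c}^\alpha(\log_2p-\mathcal L_{\rm c}^\alpha),\qquad \Pr(\overline{\mathcal R}_{\rm c}^\alpha<\mathcal R_0)\simeq\mathcal O(p^{-\mathcal D_{\rm c}^\alpha}),$$ where $\mathcal S_{\rm s}^\alpha=\frac1L$, $\mathcal S_{\rm c}^\alpha=1$, $$\mathcal L_{\rm s}^\alpha\in\left[-\log_2(LN\alpha_{\rm s}\lVert\mathbf h_{\rm s}\rVert^2),\ -\log_2(LN\alpha_{\rm s}\lVert\mathbf h_{\rm s}\rVert^2)+\sum_{i=1}^{M-1}\frac{1}{i\ln2}\right],$$ $$\mathcal L_{\rm c}^\alpha\in\left[-\log_2\alpha_{\rm c}-\frac{\psi(M)}{\ln2},\ -\log_2\alpha_{\rm c}-\frac{\psi(1)}{\ln2}\right],\qquad \mathcal D_{\rm c}^\alpha\in[1,M].$$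
   Context: $\mathcal R_{\rm c}(\mathbf w)$ is the communication rate to a single-antenna user with channel $\mathbf h_{\rm c}$ and $\mathcal R_{\rm s}(\mathbf w)$ the sensing rate for one target with (deterministic, nonzero) transmit steering vector $\mathbf h_{\rm s}$, for a base station with $M$ transmit and $N$ receive antennas, power budget $p$, frame length $L$ and unit-norm beamformer $\mathbf w$. $\mathcal{CN}(\mathbf 0,\alpha_{\rm c}\mathbf I)$ is the circularly symmetric complex Gaussian law: i.i.d. entries with mean zero and variance $\mathbb E|\cdot|^2=\alpha_{\rm c}$. $\psi(x)=\frac{d}{dx}\ln\Gamma(x)$ is the Digamma function. Empty sums are zero. Conventions: for a rate, $\mathcal R\approx\mathcal S(\log_2p-\mathcal L)$ as $p\to\infty$ means that the difference of the two sides tends to $0$; $\mathcal S$ is called the high-SNR slope and $\mathcal L$ the high-SNR power offset. $\Pr(\cdot)\simeq\mathcal O(p^{-\mathcal D})$ means that $\mathcal D$ is the diversity order, i.e. $\mathcal D=-\lim_{p\to\infty}\log\Pr(\cdot)/\log p$. The interval endpoints are the power offsets and diversity orders attained by the beamformers $\mathbf h_{\rm c}/\lVert\mathbf h_{\rm c}\rVert$ (communications-centric) and $\mathbf h_{\rm s}/\lVert\mathbf h_{\rm s}\rVert$ (sensing-centric). *)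

(* Defs.v *)
From HB Require Import structures.
From mathcomp Require Import all_boot all_order all_algebra.
From mathcomp Require Import complex.
From mathcomp Require Import all_classical all_reals all_analysis.

Set Implicit Arguments.
Unset Strict Implicit.
Unset Printing Implicit Defensive.

Import Order.TTheory GRing.Theory Num.Theory.
Import numFieldNormedType.Exports.

Local Open Scope classical_set_scope.
Local Open Scope ring_scope.

Definition log2 (R : realType) (x : R) : R := ln x / ln 2.

Definition Gamma (R : realType) (x : R) : R :=
  \int[lebesgue_measure]_(t in `]0, +oo[) (t `^ (x - 1) * expR (- t)).

Definition digamma (R : realType) (x : R) : R :=
  derive1 (fun y : R => ln (Gamma y)) x.

Definition sqnorm (R : realType) (M : nat) (v : 'cV[R[i]]_M) : R :=
  \sum_(k < M) Normc.normc (v k 0) ^+ 2.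

(* |w^H h|^2 *)
Definition gain (R : realType) (M : nat) (w h : 'cV[R[i]]_M) : R :=
  Normc.normc (((map_mx conjc w)^T *m h) 0 0) ^+ 2.

Definition comm_rate (R : realType) (M : nat) (p : R) (hc w : 'cV[R[i]]_M) : R :=
  log2 (1 + p * gain w hc).

Definition sens_rate (R : realType) (M N L : nat) (alphas p : R)
    (hs w : 'cV[R[i]]_M) : R :=
  L%:R^-1 * log2 (1 + p * N%:R * L%:R * alphas * gain w hs).

Definition feasible (R : realType) (M N L : nat) (alphas alpha p : R)
    (hs hc w : 'cV[R[i]]_M) (r : R) : Prop :=
  [/\ alpha * r <= sens_rate N L alphas p hs w,
      (1 - alpha) * r <= comm_rate p hc w
    & sqnorm w = 1].

Definition optimal_beamformer (R : realType) (M N L : nat) (alphas alpha p : R)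
    (hs hc w : 'cV[R[i]]_M) : Prop :=
  exists2 r : R, feasible N L alphas alpha p hs hc w r &
    forall (w' : 'cV[R[i]]_M) (r' : R),
      feasible N L alphas alpha p hs hc w' r' -> r' <= r.

(* The 2M real coordinates of a random vector of C^M; the boolean selects the
   imaginary part. *)
Definition coordinate (R : realType) (T : Type) (M : nat)
    (h : T -> 'cV[R[i]]_M) (k : 'I_M * bool) (t : T) : R :=
  if k.2 then complex.Im (h t k.1 0) else complex.Re (h t k.1 0).

(* h ~ CN(0, a I): the 2M real coordinates are mutually independent normal
   variables of mean 0 and variance a / 2.  The second argument of normal_prob
   is the standard deviation.  As the A k may be setT, the product rule over
   the full family gives the one over every subfamily. *)
Definition complex_gaussian (R : realType) (d : measure_display)
    (T : measurableType d) (P : probability T R) (M : nat) (a : R)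
    (h : T -> 'cV[R[i]]_M) : Prop :=
  [/\ forall k, measurable_fun setT (coordinate h k),
      forall k (A : set R), measurable A ->
        P (coordinate h k @^-1` A) = normal_prob 0 (Num.sqrt (a / 2)) A
    & forall A : 'I_M * bool -> set R, (forall k, measurable (A k)) ->
        P (\bigcap_k (coordinate h k @^-1` A k)) =
        (\prod_k P (coordinate h k @^-1` A k))%E].

(* The limit is in \bar R, so the rate is in particular finite for large p. *)
Definition high_snr_expansion (R : realType) (rate : R -> \bar R) (S Lo : R) :
    Prop :=
  (rate p - (S * (log2 p - Lo))%:E)%E @[p --> +oo%R] --> 0%E.

Definition diversity_order (R : realType) (pr : R -> \bar R) (D : R) : Prop :=
  - (ln (fine (pr p)) / ln p) @[p --> +oo%R] --> D.

(* Main.v *)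
(* For a fixed channel, a constraint of the max-min problem that is slack at the
   optimum forces the other gain to its maximum, since otherwise the beam could
   be tilted so as to raise the rate.  Hence both gains lie between their values
   at the beams [hc / |hc|] and [hs / |hs|].  Rates with gain [g] force
   [expR (rate)] to be linear in [p * g], so for large [p] the constraint with the
   larger exponent among [alpha * L] and [1 - alpha] is the binding one and its
   beam is exactly optimal; with equal exponents the optimal gains do not depend
   on [p].  In every case the gains are eventually constant in [p], and dominated
   convergence gives the expansions, the offset being minus the mean binary
   logarithm of the limiting gain.  Its bounds come from the facts that
   [|hc|^2 / alphac] and [|hs^H hc|^2 / (|hs|^2 alphac)] have Gamma laws of shapes
   [M] and [1], whose mean logarithms are [digamma M] and [digamma 1].
   If [alpha < 1], a beam that retains half of both maximal gains shows that the
   outage event lies between [{|hc|^2 < c / p}] and [{|hc|^2 < 2 * c / p}], whence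
   diversity [M]; if [alpha = 1] the beam is [hs / |hs|] and the diversity is [1]. *)
Require Import Defs.
From HB Require Import structures.
From mathcomp Require Import all_boot all_order all_algebra.
From mathcomp Require Import complex.
From mathcomp Require Import all_classical all_reals all_analysis.
From mathcomp Require Import measurable_realfun.
From mathcomp Require Import ring lra.

Set Implicit Arguments.
Unset Strict Implicit.
Unset Printing Implicit Defensive.

Import Order.TTheory GRing.Theory Num.Theory.
Import numFieldNormedType.Exports.

Local Open Scope classical_set_scope.
Local Open Scope ring_scope.

(** * Hermitian geometry *)

(** The beam [w p h] is an arbitrary selection among the optimal ones, with no measurability in [h],
    so expectations and outage events are not measurable for free. [beam_optimal_gain] removes this
    obstacle: an optimal gain is the maximum of the threshold at the optimal rate and the gain of
    the beam matched to the other channel, so the beam enters only through its rate. The rate itself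
    is measurable because rational rates and rational beams describe the event that it exceeds a
    constant. The laws of the gains are found without a density in all coordinates at once: only
    products of two measures on the line occur, and independence from the other coordinates is kept
    by intersecting every event with a box. The sensing offset involves the ratio of two dependent
    Gamma variables; its mean logarithm is obtained from the two marginal laws alone. *)

Section hermitian_geometry.
Variables (R : realType) (M : nat).
Implicit Types (u v w h : 'cV[R[i]]_M) (z : R[i]).

Definition cdot w h : R[i] := ((map_mx conjc w)^T *m h) 0 0.

Lemma sqr_normc z : Normc.normc z ^+ 2 = complex.Re z ^+ 2 + complex.Im z ^+ 2.
Proof. by case: z => a b /=; rewrite sqr_sqrtr// addr_ge0// sqr_ge0. Qed.

Lemma ReD z1 z2 : complex.Re (z1 + z2) = complex.Re z1 + complex.Re z2.
Proof. by case: z1 z2 => [? ?] [? ?]. Qed.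

Lemma ImD z1 z2 : complex.Im (z1 + z2) = complex.Im z1 + complex.Im z2.
Proof. by case: z1 z2 => [? ?] [? ?]. Qed.

Lemma ReM z1 z2 : complex.Re (z1 * z2) =
  complex.Re z1 * complex.Re z2 - complex.Im z1 * complex.Im z2.
Proof. by case: z1 z2 => [? ?] [? ?]. Qed.

Lemma ImM z1 z2 : complex.Im (z1 * z2) =
  complex.Re z1 * complex.Im z2 + complex.Im z1 * complex.Re z2.
Proof. by case: z1 z2 => [? ?] [? ?]. Qed.

Lemma Re_cdot w h : complex.Re (cdot w h) =
  \sum_k (complex.Re (w k 0) * complex.Re (h k 0) +
          complex.Im (w k 0) * complex.Im (h k 0)).
Proof.
rewrite /cdot mxE (big_morph _ ReD (erefl : complex.Re 0 = 0)).
apply: eq_bigr => k _; rewrite !mxE ReM.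
by case: (w k 0) (h k 0) => [a b] [c e] /=; rewrite mulNr opprK.
Qed.

Lemma Im_cdot w h : complex.Im (cdot w h) =
  \sum_k (complex.Re (w k 0) * complex.Im (h k 0) -
          complex.Im (w k 0) * complex.Re (h k 0)).
Proof.
rewrite /cdot mxE (big_morph _ ImD (erefl : complex.Im 0 = 0)).
apply: eq_bigr => k _; rewrite !mxE ImM.
by case: (w k 0) (h k 0) => [a b] [c e] /=; rewrite mulNr.
Qed.

Lemma gainE w h :
  gain w h = complex.Re (cdot w h) ^+ 2 + complex.Im (cdot w h) ^+ 2.
Proof. exact: sqr_normc. Qed.

Lemma gain_ge0 w h : 0 <= gain w h.
Proof. by rewrite gainE addr_ge0 ?sqr_ge0. Qed.

Lemma sqnormE v :
  sqnorm v = \sum_k (complex.Re (v k 0) ^+ 2 + complex.Im (v k 0) ^+ 2).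
Proof. by apply: eq_bigr => k _; rewrite sqr_normc. Qed.

Lemma sqnorm_ge0 v : 0 <= sqnorm v.
Proof. by apply: sumr_ge0 => k _; rewrite sqr_ge0. Qed.

Lemma sqnorm_eq0 v : (sqnorm v == 0) = (v == 0).
Proof.
apply/eqP/eqP => [v0|->]; last first.
  by rewrite sqnormE big1// => k _; rewrite mxE /= expr0n addr0.
apply/matrixP => k j; rewrite ord1 mxE.
have /eqP := v0; rewrite psumr_eq0 => [|i _]; last by rewrite sqr_ge0.
move=> /allP /(_ k); rewrite mem_index_enum sqrf_eq0 => /(_ isT) /eqP.
exact: Normc.eq0_normc.
Qed.

Lemma sqnorm_gt0 v : (0 < sqnorm v) = (v != 0).
Proof. by rewrite lt_neqAle sqnorm_ge0 andbT eq_sym sqnorm_eq0. Qed.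

Lemma cdotC w h : cdot h w = (cdot w h)^*%C.
Proof.
apply/eqP; rewrite eq_complex; apply/andP; split; apply/eqP.
  rewrite Re_cdot -[RHS]/(complex.Re ((cdot w h)^*%C)).
  transitivity (complex.Re (cdot w h)); last by case: (cdot w h).
  by rewrite Re_cdot; apply: eq_bigr => k _; ring.
transitivity (- complex.Im (cdot w h)); last by case: (cdot w h).
by rewrite !Im_cdot -sumrN; apply: eq_bigr => k _; ring.
Qed.

Lemma gainC w h : gain w h = gain h w.
Proof. by rewrite !gainE (cdotC h w); case: (cdot h w) => a b /=; rewrite sqrrN. Qed.

Lemma cdotDr w u v : cdot w (u + v) = cdot w u + cdot w v.
Proof. by rewrite /cdot mulmxDr mxE. Qed.

Lemma cdotZr w z v : cdot w (z *: v) = z * cdot w v.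
Proof. by rewrite /cdot -scalemxAr mxE. Qed.

Lemma Re_cdotvv v : complex.Re (cdot v v) = sqnorm v.
Proof. by rewrite Re_cdot sqnormE; apply: eq_bigr => k _; ring. Qed.

Lemma Im_cdotvv v : complex.Im (cdot v v) = 0.
Proof. by rewrite Im_cdot big1// => k _; ring. Qed.

Lemma sqnormD u v :
  sqnorm (u + v) = sqnorm u + sqnorm v + 2 * complex.Re (cdot u v).
Proof.
rewrite !sqnormE Re_cdot mulr_sumr -!big_split /=; apply: eq_bigr => k _.
rewrite !mxE; case: (u k 0) (v k 0) => [a b] [c e] /=; ring.
Qed.

Lemma sqnormZ z v : sqnorm (z *: v) = Normc.normc z ^+ 2 * sqnorm v.
Proof.
rewrite /sqnorm mulr_sumr; apply: eq_bigr => k _.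
by rewrite mxE Normc.normcM exprMn.
Qed.

Lemma gainZl z w h : gain (z *: w) h = Normc.normc z ^+ 2 * gain w h.
Proof. by rewrite gainC [gain w h]gainC /gain -!/(cdot _ _) cdotZr Normc.normcM exprMn. Qed.

Lemma gainZr z w h : gain w (z *: h) = Normc.normc z ^+ 2 * gain w h.
Proof. by rewrite gainC gainZl gainC. Qed.

Lemma gain_vv v : gain v v = sqnorm v ^+ 2.
Proof. by rewrite gainE Re_cdotvv Im_cdotvv expr0n addr0. Qed.

Lemma sqr_normcR (x : R) : Normc.normc (x%:C)%C ^+ 2 = x ^+ 2.
Proof. by rewrite sqr_normc /= expr0n addr0. Qed.

(** Pythagoras: the vector on the left is [h] minus its orthogonal projection on [w]. Its squared
    norm being nonnegative is the Cauchy-Schwarz inequality, its vanishing the equality case. *)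
Lemma sqnorm_residual w h : w != 0 ->
  sqnorm (h + - (cdot w h * ((sqnorm w)^-1)%:C)%C *: w) =
  sqnorm h - gain w h / sqnorm w.
Proof.
rewrite -sqnorm_eq0 => w0.
rewrite sqnormD sqnormZ cdotZr (cdotC w h) gainE.
have -> : Normc.normc (- (cdot w h * ((sqnorm w)^-1)%:C)%C) ^+ 2 =
  gain w h * (sqnorm w) ^- 2.
  by rewrite normcN Normc.normcM exprMn sqr_normcR exprVn.
rewrite gainE; case: (cdot w h) => a b /=; field.
exact: w0.
Qed.

Lemma gain_le w h : gain w h <= sqnorm w * sqnorm h.
Proof.
have [->|w0] := eqVneq w 0.
  by rewrite gainE Re_cdot Im_cdot !big1 ?expr0n ?addr0 ?mulr_ge0 ?sqnorm_ge0//;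
    move=> k _; rewrite mxE /= !mul0r ?subr0 ?addr0.
have := sqnorm_ge0 (h + - (cdot w h * ((sqnorm w)^-1)%:C)%C *: w).
rewrite sqnorm_residual// subr_ge0 ler_pdivrMr ?sqnorm_gt0//.
by rewrite mulrC.
Qed.

(** Equality in Cauchy-Schwarz makes the residual of [w] along [h] vanish, so [w] is a scalar
    multiple of [h]. A gain does not see the phase of that scalar, and its modulus is fixed by the
    norms. *)
Lemma gain_eq_max w h g : h != 0 -> sqnorm w = 1 -> gain w h = sqnorm h ->
  gain w g = gain h g / sqnorm h.
Proof.
move=> h0 w1 gw.
have := sqnorm_residual w h0; rewrite gainC gw w1.
rewrite divff ?sqnorm_eq0// subrr => /eqP; rewrite sqnorm_eq0 scaleNr subr_eq0.
move=> /eqP wE; rewrite [X in gain X g]wE gainZl Normc.normcM exprMn sqr_normcR.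
rewrite -[Normc.normc _ ^+ 2]/(gain h w) (gainC h w) gw.
by field; rewrite sqnorm_eq0.
Qed.

Lemma ge_sqr_le (x y : R) : 0 <= y -> x ^+ 2 <= y ^+ 2 -> (- y <= x <= y).
Proof. by move=> y0 xy; rewrite -ler_norml -(ler_sqr (normr_ge0 _) y0) real_normK// num_real. Qed.

Lemma Re_cdot_le u v (e x : R) : 0 <= e -> 0 <= x ->
  sqnorm u <= x ^+ 2 -> sqnorm v <= e ^+ 2 -> - (x * e) <= complex.Re (cdot u v) <= x * e.
Proof.
move=> e0 x0 ux ve; apply: ge_sqr_le; first exact: mulr_ge0.
apply: (@le_trans _ _ (gain u v)); first by rewrite gainE lerDl sqr_ge0.
by apply: (le_trans (gain_le _ _)); rewrite exprMn ler_pM// sqnorm_ge0.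
Qed.

Lemma gainDl w u h : gain (w + u) h = gain w h + gain u h +
  2 * (complex.Re (cdot h w) * complex.Re (cdot h u) +
       complex.Im (cdot h w) * complex.Im (cdot h u)).
Proof.
rewrite gainC (gainC w) (gainC u) !gainE cdotDr ReD ImD; ring.
Qed.

(** The threshold is scaled by [sqnorm v] so that [v] may be any vector: normalizing a nonzero [v]
    afterwards gives a unit beam with gain at least [s]. The alternative [s <= 0] covers thresholds
    that vanish identically. *)
Lemma gain_near w h (s : R) : sqnorm w = 1 -> s < gain w h \/ s <= 0 ->
  exists2 e : R, 0 < e & forall v, sqnorm (v - w) <= e -> s * sqnorm v <= gain v h.
Proof.
move=> w1 [sg|s0]; last first.
  exists 1 => // v _; apply: le_trans (gain_ge0 v h).
  by rewrite mulr_le0_ge0// sqnorm_ge0.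
have [s0|s_gt0] := leP s 0.
  exists 1 => // v _; apply: le_trans (gain_ge0 v h).
  by rewrite mulr_le0_ge0// sqnorm_ge0.
set X := sqnorm h; set g := gain w h in sg *.
have X0 : 0 <= X by exact: sqnorm_ge0.
have D0 : 0 < 3 * s + 2 * X + 1 by lra.
(* For [e <= 1] one has [sqnorm v <= 1 + 3 * e] and [g - 2 * X * e <= gain v h], so it suffices that
   [e * (3 * s + 2 * X) <= g - s]. *)
pose e := Num.min 1 ((g - s) / (3 * s + 2 * X + 1)).
have e0 : 0 < e by rewrite lt_min ltr01 divr_gt0// subr_gt0.
have e1 : e <= 1 by rewrite ge_min lexx.
have e2 : e * (3 * s + 2 * X + 1) <= g - s.
  by rewrite -ler_pdivlMr// ge_min lexx orbT.
exists (e ^+ 2); first exact: exprn_gt0.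
move=> v ve; rewrite -(subrK w v) addrC; set u := v - w in ve *.
have w11 : sqnorm w <= 1 ^+ 2 by rewrite w1 expr1n.
have /andP[_ Hs] := Re_cdot_le (ltW e0) ler01 w11 ve.
have Hsq : sqnorm (w + u) <= 1 + 3 * e.
  rewrite sqnormD w1; have : e ^+ 2 <= e by rewrite expr2 ler_piMl// ltW.
  lra.
have gX : g <= X by have := gain_le w h; rewrite w1 mul1r.
have uX : gain u h <= X * e ^+ 2.
  by apply: (le_trans (gain_le _ _)); rewrite mulrC ler_wpM2l.
(* The cross term is a scalar product in the plane; the gap in its Cauchy-Schwarz bound by the two
   gains is [(a * k - b * c) ^+ 2]. *)
have Hc : - (X * e) <= complex.Re (cdot h w) * complex.Re (cdot h u) +
       complex.Im (cdot h w) * complex.Im (cdot h u).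
  apply: (proj1 (andP (ge_sqr_le (mulr_ge0 X0 (ltW e0)) _))).
  apply: (@le_trans _ _ (g * gain u h)).
    rewrite /g gainC (gainC u) !gainE.
    set a := complex.Re _; set b := complex.Im _.
    set c := complex.Re _; set k := complex.Im _.
    have : 0 <= (a * k - b * c) ^+ 2 by exact: sqr_ge0.
    nra.
  rewrite exprMn expr2 -mulrA ler_pM ?gain_ge0//.
rewrite gainDl -/g; have := gain_ge0 u h.
have := ler_wpM2l (ltW s_gt0) Hsq.
nra.
Qed.

Lemma normalized_sqnorm v : v != 0 ->
  sqnorm ((Num.sqrt (sqnorm v))^-1%:C%C *: v) = 1.
Proof.
move=> v0; rewrite sqnormZ sqr_normcR exprVn sqr_sqrtr ?sqnorm_ge0//.
by rewrite mulVf// sqnorm_eq0.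
Qed.

Lemma normalized_gain v h :
  gain ((Num.sqrt (sqnorm v))^-1%:C%C *: v) h = gain v h / sqnorm v.
Proof. by rewrite gainZl sqr_normcR exprVn sqr_sqrtr ?sqnorm_ge0// mulrC. Qed.

(** Moving [w] slightly towards [h], in the phase of [cdot h w], raises the normalized gain as long
    as [w] is not aligned with [h]. A short enough move keeps the other gain above [s] by
    [gain_near]. *)
Lemma gain_improve w h h' (s : R) : sqnorm w = 1 -> gain w h < sqnorm h ->
  s < gain w h' \/ s <= 0 ->
  exists v, [/\ sqnorm v = 1, gain w h < gain v h & s <= gain v h'].
Proof.
move=> w1 gX sg; have [e e0 He] := gain_near w1 sg.
set g := gain w h in gX *; set X := sqnorm h in gX *.
have g0 : 0 <= g by exact: gain_ge0.
have X0 : 0 < X by exact: le_lt_trans gX.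
suff [v [v0 vw gv]] : exists v, [/\ v != 0, sqnorm (v - w) <= e & g * sqnorm v < gain v h].
  exists ((Num.sqrt (sqnorm v))^-1%:C%C *: v); split.
  - exact: normalized_sqnorm.
  - by rewrite normalized_gain ltr_pdivlMr ?sqnorm_gt0.
  - by rewrite normalized_gain ler_pdivlMr ?sqnorm_gt0//; exact: He.
(* With [g = 0] there is no phase to follow, and any small multiple of [h] creates a positive
   gain. *)
have [gz|gn] := eqVneq g 0.
  pose k := Num.min 1 (e / X).
  have k0 : 0 < k by rewrite lt_min ltr01 divr_gt0.
  have k1 : k <= 1 by rewrite ge_min lexx.
  have kX : k * X <= e by rewrite -ler_pdivlMr// ge_min lexx orbT.
  have cz : complex.Re (cdot h w) = 0 /\ complex.Im (cdot h w) = 0.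
    move: gz; rewrite /g gainC gainE => /eqP; rewrite paddr_eq0 ?sqr_ge0//.
    by rewrite !sqrf_eq0 => /andP[/eqP ? /eqP ?].
  have gk : gain (w + k%:C%C *: h) h = k ^+ 2 * X ^+ 2.
    by rewrite gainDl -/g gz gainZl sqr_normcR gain_vv cz.1 cz.2 -/X; ring.
  exists (w + k%:C%C *: h); split.
  - apply: contraTN isT => /eqP vz; have := gk; rewrite vz.
    have -> : gain 0 h = 0 by rewrite -[X in gain X _](scale0r 0) gainZl Normc.normc0 expr0n mul0r.
    move/eqP; rewrite eq_sym mulf_eq0 !sqrf_eq0 (gt_eqF k0) (gt_eqF X0)//.
  - rewrite addrC addKr sqnormZ sqr_normcR -/X (le_trans _ kX)// ler_pM2r//.
    by rewrite expr2 ler_piMl// ltW.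
  - by rewrite gz mul0r gk mulr_gt0// exprn_gt0.
have {gn}g_gt0 : 0 < g by rewrite lt_neqAle eq_sym gn.
pose k := Num.min 1 (e / (g * X)).
have gX0 : 0 < g * X by exact: mulr_gt0.
have k0 : 0 < k by rewrite lt_min ltr01 divr_gt0.
have k1 : k <= 1 by rewrite ge_min lexx.
have kX : k * (g * X) <= e by rewrite -ler_pdivlMr// ge_min lexx orbT.
(* The gain is multiplied by [(1 + k * X) ^+ 2], the squared norm only by
   [1 + 2 * k * g + k ^+ 2 * g * X], and [g < X]. *)
pose v := w + (k%:C%C * cdot h w) *: h.
have nz : Normc.normc (k%:C%C * cdot h w) ^+ 2 = k ^+ 2 * g.
  by rewrite Normc.normcM exprMn sqr_normcR /g gainC.
have gE : g = complex.Re (cdot h w) ^+ 2 + complex.Im (cdot h w) ^+ 2.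
  by rewrite /g gainC gainE.
have gv : gain v h = g * (1 + k * X) ^+ 2.
  rewrite gainDl -/g gainZl nz gain_vv -/X cdotZr (ReM _ (cdot h h)).
  rewrite (ImM _ (cdot h h)) Re_cdotvv Im_cdotvv -/X gE.
  by case: (cdot h w) => a b /=; ring.
have nv : sqnorm v = 1 + 2 * k * g + k ^+ 2 * g * X.
  rewrite sqnormD w1 sqnormZ nz -/X cdotZr (cdotC h w) gE.
  by case: (cdot h w) => a b /=; ring.
exists v; split.
- by rewrite -sqnorm_gt0 nv; nra.
- rewrite /v addrC addKr sqnormZ nz -/X (le_trans _ kX)// -mulrA ler_pM2r//.
  by rewrite expr2 ler_piMl// ltW.
- rewrite gv nv ltr_pM2l//.
  have d0 : 0 < k * (X - g) by rewrite mulr_gt0// subr_gt0.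
  have : 0 < k * (X - g) * (k * X) by rewrite mulr_gt0// mulr_gt0.
  lra.
Qed.

(** The beam is the normalized sum of the two unit directions [a] and [b]. If the real part [c] of
    their product is nonnegative, each gain is at least the fraction [(1 + c) ^+ 2 / (2 + 2 * c)] of
    its maximum, hence at least one half. *)
Lemma balanced_beam h h' : h != 0 -> h' != 0 -> exists v,
  [/\ sqnorm v = 1, sqnorm h / 2 <= gain v h & sqnorm h' / 2 <= gain v h'].
Proof.
move=> h0 h0'.
pose a := (Num.sqrt (sqnorm h))^-1%:C%C *: h.
(* Changing the sign of [b] leaves all gains unchanged and is enough to make [c] nonnegative. *)
have [b b1 [gb cb]] : exists2 b, sqnorm b = 1 &
    (forall v, gain v h' = sqnorm h' * gain v b) /\ 0 <= complex.Re (cdot a b).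
  pose b := (Num.sqrt (sqnorm h'))^-1%:C%C *: h'.
  have gb v : gain v h' = sqnorm h' * gain v b.
    rewrite [gain v b]gainC normalized_gain gainC mulrC divfK// sqnorm_eq0//.
  have [|c0] := leP 0 (complex.Re (cdot a b)).
    by exists b => //; exact: normalized_sqnorm.
  exists (- 1 *: b).
    by rewrite sqnormZ normcN Normc.normc1 expr1n mul1r; exact: normalized_sqnorm.
  split=> [v|]; first by rewrite gainZr normcN Normc.normc1 expr1n mul1r.
  by rewrite cdotZr mulN1r; case: (cdot a b) c0 => x y /= /ltW; rewrite -oppr_ge0.
have a1 : sqnorm a = 1 by exact: normalized_sqnorm.
have ga v : gain v h = sqnorm h * gain v a.
  by rewrite [gain v a]gainC normalized_gain gainC mulrC divfK// sqnorm_eq0.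
set c := complex.Re (cdot a b) in cb.
have nv : sqnorm (a + b) = 2 + 2 * c by rewrite sqnormD a1 b1 -/c; ring.
have v0 : a + b != 0 by rewrite -sqnorm_gt0 nv; lra.
have gge (x : 'cV[R[i]]_M) : 1 + c = complex.Re (cdot x (a + b)) ->
    2^-1 <= gain (a + b) x / sqnorm (a + b).
  move=> cE; rewrite nv ler_pdivlMr; last by lra.
  apply: (@le_trans _ _ ((1 + c) ^+ 2)); first by nra.
  by rewrite cE gainC gainE lerDl sqr_ge0.
exists ((Num.sqrt (sqnorm (a + b)))^-1%:C%C *: (a + b)); split.
- exact: normalized_sqnorm.
- rewrite ga ler_pM2l ?sqnorm_gt0// normalized_gain; apply: gge.
  by rewrite cdotDr ReD Re_cdotvv a1.
- rewrite gb ler_pM2l ?sqnorm_gt0// normalized_gain; apply: gge.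
  by rewrite cdotDr ReD Re_cdotvv b1 addrC (cdotC a b) /c; case: (cdot a b).
Qed.

(** Finite functions into pairs of rationals form a countable type, so unions over these vectors
    stay measurable. *)
Definition rat_vector (f : {ffun 'I_M -> rat * rat}) : 'cV[R[i]]_M :=
  \col_k Complex (ratr (f k).1) (ratr (f k).2).

Lemma rat_vector_dense w (e : R) : 0 < e ->
  exists f, sqnorm (rat_vector f - w) <= e.
Proof.
move=> e0.
(* [d <= 1] turns an error of at most [d] into a squared error of at most [d], so each entry costs
   at most [2 * d]. [M.+1] keeps the denominator nonzero when [M = 0]. *)
pose d := Num.min 1 (e / (2 * M.+1%:R)).
have M0 : 0 < 2 * M.+1%:R :> R by rewrite mulr_gt0// ltr0n.
have d0 : 0 < d by rewrite lt_min ltr01 divr_gt0.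
have d1 : d <= 1 by rewrite ge_min lexx.
have dM : d * (2 * M.+1%:R) <= e by rewrite -ler_pdivlMr// ge_min lexx orbT.
have approx (x : R) : exists q : rat, (ratr q - x) ^+ 2 <= d.
  have [q] := @rat_in_itvoo R x (x + d) ltac:(lra).
  rewrite in_itv /= => /andP[q1 q2]; exists q.
  have : 0 <= ratr q - x <= d by lra.
  move=> /andP[y0 y1]; nra.
have /fin_all_exists[f fE] : forall k : 'I_M, exists q : rat * rat,
    (ratr q.1 - complex.Re (w k 0)) ^+ 2 + (ratr q.2 - complex.Im (w k 0)) ^+ 2 <= 2 * d.
  move=> k; have [q1 H1] := approx (complex.Re (w k 0)).
  have [q2 H2] := approx (complex.Im (w k 0)).
  by exists (q1, q2) => /=; lra.
exists (finfun f); rewrite sqnormE.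
apply: (@le_trans _ _ (\sum_(k < M) (2 * d))).
  apply: ler_sum => k _; apply: le_trans (fE k); rewrite !mxE ffunE.
  by case: (w k 0) => a b /=.
rewrite sumr_const card_ord -[leLHS]mulr_natr (le_trans _ dM)//.
by rewrite [2 * d]mulrC -mulrA ler_pM2l// ler_pM2l// ler_nat.
Qed.

End hermitian_geometry.

(** Packages a pushforward as a bundled measure from a bare proof of measurability, so that
    uniqueness theorems for measures apply to it. *)
Definition image_measure d d' (T1 : measurableType d) (T2 : measurableType d')
    (R : realType) (m : {measure set T1 -> \bar R}) (f : T1 -> T2)
    (mf : measurable_fun setT f) : {measure set T2 -> \bar R} :=
  measure_function_pushforward__canonical__measure_function_Measure m mf.

(** * Affine changes of variable for the Lebesgue measure *)

Section lebesgue_affine.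
Variable R : realType.
Local Notation mu := (@lebesgue_measure R).
Local Open Scope ereal_scope.

Lemma measurable_affine (c b : R) :
  measurable_fun [set: measurableTypeR R] ((fun x => c * x + b)%R : _ -> measurableTypeR R).
Proof.
apply: measurable_funD => //; exact: measurable_funM.
Qed.

(** The image of the Lebesgue measure under the map, rescaled by [c], gives half-open intervals
    their length; uniqueness does the rest. *)
Lemma lebesgue_measure_affine (c b : R) (A : set R) : (0 < c)%R -> measurable A ->
  c%:E * mu ((fun x => c * x + b)%R @^-1` A) = mu A.
Proof.
move=> c0 mA.
pose k : {nonneg R} := NngNum (ltW c0).
pose m' : {measure set (measurableTypeR R) -> \bar R} :=
  mscale k (image_measure mu (measurable_affine c b)).
rewrite -[LHS]/(m' A); apply/esym/lebesgue_measure_unique => //= _ [[x y]] _ <-.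
rewrite /m' /mscale /= /mscale /= /pushforward.
rewrite (_ : _ @^-1` _ = `](x - b) / c, (y - b) / c]%classic)%R; last first.
  apply/seteqP; split=> z; rewrite /= !in_itv /= => /andP[z1 z2].
    by rewrite ltr_pdivrMr// ler_pdivlMr// ltrBlDr lerBrDr mulrC z1.
  by move: z1 z2; rewrite ltr_pdivrMr// ler_pdivlMr// ltrBlDr lerBrDr mulrC => ->.
rewrite !lebesgue_measure_itv/= !lte_fin ltr_pM2r ?invr_gt0// ltrD2r.
case: ifP => _; last by rewrite mule0.
by rewrite -!EFinB -EFinM -mulrBl mulrC divfK ?gt_eqF//; congr EFin; ring.
Qed.

Lemma ge0_integral_affine_pos (c b : R) (f : R -> \bar R) : (0 < c)%R ->
  measurable_fun [set: R] f -> (forall x, 0 <= f x) ->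
  c%:E * \int[mu]_x f (c * x + b)%R = \int[mu]_x f x.
Proof.
move=> c0 mf f0.
pose k : {nonneg R} := NngNum (ltW c0).
pose m' : {measure set (measurableTypeR R) -> \bar R} :=
  mscale k (image_measure mu (measurable_affine c b)).
transitivity (\int[m']_x f x).
  rewrite ge0_integral_mscale//; congr (_ * _).
  by rewrite (ge0_integral_pushforward (measurable_affine c b)).
apply: eq_measure_integral => A mA _.
exact: lebesgue_measure_affine.
Qed.

Lemma ge0_integral_oppr (f : R -> \bar R) :
  measurable_fun [set: R] f -> (forall x, 0 <= f x) ->
  \int[mu]_x f (- x)%R = \int[mu]_x f x.
Proof.
move=> mf f0.
transitivity (\int[pushforward mu (-%R : _ -> measurableTypeR R)]_x f x).
  by rewrite ge0_integral_pushforward.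
by apply: eq_measure_integral => A mA _; exact: lebesgue_measureN.
Qed.

Lemma ge0_integral_affine (c b : R) (f : R -> \bar R) : (c != 0)%R ->
  measurable_fun [set: R] f -> (forall x, 0 <= f x) ->
  `|c|%:E * \int[mu]_x f (c * x + b)%R = \int[mu]_x f x.
Proof.
move=> c0 mf f0; have [c_gt0|c_lt0|c00] := ltgtP c 0%R; last by rewrite c00 eqxx in c0.
  rewrite ltr0_norm// -(@ge0_integral_oppr (fun x => f (c * x + b)%R))//; last first.
    apply: measurableT_comp => //; exact: measurable_affine.
  under eq_integral do rewrite mulrN -mulNr.
  by apply: ge0_integral_affine_pos; rewrite // oppr_gt0.
by rewrite gtr0_norm//; apply: ge0_integral_affine_pos.
Qed.

End lebesgue_affine.

(** * Integration against a density *)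

Section integral_density.
Context d (T : measurableType d) (R : realType).
Variables (mu nu : {measure set T -> \bar R}) (g : T -> R).
Hypotheses (g0 : forall x, 0 <= g x) (mg : measurable_fun setT g).
Hypothesis nuE : forall A, measurable A -> nu A = (\int[mu]_(x in A) (g x)%:E)%E.
Local Open Scope ereal_scope.
Import HBNNSimple.

(** On indicators this is [nuE]. Linearity extends it to simple functions, and monotone convergence
    along [nnsfun_approx], on both sides, to [f]. *)
Lemma ge0_integral_density (f : T -> \bar R) : measurable_fun setT f ->
  (forall x, 0 <= f x) -> \int[nu]_x f x = \int[mu]_x (f x * (g x)%:E).
Proof.
move=> mf f0; pose f_ := nnsfun_approx measurableT mf.
have cvf x : (f_ n x)%:E @[n --> \oo] --> f x.
  by apply: cvg_nnsfun_approx => // y _; exact: f0.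
transitivity (limn (fun n => \int[nu]_x (f_ n x)%:E)).
  rewrite -monotone_convergence//.
  - by apply: eq_integral => y _; apply/esym/cvg_lim.
  - by move=> n; exact/measurable_EFinP/measurable_funP.
  - by move=> n y _; rewrite lee_fin.
  - by move=> y _ m n mn; rewrite lee_fin; exact/lefP/nd_nnsfun_approx.
rewrite [X in limn X](_ : _ =
    (fun n => \int[mu]_x ((f_ n x)%:E * (g x)%:E))).
  rewrite -monotone_convergence//; last 3 first.
    - move=> n; apply: emeasurable_funM; exact/measurable_EFinP.
    - by move=> n x _; rewrite mule_ge0// lee_fin.
    - move=> x _ m n mn; apply: lee_wpmul2r; rewrite lee_fin//.
      exact/lefP/nd_nnsfun_approx.
  apply: eq_integral => y _; apply/cvg_lim => //.
  by apply: cvgeZr => //; exact: cvf.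
apply/funext => n.
transitivity (\sum_(k \in range (f_ n)) \int[nu]_x (k * \1_(f_ n @^-1` [set k]) x)%:E).
  under eq_integral do rewrite fimfunE -fsumEFin//.
  rewrite ge0_integral_fsum//.
  - by move=> y; exact/measurable_EFinP/measurable_funM.
  - by move=> y x _; rewrite nnfun_muleindic_ge0.
transitivity (\sum_(k \in range (f_ n)) \int[mu]_x ((k * \1_(f_ n @^-1` [set k]) x)%:E * (g x)%:E)).
  apply: eq_fsbigr => r /[!inE] -[z _ <-].
  rewrite integralZl_indic_nnsfun// integral_indic// setIT nuE//.
  rewrite [in LHS]integral_mkcond -ge0_integralZl//=.
  - apply: eq_integral => x _; rewrite patchE indicE.
    by case: ifPn => _; rewrite ?mule0 ?mulr1// mulr0 mul0e.
  - by apply/(measurable_restrictT _ _).1 => //; apply: measurable_funTS; exact/measurable_EFinP.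
  - by move=> x _; rewrite patchE; case: ifPn; rewrite ?lee_fin.
  - by rewrite lee_fin.
rewrite -ge0_integral_fsum//.
- apply: eq_integral => x _; rewrite -ge0_mule_fsuml; last first.
    by move=> y; rewrite nnfun_muleindic_ge0.
  by rewrite fsumEFin// -fimfunE.
- move=> y; apply: emeasurable_funM; first exact/measurable_EFinP/measurable_funM.
  exact/measurable_EFinP.
- move=> y x _; apply: mule_ge0; last by rewrite lee_fin.
  exact: nnfun_muleindic_ge0.
Qed.

Lemma integrable_density (f : T -> R) : measurable_fun setT f ->
  nu.-integrable setT (EFin \o f) <-> mu.-integrable setT (fun x => (f x * g x)%:E).
Proof.
move=> mf; have mfg : measurable_fun setT (fun x => (f x * g x)%:E).
  exact/measurable_EFinP/measurable_funM.
have E : \int[nu]_x `|(f x)%:E| = \int[mu]_x `|(f x * g x)%:E|.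
  rewrite ge0_integral_density//; last exact/measurable_EFinP/measurableT_comp.
  by apply: eq_integral => x _; rewrite EFinM abseM [X in _ = _ * X]gee0_abs// lee_fin.
split=> /integrableP[_ H]; apply/integrableP; split => //=.
- by rewrite -E.
- exact/measurable_EFinP.
- by rewrite E.
Qed.

Lemma integral_density (f : T -> R) : measurable_fun setT f ->
  \int[nu]_x (f x)%:E = \int[mu]_x (f x * g x)%:E.
Proof.
move=> mf; rewrite integralE [RHS]integralE; congr (_ - _).
- rewrite ge0_integral_density//; last exact/measurable_funepos/measurable_EFinP.
  apply: eq_integral => x _; rewrite !funeposE -EFin_max -EFinM.
  by rewrite -EFin_max maxr_pMl// mul0r.
- rewrite ge0_integral_density//; last exact/measurable_funeneg/measurable_EFinP.
  apply: eq_integral => x _; rewrite !funenegE -!EFinN -!EFin_max -EFinM.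
  by rewrite maxr_pMl// mul0r mulNr.
Qed.

End integral_density.

(** * Joint laws relative to an event *)

Section joint_law.
Context d (T : measurableType d) (R : realType) (P : probability T R).
Local Open Scope ereal_scope.
Local Notation mR := (measurableTypeR R).

(** [E] collects the constraints on other coordinates and is carried unchanged through the
    inductions. Divided by [P E], the trace of [P] on [E] pushed to the plane agrees with the
    product measure on rectangles, hence everywhere. *)
Lemma joint_law (mu nu : probability mR R) (U V : T -> mR) (E : set T) :
  measurable_fun setT U -> measurable_fun setT V -> measurable E ->
  (forall A B : set mR, measurable A -> measurable B ->
    P (U @^-1` A `&` V @^-1` B `&` E) = mu A * nu B * P E) ->
  forall C : set (mR * mR), measurable C ->
    P ([set t | C (U t, V t)] `&` E) = (mu \x nu) C * P E.
Proof.
move=> mU mV mE H C mC.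
have mUV : measurable_fun setT (fun t => (U t, V t)) by exact: measurable_fun_pair.
have mpre : measurable [set t | C (U t, V t)].
  by rewrite -[X in measurable X]setTI; exact: mUV.
have Pfin : P E \is a fin_num by exact: fin_num_measure.
have [PE0|PE0] := eqVneq (P E) 0.
  rewrite PE0 mule0; apply/eqP; rewrite eq_le measure_ge0 andbT -PE0.
  by rewrite le_measure// inE//; exact: measurableI.
have k0 : (0 <= (fine (P E))^-1)%R by rewrite invr_ge0 fine_ge0.
pose m' : {measure set (mR * mR) -> \bar R} :=
  mscale (NngNum k0) (image_measure (mrestr P mE) mUV).
have PEn0 : fine (P E) != 0%R by rewrite fine_eq0.
have -> : (mu \x nu) C = m' C.
  apply: product_measure_unique => // A B mA mB.
  rewrite /m' /= /mscale /= /pushforward /mrestr.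
  have -> : (fun t => (U t, V t)) @^-1` (A `*` B) = U @^-1` A `&` V @^-1` B.
    by apply/seteqP; split=> t /= [].
  rewrite H//= -(fineK Pfin) muleC -muleA -EFinM mulfV ?fineK ?mule1//.
rewrite /m' /= /mscale /= /pushforward /mrestr muleAC -[X in _ * X * _](fineK Pfin).
by rewrite -EFinM mulVf// mul1e.
Qed.

End joint_law.

(** * Densities of pairs and of sums *)

Lemma indic_preimage (R : pzRingType) (T U : Type) (f : T -> U) (A : set U) (t : T) :
  \1_[set t | A (f t)] t = \1_A (f t) :> R.
Proof. by rewrite !indicE; congr ((nat_of_bool _)%:R); apply/idP/idP; rewrite !inE. Qed.

Section product_density.
Variable R : realType.
Local Open Scope ereal_scope.
Local Notation mR := (measurableTypeR R).
Local Notation lambda := (@lebesgue_measure R).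

Lemma product_densityE (mu nu : probability mR R) (f g : R -> R) :
  (forall x, 0 <= f x)%R -> measurable_fun [set: mR] f ->
  (forall x, 0 <= g x)%R -> measurable_fun [set: mR] g ->
  (forall A, measurable A -> mu A = \int[lambda]_(x in A) (f x)%:E) ->
  (forall A, measurable A -> nu A = \int[lambda]_(x in A) (g x)%:E) ->
  forall C : set (mR * mR), measurable C ->
  (mu \x nu) C =
    \int[lambda]_x \int[lambda]_y (\1_C (x, y) * f x * g y)%:E.
Proof.
move=> f0 mf g0 mg muE nuE C mC.
have mC1 : measurable_fun [set: mR * mR] (EFin \o \1_C : mR * mR -> \bar R).
  by apply/measurable_EFinP; exact: measurable_indic.
transitivity (\int[mu]_x \int[nu]_y (\1_C (x, y))%:E).
  rewrite -(@fubini_tonelli1 _ _ _ _ _ mu nu (EFin \o \1_C))//.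
  - by rewrite integral_indic// setIT.
  - by move=> x; rewrite lee_fin.
rewrite (@ge0_integral_density _ mR R lambda mu f f0 mf muE); last 2 first.
- apply: (@measurable_fun_fubini_tonelli_F _ _ _ _ _ nu (EFin \o \1_C)) => //.
  by move=> z; rewrite lee_fin.
- by move=> x; apply: integral_ge0 => y _; rewrite lee_fin.
apply: eq_integral => x _.
rewrite (@ge0_integral_density _ mR R lambda nu g g0 mg nuE); last 2 first.
- exact: (measurableT_comp mC1 (measurable_pair1 _)).
- by move=> y; rewrite lee_fin.
rewrite -ge0_integralZr//.
- by apply: eq_integral => y _; rewrite -!EFinM mulrAC.
- apply: emeasurable_funM; last exact/measurable_EFinP.
  exact: (measurableT_comp mC1 (measurable_pair1 _)).
- by move=> y _; rewrite -EFinM lee_fin mulr_ge0.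
- by rewrite lee_fin.
Qed.

Lemma tonelli_lebesgue (f : mR -> mR -> R) :
  measurable_fun [set: mR * mR] (fun z => f z.1 z.2) ->
  (forall x y, 0 <= f x y)%R ->
  \int[lambda]_x \int[lambda]_y (f x y)%:E = \int[lambda]_y \int[lambda]_x (f x y)%:E.
Proof.
move=> mf f0.
apply: (@fubini_tonelli _ _ _ _ _ lambda lambda (fun z => (f z.1 z.2)%:E)).
- exact/measurable_EFinP.
- by move=> z; rewrite lee_fin.
Qed.

(** The hypothesis on [h] says that it is the convolution of [f] and [g]. The shift [u = x + y] in
    the inner integral, followed by an exchange of the integrals, isolates it. *)
Lemma density_sum (mu nu : probability mR R) (f g h : R -> R) :
  (forall x, 0 <= f x)%R -> measurable_fun [set: mR] f ->
  (forall x, 0 <= g x)%R -> measurable_fun [set: mR] g ->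
  (forall A, measurable A -> mu A = \int[lambda]_(x in A) (f x)%:E) ->
  (forall A, measurable A -> nu A = \int[lambda]_(x in A) (g x)%:E) ->
  (forall u, \int[lambda]_x (f x * g (u - x))%:E = (h u)%:E) ->
  forall A : set mR, measurable A ->
  (mu \x nu) [set z : mR * mR | A (z.1 + z.2)%R] = \int[lambda]_(u in A) (h u)%:E.
Proof.
move=> f0 mf g0 mg muE nuE hE A mA.
have mC : measurable [set z : mR * mR | A (z.1 + z.2)%R].
  rewrite -[X in measurable X]setTI.
  by apply: (measurable_funD (measurable_fst) (measurable_snd)).
rewrite (product_densityE f0 mf g0 mg muE nuE)//.
pose F (x u : mR) := (\1_A u * f x * g (u - x))%R.
have F0 x u : (0 <= F x u)%R by rewrite !mulr_ge0.
have mF : measurable_fun [set: mR * mR] (fun z => F z.1 z.2).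
  apply: measurable_funM; first apply: measurable_funM.
  - by apply: measurableT_comp; [exact: measurable_indic|exact: measurable_snd].
  - exact: (measurableT_comp mf measurable_fst).
  - by apply: (measurableT_comp mg); exact: measurable_funB.
transitivity (\int[lambda]_x \int[lambda]_u (F x u)%:E).
  apply: eq_integral => x _.
  rewrite -(@ge0_integral_affine_pos R 1 x (fun u => (F x u)%:E))//.
  - rewrite mul1e; apply: eq_integral => y _; rewrite /F mul1r addrK addrC.
    by rewrite -(indic_preimage _ (fun z : mR * mR => z.1 + z.2)%R A (x, y)).
  - apply/measurable_EFinP.
    exact: (measurableT_comp mF (measurable_pair1 _)).
  - by move=> u; rewrite lee_fin.
rewrite (tonelli_lebesgue mF F0) [RHS]integral_mkcond.
apply: eq_integral => u _; rewrite patchE /F indicE.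
case: ifPn => uA; last first.
  by apply: integral0_eq => x _; rewrite !mul0r.
by under eq_integral do rewrite mul1r.
Qed.

End product_density.

(** * Sums and rotations of centred normal variables *)

Section normal_pairs.
Variable R : realType.
Local Open Scope ereal_scope.
Local Notation mR := (measurableTypeR R).
Local Notation lambda := (@lebesgue_measure R).

Lemma normal_pdf_sqrtE (m s x : R) : (0 < s)%R ->
  normal_pdf m s x =
    ((s * Num.sqrt (pi *+ 2))^-1 * expR (- (x - m) ^+ 2 / (s ^+ 2 *+ 2)))%R.
Proof.
move=> s0; rewrite normal_pdfE ?gt_eqF// /normal_peak /normal_fun -mulrnAr.
by rewrite sqrtrM ?sqr_ge0// sqrtr_sqr gtr0_norm.
Qed.

(** Completing the square in [x]: the second factor on the right is a probability density in [x], so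
    integrating over [x] leaves the normal density of the sum. *)
Lemma normal_pdf_sum (s t u x : R) : (0 < s)%R -> (0 < t)%R ->
  let q := Num.sqrt (s ^+ 2 + t ^+ 2) in
  (normal_pdf 0 s x * normal_pdf 0 t (u - x) =
   normal_pdf 0 q u * normal_pdf (s ^+ 2 * u / q ^+ 2) (s * t / q) x)%R.
Proof.
move=> s0 t0 q.
have q2 : (q ^+ 2 = s ^+ 2 + t ^+ 2)%R by rewrite sqr_sqrtr// addr_ge0// sqr_ge0.
have q0 : (0 < q)%R by rewrite sqrtr_gt0 addr_gt0// exprn_gt0.
have k0 : (0 < Num.sqrt (pi *+ 2) :> R)%R by rewrite sqrtr_gt0 mulrn_wgt0// pi_gt0.
rewrite !normal_pdf_sqrtE ?divr_gt0 ?mulr_gt0//.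
rewrite mulrACA [RHS]mulrACA -!expRD; congr (_ * expR _)%R.
  by field; rewrite !gt_eqF.
have st0 : (s ^+ 2 + t ^+ 2 != 0)%R by rewrite -q2 gt_eqF// exprn_gt0.
rewrite !exprMn !exprVn !q2; field.
by rewrite st0 !gt_eqF.
Qed.

Lemma normal_prob_sum (s t : R) (A : set mR) : (0 < s)%R -> (0 < t)%R -> measurable A ->
  (normal_prob 0 s \x normal_prob 0 t) [set z : mR * mR | A (z.1 + z.2)%R] =
  normal_prob 0 (Num.sqrt (s ^+ 2 + t ^+ 2)) A.
Proof.
move=> s0 t0 mA.
apply: (density_sum (f := normal_pdf 0 s) (g := normal_pdf 0 t))=> //.
- exact: normal_pdf_ge0.
- exact: measurable_normal_pdf.
- exact: normal_pdf_ge0.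
- exact: measurable_normal_pdf.
- move=> u; under eq_integral do rewrite (normal_pdf_sum _ _ s0 t0) EFinM.
  rewrite ge0_integralZl//.
  + by rewrite integral_normal_pdf mule1.
  + by apply/measurable_EFinP; exact: measurable_normal_pdf.
  + by move=> x _; rewrite lee_fin normal_pdf_ge0.
  + by rewrite lee_fin normal_pdf_ge0.
Qed.

(** The map is a rotation combined with a scaling, of Jacobian [c ^+ 2 + e ^+ 2]. It is reduced to
    affine changes of one variable at a time, with an exchange of the integrals between them. *)
Lemma ge0_integral_similarity (c e : R) (F : mR -> mR -> R) : (0 < c ^+ 2 + e ^+ 2)%R ->
  measurable_fun [set: mR * mR] (fun z => F z.1 z.2) ->
  (forall x y, 0 <= F x y)%R ->
  (c ^+ 2 + e ^+ 2)%:E *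
    \int[lambda]_x \int[lambda]_y (F (c * x - e * y) (e * x + c * y))%:E =
  \int[lambda]_u \int[lambda]_v (F u v)%:E.
Proof.
move=> r0 mF F0; set r := (c ^+ 2 + e ^+ 2)%R in r0 *.
have msec x : measurable_fun [set: mR] (fun y => (F x y)%:E).
  by apply/measurable_EFinP; exact: (measurableT_comp mF (measurable_pair1 _)).
have mlin (a b : R) : measurable_fun [set: mR * mR] (fun z : mR * mR => (a * z.1 + b * z.2)%R).
  by apply: measurable_funD; exact: measurable_funM.
have mcomp (f g : mR * mR -> mR) : measurable_fun setT f -> measurable_fun setT g ->
    measurable_fun [set: mR * mR] (fun z => F (f z) (g z)).
  move=> mf mg; apply: (measurableT_comp mF (measurable_fun_pair mf mg)).
(* For [c = 0] the map is a scaled quarter turn, which only exchanges the variables. *)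
have [c0|c0] := eqVneq c 0%R.
  have e0 : (e != 0)%R by apply/eqP => e0; move: r0; rewrite /r c0 e0 expr0n addr0 ltxx.
  have rE : r = (`|- e| * `|e|)%R by rewrite normrN -expr2 real_normK ?num_real// /r c0 expr0n add0r.
  transitivity (`|- e|%:E * \int[lambda]_y (\int[lambda]_v (F (- e * y + 0) v)%:E)); last first.
    rewrite (@ge0_integral_affine R (- e) 0 (fun u => \int[lambda]_v (F u v)%:E)) ?oppr_eq0//.
    - apply: (@measurable_fun_fubini_tonelli_F _ _ _ _ _ lambda ( fun z => (F z.1 z.2)%:E)).
      + exact/measurable_EFinP.
      + by move=> z; rewrite lee_fin.
    - by move=> x; apply: integral_ge0 => y _; rewrite lee_fin.
  rewrite rE EFinM -muleA; congr (_ * _).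
  rewrite (@tonelli_lebesgue _ (fun x y => F (c * x - e * y) (e * x + c * y))%R)//; last first.
    apply: mcomp; last exact: mlin.
    under eq_fun do rewrite -mulNr; exact: mlin.
  rewrite -ge0_integralZl//.
  - apply: eq_integral => y _.
    rewrite -(@ge0_integral_affine R e 0 (fun v => (F (- e * y + 0) v)%:E))//.
    + congr (_ * _); apply: eq_integral => x _.
      by rewrite c0 !mul0r add0r !addr0 mulNr.
    + exact: msec.
    + by move=> v; rewrite lee_fin.
  - apply: (@measurable_fun_fubini_tonelli_G _ _ _ _ _ lambda
      ( fun z => (F (c * z.1 - e * z.2) (e * z.1 + c * z.2))%:E)).
    + apply/measurable_EFinP; apply: mcomp; last exact: mlin.
      by under eq_fun do rewrite -mulNr; exact: mlin.
    + by move=> z; rewrite lee_fin.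
  - by move=> y _; apply: integral_ge0 => x _; rewrite lee_fin.
have rE : r = (`|c| * `|r / c|)%R.
  by rewrite -normrM mulrC divfK// gtr0_norm.
(* For fixed [y], putting [u = c * x - e * y] turns the second argument into
   [r / c * y + e / c * u]. The map thus splits into two substitutions in one variable, of factors
   [c] and [r / c]. *)
pose G (u y : mR) := F u (r / c * y + e / c * u)%R.
have mG : measurable_fun [set: mR * mR] (fun z => G z.1 z.2).
  apply: mcomp => //.
  under eq_fun do rewrite addrC; exact: mlin.
have G0 u y : (0 <= G u y)%R by exact: F0.
transitivity (`|r / c|%:E * \int[lambda]_u \int[lambda]_y (G u y)%:E); last first.
  rewrite -ge0_integralZl//; last 2 first.
  - apply: (@measurable_fun_fubini_tonelli_F _ _ _ _ _ lambda ( fun z => (G z.1 z.2)%:E)).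
    + exact/measurable_EFinP.
    + by move=> z; rewrite lee_fin.
  - by move=> y _; apply: integral_ge0 => x _; rewrite lee_fin.
  apply: eq_integral => u _.
  rewrite (@ge0_integral_affine R (r / c) (e / c * u) (fun v => (F u v)%:E))//.
  - by rewrite mulf_neq0 ?invr_eq0// gt_eqF.
  - exact: msec.
  - by move=> v; rewrite lee_fin.
rewrite {1}rE (mulrC `|c|%R) EFinM -muleA; congr (_ * _).
rewrite (@tonelli_lebesgue _ (fun x y => F (c * x - e * y) (e * x + c * y))%R)//; last first.
  apply: mcomp; last exact: mlin.
  under eq_fun do rewrite -mulNr; exact: mlin.
rewrite (tonelli_lebesgue mG G0).
rewrite -ge0_integralZl//; last 2 first.
- apply: (@measurable_fun_fubini_tonelli_G _ _ _ _ _ lambda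
    ( fun z => (F (c * z.1 - e * z.2) (e * z.1 + c * z.2))%:E)).
  + apply/measurable_EFinP; apply: mcomp; last exact: mlin.
    by under eq_fun do rewrite -mulNr; exact: mlin.
  + by move=> z; rewrite lee_fin.
- by move=> y _; apply: integral_ge0 => x _; rewrite lee_fin.
apply: eq_integral => y _.
rewrite -(@ge0_integral_affine R c (- e * y) (fun u => (G u y)%:E))//.
- congr (_ * _); apply: eq_integral => x _; rewrite /G mulNr; congr (F _ _)%:E.
  by rewrite /r; field.
- apply/measurable_EFinP.
  exact: (measurableT_comp mG (measurable_pair2 _)).
- by move=> u; rewrite lee_fin.
Qed.

(** The map multiplies [x ^+ 2 + y ^+ 2] by [c ^+ 2 + e ^+ 2], so the density of the pair is carried
    to one of the same kind. In complex terms this is multiplication by the constant with parts [c]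
    and [e]: real and imaginary parts stay independent. *)
Lemma normal_prob_similarity (c e s : R) (A B : set mR) : (0 < c ^+ 2 + e ^+ 2)%R ->
  (0 < s)%R -> measurable A -> measurable B ->
  let q := (Num.sqrt (c ^+ 2 + e ^+ 2) * s)%R in
  (normal_prob 0 s \x normal_prob 0 s)
    [set z : mR * mR | A (c * z.1 - e * z.2)%R /\ B (e * z.1 + c * z.2)%R] =
  normal_prob 0 q A * normal_prob 0 q B.
Proof.
move=> r0 s0 mA mB q.
have q2 : (q ^+ 2 = (c ^+ 2 + e ^+ 2) * s ^+ 2)%R by rewrite exprMn sqr_sqrtr// ltW.
have q0 : (0 < q)%R by rewrite mulr_gt0// sqrtr_gt0.
have mlin (a b : R) : measurable_fun [set: mR * mR] (fun z : mR * mR => (a * z.1 + b * z.2)%R).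
  by apply: measurable_funD; exact: measurable_funM.
have mC : measurable [set z : mR * mR | A (c * z.1 - e * z.2)%R /\ B (e * z.1 + c * z.2)%R].
  apply: measurableI; rewrite -[X in measurable X]setTI.
    by under eq_fun do rewrite -mulNr; exact: mlin.
  exact: mlin.
rewrite (product_densityE (f := normal_pdf 0 s) (g := normal_pdf 0 s))//; last 4 first.
- exact: normal_pdf_ge0.
- exact: measurable_normal_pdf.
- exact: normal_pdf_ge0.
- exact: measurable_normal_pdf.
pose F (u v : mR) := (\1_A u * normal_pdf 0 q u * (\1_B v * normal_pdf 0 q v))%R.
have F0 u v : (0 <= F u v)%R by rewrite !mulr_ge0// normal_pdf_ge0.
have mAq (D : set mR) : measurable D -> measurable_fun [set: mR] (fun u => \1_D u * normal_pdf 0 q u)%R.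
  by move=> mD; apply: measurable_funM; [exact: measurable_indic|exact: measurable_normal_pdf].
have mF : measurable_fun [set: mR * mR] (fun z => F z.1 z.2).
  by apply: measurable_funM; apply: (measurableT_comp (mAq _ _)).
have intD (D : set mR) : measurable D ->
    \int[lambda]_v (\1_D v * normal_pdf 0 q v)%:E = normal_prob 0 q D.
  move=> mD; rewrite /normal_prob [RHS]integral_mkcond; apply: eq_integral => v _.
  by rewrite patchE indicE; case: ifP => _; rewrite ?mul1r ?mul0r.
transitivity (\int[lambda]_u \int[lambda]_v (F u v)%:E).
  rewrite -(ge0_integral_similarity r0 mF F0).
  rewrite -ge0_integralZl//; last 3 first.
  - apply: (@measurable_fun_fubini_tonelli_F _ _ _ _ _ lambda
      (fun z => (F (c * z.1 - e * z.2) (e * z.1 + c * z.2))%:E)).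
    + apply/measurable_EFinP; apply: (measurableT_comp mF (measurable_fun_pair _ _)).
        by under eq_fun do rewrite -mulNr; exact: mlin.
      exact: mlin.
    + by move=> z; rewrite lee_fin.
  - by move=> x _; apply: integral_ge0 => y _; rewrite lee_fin.
  - by rewrite lee_fin ltW.
  apply: eq_integral => x _; rewrite -ge0_integralZl//; last 3 first.
  - apply/measurable_EFinP.
    have mp : measurable_fun [set: mR * mR]
        (fun z : mR * mR => (c * z.1 - e * z.2, e * z.1 + c * z.2)%R).
      apply: measurable_fun_pair; last exact: mlin.
      by under eq_fun do rewrite -mulNr; exact: mlin.
    exact: (measurableT_comp (measurableT_comp mF mp) (measurable_pair1 x)).
  - by move=> y _; rewrite lee_fin.
  - by rewrite lee_fin ltW.
  apply: eq_integral => y _; rewrite -EFinM /F; congr EFin.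
  rewrite (_ : \1__ (x, y) = \1_A (c * x - e * y) * \1_B (e * x + c * y))%R; last first.
    rewrite !indicE -natrM mulnb; congr ((nat_of_bool _)%:R).
    by apply/idP/andP; rewrite !inE.
  have k0 : (0 < Num.sqrt (pi *+ 2) :> R)%R by rewrite sqrtr_gt0 mulrn_wgt0// pi_gt0.
  have -> : (normal_pdf 0 s x = (s * Num.sqrt (pi *+ 2))^-1 * expR (- x ^+ 2 / (s ^+ 2 *+ 2)))%R.
    by rewrite normal_pdf_sqrtE// subr0.
  have -> : (normal_pdf 0 s y = (s * Num.sqrt (pi *+ 2))^-1 * expR (- y ^+ 2 / (s ^+ 2 *+ 2)))%R.
    by rewrite normal_pdf_sqrtE// subr0.
  rewrite !normal_pdf_sqrtE// !subr0.
  set a := \1_A _; set b := \1_B _.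
  have eE : (expR (- x ^+ 2 / (s ^+ 2 *+ 2)) * expR (- y ^+ 2 / (s ^+ 2 *+ 2)) =
     expR (- (c * x - e * y) ^+ 2 / (q ^+ 2 *+ 2)) *
     expR (- (e * x + c * y) ^+ 2 / (q ^+ 2 *+ 2)))%R.
    rewrite -!expRD; congr expR; rewrite q2; field.
    by rewrite (gt_eqF s0) (gt_eqF r0).
  set E1 := expR _ in eE *; set E2 := expR _ in eE *.
  set E3 := expR _ in eE *; set E4 := expR _ in eE *.
  transitivity (a * b * (s * Num.sqrt (pi *+ 2)) ^- 2 * (E1 * E2))%R.
    by field; rewrite !gt_eqF.
  rewrite eE; transitivity ((c ^+ 2 + e ^+ 2) * a * b * ((q ^+ 2) * Num.sqrt (pi *+ 2) ^+ 2)^-1 * (E3 * E4))%R.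
    by rewrite q2; field; rewrite !gt_eqF.
  by field; rewrite !gt_eqF.
under eq_integral.
  move=> u _; under eq_integral do rewrite EFinM.
  rewrite ge0_integralZl//; last 3 first.
  - by apply/measurable_EFinP; exact: mAq.
  - by move=> v _; rewrite lee_fin mulr_ge0// normal_pdf_ge0.
  - by rewrite lee_fin mulr_ge0// normal_pdf_ge0.
  rewrite intD//; over.
rewrite ge0_integralZr ?intD//.
- by apply/measurable_EFinP; exact: mAq.
- by move=> v _; rewrite lee_fin mulr_ge0// normal_pdf_ge0.
Qed.

End normal_pairs.

(** * Squared radius of a normal pair, and Gamma densities *)

Section gaussian_radius.
Variable R : realType.
Local Open Scope ereal_scope.
Local Notation mR := (measurableTypeR R).
Local Notation lambda := (@lebesgue_measure R).

(** Half-open intervals are differences of half-lines, and they generate the Borel sets and are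
    stable under intersection. Finiteness gives the differences a meaning. *)
Lemma finite_measure_eq_itvNyc (mu nu : {measure set mR -> \bar R}) :
  mu setT < +oo -> (forall x : R, mu `]-oo, x]%classic = nu `]-oo, x]%classic) ->
  forall A : set mR, measurable A -> mu A = nu A.
Proof.
move=> muT munu A mA; apply: (@measure_unique _ R mR (@ocitv R) (fun n : nat => `](- n%:R)%R, n%:R%R]%classic)).
- by [].
- exact: ocitvI.
- by move=> n; exact: is_ocitv.
- by rewrite bigcup_itvT.
- move=> _ [[a b] _ <-] /=; have [ab|ba] := leP b a.
    by rewrite set_itv_ge ?measure0// bnd_simp -leNgt.
  have -> : `]a, b]%classic = `]-oo, b]%classic `\` `]-oo, a]%classic :> set R.
    by rewrite -[RHS]setCK setCD setCitvl setUC -[LHS]setCK setCitv.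
  have fin x : mu `]-oo, x]%classic < +oo.
    by apply: le_lt_trans muT; apply: le_measure; rewrite ?inE.
  rewrite !measureD//; [|by move: (fin b); rewrite munu|exact: fin].
  rewrite setIidr; first by congr (_ - _); exact: munu.
  by apply: subset_itvl; rewrite bnd_simp ltW.
- by move=> n; apply: le_lt_trans muT; apply: le_measure; rewrite ?inE.
- exact: mA.
Qed.

(** The law of the squared radius in polar coordinates, [2 * z * expR (- z ^+ 2)] on the half-line,
    spread evenly over the whole line by the absolute value. On the whole line a rescaling of [z]
    does not move the domain. *)
Definition radial_mass (D : set R) : \bar R :=
  \int[lambda]_z (`|z| * \1_D (z ^+ 2) * expR (- z ^+ 2))%:E.

Lemma measurable_radial (D : set R) : measurable D -> measurable_fun [set: mR]
    (fun z : mR => (`|z| * \1_D (z ^+ 2) * expR (- z ^+ 2)))%R.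
Proof.
move=> mD; apply: measurable_funM; first apply: measurable_funM.
- exact: normr_measurable.
- by apply: (measurableT_comp (measurable_indic mD)); exact: measurable_funX.
- by apply: measurableT_comp => //; apply: measurableT_comp => //; exact: measurable_funX.
Qed.

Lemma radial_massE (D : set R) : measurable D ->
  radial_mass D = 2%:E * \int[lambda]_(z in `[0%R, +oo[) (z * expR (- z ^+ 2) * \1_D (z ^+ 2))%:E.
Proof.
move=> mD; pose f z := (`|z| * \1_D (z ^+ 2) * expR (- z ^+ 2))%R.
have mf : measurable_fun [set: mR] (EFin \o f) by apply/measurable_EFinP; exact: measurable_radial mD.
have f0 z : 0 <= (EFin \o f) z by rewrite lee_fin !mulr_ge0// expR_ge0.
have fpos : \int[lambda]_(z in `[0%R, +oo[) (f z)%:E =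
    \int[lambda]_(z in `[0%R, +oo[) (z * expR (- z ^+ 2) * \1_D (z ^+ 2))%:E.
  apply: eq_integral => z; rewrite inE /= in_itv /= andbT => z0.
  by rewrite /f ger0_norm// mulrAC.
rewrite -fpos /radial_mass -(setUv `[0%R, +oo[%classic) ge0_integral_setU//=; last 3 first.
- exact: measurableC.
- by rewrite setUv; exact: mf.
- exact/disj_setPCl.
rewrite setCitvr [X in _ + X](_ : _ = \int[lambda]_(z in `[0%R, +oo[) (f z)%:E); last first.
  rewrite (ge0_integration_by_substitution0 mf f0)/=.
  rewrite -integral_itv_bndo_bndc//; last by apply: measurable_funTS; apply: (measurableT_comp mf).
  by apply: eq_integral => z _; rewrite /= /f normrN sqrrN.
by rewrite -[X in X + _]mul1e -[X in _ + X]mul1e -ge0_muleDl.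
Qed.

Lemma derivable1_cvg (f : R -> R) (x : R) : derivable f x 1%R -> f y @[y --> x] --> f x.
Proof. by move=> /derivable1_diffP /differentiable_continuous. Qed.

Lemma derive_halfgauss (z : R) :
  is_derive z 1%R (fun z => - (expR (- z ^+ 2) / 2))%R (z * expR (- z ^+ 2))%R.
Proof.
apply: is_derive_eq.
by rewrite /GRing.scale /=; field.
Qed.

Lemma radial_massT : radial_mass setT = 1.
Proof.
rewrite radial_massE//.
under eq_integral do rewrite indicT mulr1.
rewrite (@ge0_continuous_FTC2y _ _ (fun z => - (expR (- z ^+ 2) / 2))%R 0 0%R)//.
- by rewrite expr0n /= oppr0 expR0 -EFinB -EFinM; congr EFin; field.
- by move=> z z0; rewrite mulr_ge0// expR_ge0.
- by apply: derivable_within_continuous => z _; exact: ex_derive.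
- rewrite -oppr0; apply: cvgN; rewrite -(mul0r 2^-1)%R; apply: cvgM; last exact: cvg_cst.
  apply: (@squeeze_cvgr _ _ _ _ (cst 0%R) (fun x => expR (- x))) => //.
  + near=> x; rewrite expR_ge0 ler_expR lerN2 expr2 ler_peMl//.
  + exact: cvg_cst.
  + exact: cvgr_expR.
- by apply: cvg_at_right_filter; apply: derivable1_cvg; exact: ex_derive.
- by move=> z _; rewrite derive1E; have [_ ->] := derive_halfgauss z.
Unshelve. all: by end_near. Qed.

Lemma radial_mass_itvNyc (x : R) : (0 <= x)%R ->
  radial_mass `]-oo, x]%classic = (1 - expR (- x))%:E.
Proof.
move=> x0; rewrite radial_massE//.
have -> : \int[lambda]_(z in `[0%R, +oo[) (z * expR (- z ^+ 2) * \1_`]-oo, x] (z ^+ 2))%:E =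
    \int[lambda]_(z in `[0%R, Num.sqrt x]) (z * expR (- z ^+ 2))%:E.
  rewrite [LHS]integral_mkcond [RHS]integral_mkcond; apply: eq_integral => z _.
  rewrite !patchE indicE !mem_setE !in_itv /= andbT.
  have [z0|//] := leP 0%R z; rewrite /=.
  have -> : (z <= Num.sqrt x)%R = (z ^+ 2 <= x)%R.
    by rewrite -[in RHS](sqr_sqrtr x0) ler_sqr// nnegrE sqrtr_ge0.
  by case: ifP => _; rewrite ?mulr1 ?mulr0.
move: x0; rewrite le_eqVlt => /predU1P[<-|x0].
  by rewrite sqrtr0 set_itv1 integral_set1 mule0 oppr0 expR0 subrr.
rewrite (@continuous_FTC2 _ _ (fun z => - (expR (- z ^+ 2) / 2))%R) ?sqrtr_gt0//.
- rewrite expr0n /= oppr0 expR0 sqr_sqrtr ?ltW// -EFinB -EFinM; congr EFin; field.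
- by [].
- by apply: derivable_within_continuous => z _; exact: ex_derive.
- split.
  + by move=> z _; exact: ex_derive.
  + by apply: cvg_at_right_filter; apply: derivable1_cvg; exact: ex_derive.
  + by apply: cvg_at_left_filter; apply: derivable1_cvg; exact: ex_derive.
- by move=> z _; rewrite derive1E; have [_ ->] := derive_halfgauss z.
Qed.

(* Substituting [y = x * u] and then rescaling [x] separates the variables. *)
Lemma normal_radius (s : R) (D : set R) : (0 < s)%R -> measurable D ->
  (normal_prob 0 s \x normal_prob 0 s)
    [set z : mR * mR | D ((z.1 ^+ 2 + z.2 ^+ 2) / (s ^+ 2 *+ 2))%R] =
  radial_mass D.
Proof.
move=> s0 mD.
have mr : measurable_fun [set: mR * mR] (fun z : mR * mR => (z.1 ^+ 2 + z.2 ^+ 2) / (s ^+ 2 *+ 2))%R.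
  by apply: measurable_funM => //; apply: measurable_funD; exact: measurable_funX.
have K0 (D' : set R) z : (0 <= `|z| * \1_D' (z ^+ 2) * expR (- z ^+ 2))%R.
  by rewrite !mulr_ge0// expR_ge0.
pose kap : R := ((s * Num.sqrt (pi *+ 2)) ^- 2)%R.
have kap0 : (0 <= kap)%R by rewrite invr_ge0 sqr_ge0.
pose sg2 : R := (s ^+ 2 *+ 2)%R.
have sg0 : (0 < sg2)%R by rewrite mulrn_wgt0// exprn_gt0.
(* The factor left over from the variable [u = y / x]. It is not computed: [main] with the full set
   shows that it equals [1]. *)
pose C0 := \int[lambda]_u (kap * sg2 / (1 + u ^+ 2))%:E.
have main (D' : set R) : measurable D' ->
  (normal_prob 0 s \x normal_prob 0 s)
    [set z : mR * mR | D' ((z.1 ^+ 2 + z.2 ^+ 2) / sg2)%R] = C0 * radial_mass D'.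
  move=> mD'.
  rewrite (product_densityE (f := normal_pdf 0 s) (g := normal_pdf 0 s))//; last 5 first.
  - exact: normal_pdf_ge0.
  - exact: measurable_normal_pdf.
  - exact: normal_pdf_ge0.
  - exact: measurable_normal_pdf.
  - by rewrite -[X in measurable X]setTI; exact: mr.
  pose H (t : R) := (\1_D' t * kap * expR (- t))%R.
  have mH : measurable_fun [set: mR] H.
    apply: measurable_funM; first by apply: measurable_funM => //; exact: measurable_indic.
    by apply: measurableT_comp => //; exact: measurableT_comp.
  have H0 t : (0 <= H t)%R by rewrite !mulr_ge0// expR_ge0.
  pose F (x u : mR) := (`|x| * H (x ^+ 2 * (1 + u ^+ 2) / sg2))%R.
  have F0 x u : (0 <= F x u)%R by rewrite mulr_ge0.
  have mF : measurable_fun [set: mR * mR] (fun z => F z.1 z.2).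
    apply: measurable_funM; first exact: (measurableT_comp (@normr_measurable _ _) measurable_fst).
    apply: (measurableT_comp mH); apply: measurable_funM => //.
    by apply: measurable_funM; [exact: measurable_funX|apply: measurable_funD => //; exact: measurable_funX].
  transitivity (\int[lambda]_x \int[lambda]_u (F x u)%:E).
    have pdfE (x y : R) : (\1_[set z : mR * mR | D' ((z.1 ^+ 2 + z.2 ^+ 2) / sg2)%R] (x, y) *
        normal_pdf 0 s x * normal_pdf 0 s y = H ((x ^+ 2 + y ^+ 2) / sg2))%R.
      rewrite (indic_preimage _ (fun z : mR * mR => (z.1 ^+ 2 + z.2 ^+ 2) / sg2)%R D' (x, y)) /=.
      rewrite !normal_pdf_sqrtE// !subr0 /H -mulrA; rewrite -[in RHS]mulrA; congr (_ * _)%R.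
      rewrite mulrACA -expRD -expr2 exprVn; congr (_ * expR _)%R.
      by rewrite /sg2; field; rewrite gt_eqF.
    (* The substitution [y = x * u] is available except at [x = 0], which is a null set. *)
    apply: ae_eq_integral => //.
    - apply: (@measurable_fun_fubini_tonelli_F _ _ _ _ _ lambda (fun z => (\1_[set z : mR * mR | D' ((z.1 ^+ 2 + z.2 ^+ 2) / sg2)%R] z *
        normal_pdf 0 s z.1 * normal_pdf 0 s z.2)%:E)).
      + apply/measurable_EFinP.
        under eq_fun => z do rewrite [z in \1__ z]surjective_pairing pdfE.
        apply: (measurableT_comp mH mr).
      + by move=> z; rewrite lee_fin !mulr_ge0// normal_pdf_ge0.
    - apply: (@measurable_fun_fubini_tonelli_F _ _ _ _ _ lambda (fun z => (F z.1 z.2)%:E)).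
      + exact/measurable_EFinP.
      + by move=> z; rewrite lee_fin.
    exists [set 0%R]; split => //; first exact: lebesgue_measure_set1.
    move=> x /= /not_implyP[_]; apply: contra_notP => /eqP x0.
    under eq_integral do rewrite pdfE.
    rewrite -(@ge0_integral_affine R x 0 (fun y => (H ((x ^+ 2 + y ^+ 2) / sg2))%:E))//.
    - rewrite -ge0_integralZl//.
      + apply: eq_integral => u _; rewrite -EFinM /F addr0; congr (_ * H (_ / _))%:E; ring.
      + apply/measurable_EFinP; apply: (measurableT_comp mH); apply: measurable_funM => //.
        apply: measurable_funD => //; apply: measurable_funX.
        by apply: measurable_funD => //; exact: measurable_funM.
      + by move=> u _; rewrite lee_fin.
    - apply/measurable_EFinP; apply: (measurableT_comp mH); apply: measurable_funM => //.
      by apply: measurable_funD => //; exact: measurable_funX.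
    - by move=> u; rewrite lee_fin.
  rewrite (tonelli_lebesgue mF F0) /C0 -ge0_integralZr//; last 3 first.
  - apply/measurable_EFinP; apply: measurable_funM => //.
    apply: continuous_measurable_fun => u; apply: derivable1_cvg.
    by apply: derivableV; [rewrite gt_eqF// ltr_pwDl// sqr_ge0|exact: ex_derive].
  - move=> u _; rewrite lee_fin divr_ge0 ?mulr_ge0 ?(ltW sg0)//.
    by rewrite addr_ge0// sqr_ge0.
  - by apply: integral_ge0 => z _; rewrite lee_fin.
  apply: eq_integral => u _.
  have u1 : (0 < 1 + u ^+ 2)%R by rewrite ltr_pwDl// sqr_ge0.
  (* [(k * x) ^+ 2 = x ^+ 2 * (1 + u ^+ 2) / sg2], so [z = k * x] leaves [radial_mass D'] times a
     function of [u]. *)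
  pose k : R := Num.sqrt ((1 + u ^+ 2) / sg2).
  have k2 : (k ^+ 2 = (1 + u ^+ 2) / sg2)%R by rewrite sqr_sqrtr// ltW// divr_gt0.
  have k0 : (0 < k)%R by rewrite sqrtr_gt0 divr_gt0.
  rewrite /radial_mass -(@ge0_integral_affine_pos R k 0 (fun z => (`|z| * \1_D' (z ^+ 2) * expR (- z ^+ 2))%:E))//; last first.
    by apply/measurable_EFinP; exact: measurable_radial.
  rewrite -!ge0_integralZl//.
  - apply: eq_integral => x _; rewrite -!EFinM /F /H addr0 normrM gtr0_norm//.
    have -> : (x ^+ 2 * (1 + u ^+ 2) / sg2 = (k * x) ^+ 2)%R by rewrite exprMn k2 -mulrA mulrC.
    congr EFin; set a := expR _; set b := \1_D' _.
    have -> : (kap * sg2 / (1 + u ^+ 2) = kap / k ^+ 2)%R by rewrite k2 invf_div mulrA.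
    by field; rewrite gt_eqF.
  - apply/measurable_EFinP; apply: measurable_funM => //.
    exact: (measurableT_comp (measurable_radial mD') (measurable_affine k 0)).
  - by move=> x _; rewrite mule_ge0// lee_fin// ltW.
  - rewrite lee_fin divr_ge0 ?(ltW u1)//.
    by rewrite mulr_ge0// ltW.
  - apply/measurable_EFinP.
    exact: (measurableT_comp (measurable_radial mD') (measurable_affine k 0)).
  - by rewrite lee_fin ltW.
have C01 : C0 = 1.
  have := main setT measurableT; rewrite radial_massT mule1 => <-.
  rewrite (_ : [set z : mR * mR | _] = setT `*` setT); last by apply/seteqP; split.
  have NT : normal_prob 0 s [set: mR] = 1 by exact: probability_setT.
  apply: (etrans (product_measure1E _ _ measurableT measurableT)).
  by rewrite -[RHS]mule1; congr (_ * _); exact: NT.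
by have := main D mD; rewrite C01 mul1e.
Qed.

(** The Gamma density of shape [k + 1] and unit scale; the index is the exponent of [t]. *)
Definition gamma_pdf (k : nat) (t : R) : R :=
  (\1_`[0%R, +oo[ t * (t ^+ k * expR (- t) / k`!%:R))%R.

Lemma gamma_pdf_ge0 k t : (0 <= gamma_pdf k t)%R.
Proof.
rewrite /gamma_pdf indicE mem_setE in_itv /= andbT; have [t0|_] := leP 0%R t.
  by rewrite mul1r divr_ge0// mulr_ge0 ?exprn_ge0 ?expR_ge0.
by rewrite mul0r.
Qed.

Lemma measurable_gamma_pdf k : measurable_fun [set: mR] (gamma_pdf k).
Proof.
apply: measurable_funM; first exact: measurable_indic.
apply: measurable_funM => //; apply: measurable_funM; first exact: measurable_funX.
by apply: measurableT_comp => //; exact: measurableT_comp.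
Qed.

Lemma gamma_pdf0E : gamma_pdf 0 = exponential_pdf 1.
Proof.
apply/funext => t; rewrite /gamma_pdf /exponential_pdf patchE indicE.
by case: ifP => _; rewrite ?mul0r// mul1r expr0 !mul1r mulN1r divr1.
Qed.

(** Both sides are finite measures with the exponential distribution function: [1 - expR (- x)] for
    [x >= 0] and zero for negative [x]. *)
Lemma radial_mass_gamma (D : set mR) : measurable D ->
  radial_mass D = \int[lambda]_(t in D) (gamma_pdf 0 t)%:E.
Proof.
move=> mD.
have mr : measurable_fun [set: mR * mR] ((fun z : mR * mR =>
    (z.1 ^+ 2 + z.2 ^+ 2) / (1 ^+ 2 *+ 2))%R : _ -> mR).
  by apply: measurable_funM => //; apply: measurable_funD; exact: measurable_funX.
(* [radial_mass] is a bare set function; as the law of the normalized squared radius of a standard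
   pair it becomes a measure. *)
pose mu : {measure set mR -> \bar R} :=
  image_measure (normal_prob 0 1 \x normal_prob 0 1) mr.
pose nu : {measure set mR -> \bar R} :=
  exponential_distribution_exponential_prob__canonical__measure_function_Measure (@ltr01 R).
have muE (B : set mR) : measurable B -> mu B = radial_mass B.
  by move=> mB; rewrite -(normal_radius ltr01 mB).
rewrite -muE// gamma_pdf0E -[RHS]/(nu D).
apply: finite_measure_eq_itvNyc => // [|x].
  rewrite muE// radial_massT ltry//.
rewrite muE//; have [x0|x0] := leP 0%R x; last first.
  rewrite [LHS]integral0_eq; last first.
    move=> z _; rewrite indicE mem_setE in_itv /=.
    by rewrite leNgt (lt_le_trans x0 (sqr_ge0 z)) mulr0 mul0r.
  rewrite [RHS]integral0_eq// => z; rewrite /= in_itv /= => zx.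
  by rewrite lt0_exponential_pdf// (le_lt_trans zx).
rewrite radial_mass_itvNyc//.
have -> : nu `]-oo, x]%classic = \int[lambda]_(t in `[0%R, x]) (exponential_pdf 1 t)%:E.
  rewrite /nu /= /exponential_prob [LHS]integral_mkcond [RHS]integral_mkcond.
  apply: eq_integral => z _; rewrite !patchE !mem_setE !in_itv /=.
  by have [z0|z0] := leP 0%R z => //=; case: ifP => // _; rewrite lt0_exponential_pdf.
move: x0; rewrite le_eqVlt => /predU1P[<-|x0].
  by rewrite set_itv1 integral_set1 oppr0 expR0 subrr.
by have := exponential_prob_itv0c 1 x0; rewrite /exponential_prob mulN1r EFinB.
Qed.

#[local] Instance is_derive_exprn (n : nat) (x : R) :
  is_derive x 1%R (fun y : R => y ^+ n)%R (n%:R * x ^+ n.-1)%R.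
Proof.
apply: DeriveDef; first exact: exprn_derivable.
by rewrite exp_derive /GRing.scale /= mulr1.
Qed.

(** On [[0, v]] the two exponentials multiply to [expR (- v)], which leaves the integral of a
    monomial. Elsewhere one of the indicators vanishes. *)
Lemma gamma_pdf_conv k (v : R) :
  \int[lambda]_x (gamma_pdf k x * gamma_pdf 0 (v - x))%:E = (gamma_pdf k.+1 v)%:E.
Proof.
pose c : R := (expR (- v) / k`!%:R)%R.
transitivity (\int[lambda]_(x in `[0%R, v]) (c * x ^+ k)%:E).
  rewrite [RHS]integral_mkcond; apply: eq_integral => x _; rewrite patchE.
  rewrite mem_setE in_itv /= /gamma_pdf !indicE !mem_setE !in_itv /= !andbT subr_ge0.
  case: ifPn => [/andP[-> ->]|]; last first.
    case: (leP 0%R x) => x0 /=; last by rewrite !mul0r.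
    by case: leP => // _ _; rewrite mul0r mulr0.
  rewrite !mul1r divr1 /c; congr EFin.
  have -> : (expR (- v) = expR (- x) * expR (- (v - x)))%R.
    by rewrite -expRD; congr expR; ring.
  by field; rewrite pnatr_eq0 -lt0n fact_gt0.
rewrite /gamma_pdf indicE mem_setE in_itv /= andbT.
have [|v0] := leP 0%R v; last first.
  rewrite mul0r set_itv_ge ?integral_set0// bnd_simp -ltNge//.
rewrite le_eqVlt => /predU1P[<-|v0].
  by rewrite set_itv1 integral_set1 exprS !mul0r mulr0.
have dF (x : R) : is_derive x 1%R (fun x => c * (x ^+ k.+1 / k.+1%:R))%R (c * x ^+ k)%R.
  apply: is_derive_eq; rewrite /GRing.scale /=.
  by rewrite !mulr0 add0r mulKf ?pnatr_eq0.
rewrite (@continuous_FTC2 _ _ (fun x => c * (x ^+ k.+1 / k.+1%:R))%R)//.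
- rewrite expr0n /= !mul0r mulr0 sube0 mul1r /c factS natrM; congr EFin; field.
  by rewrite addrC natr1 !pnatr_eq0 -lt0n fact_gt0.
- by apply: derivable_within_continuous => z _; exact: ex_derive.
- split.
  + by move=> z _; exact: ex_derive.
  + by apply: cvg_at_right_filter; apply: derivable1_cvg; exact: ex_derive.
  + by apply: cvg_at_left_filter; apply: derivable1_cvg; exact: ex_derive.
- by move=> z _; rewrite derive1E; have [_ ->] := dF z.
Qed.

End gaussian_radius.

(** * Laws of the gains of a Gaussian vector *)

Section gaussian_vector.
Context d (T : measurableType d) (R : realType) (P : probability T R).
Local Open Scope ereal_scope.
Local Notation mR := (measurableTypeR R).

Lemma measurable_preimage (U : T -> mR) (A : set mR) :
  measurable_fun setT U -> measurable A -> measurable (U @^-1` A).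
Proof. by move=> mU mA; rewrite -[X in measurable X]setTI; exact: mU. Qed.

Lemma measurable_rotated (c e : R) (A B : set mR) : measurable A -> measurable B ->
  measurable [set z : mR * mR | A (c * z.1 - e * z.2)%R /\ B (e * z.1 + c * z.2)%R].
Proof.
move=> mA mB; have mlin (a b : R) :
    measurable_fun [set: mR * mR] (fun z : mR * mR => (a * z.1 + b * z.2)%R).
  by apply: measurable_funD; exact: measurable_funM.
apply: measurableI; rewrite -[X in measurable X]setTI.
  by under eq_fun do rewrite -mulNr; exact: mlin.
exact: mlin.
Qed.

Lemma mule_regroup (x y z t v : \bar R) : x * y * (z * t * v) = x * z * (y * t * v).
Proof. by rewrite !muleA; congr (_ * _ * _); exact: muleAC. Qed.

Lemma joint_law_sum (mu nu : probability mR R) (U V : T -> mR) (E : set T) :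
  measurable_fun setT U -> measurable_fun setT V -> measurable E ->
  (forall A B : set mR, measurable A -> measurable B ->
    P (U @^-1` A `&` V @^-1` B `&` E) = mu A * nu B * P E) ->
  forall A : set mR, measurable A ->
    P ((fun t => (U t + V t)%R) @^-1` A `&` E) =
    (mu \x nu) [set z : mR * mR | A (z.1 + z.2)%R] * P E.
Proof.
move=> mU mV mE H A mA.
have mC : measurable [set z : mR * mR | A (z.1 + z.2)%R].
  rewrite -[X in measurable X]setTI.
  by apply: (measurable_funD (measurable_fst) (measurable_snd)).
exact: (joint_law mU mV mE H mC).
Qed.

(** The sums are formed one at a time: first [S1 + W1], with [S2] and [W2] kept inside the auxiliary
    event, then [S2 + W2], with the first sum inside it. In this way the two sums stay independent
    of each other and of [E]. *)
Lemma normal_pair_sum (s t : R) (S1 S2 W1 W2 : T -> mR) (E : set T) :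
  (0 < s)%R -> (0 < t)%R ->
  measurable_fun setT S1 -> measurable_fun setT S2 ->
  measurable_fun setT W1 -> measurable_fun setT W2 -> measurable E ->
  (forall A1 A2 B1 B2 : set mR, measurable A1 -> measurable A2 ->
    measurable B1 -> measurable B2 ->
    P (S1 @^-1` A1 `&` S2 @^-1` A2 `&` (W1 @^-1` B1 `&` W2 @^-1` B2 `&` E)) =
    normal_prob 0 s A1 * normal_prob 0 s A2 *
      (normal_prob 0 t B1 * normal_prob 0 t B2 * P E)) ->
  forall A1 A2 : set mR, measurable A1 -> measurable A2 ->
    let q := Num.sqrt (s ^+ 2 + t ^+ 2) in
    P ((fun u => (S1 u + W1 u)%R) @^-1` A1 `&` (fun u => (S2 u + W2 u)%R) @^-1` A2 `&` E) =
    normal_prob 0 q A1 * normal_prob 0 q A2 * P E.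
Proof.
move=> s0 t0 mS1 mS2 mW1 mW2 mE H A1 A2 mA1 mA2 q.
have NT (x : R) : normal_prob 0 x setT = 1 by exact: probability_setT.
have first_sum (B C D : set mR) : measurable B -> measurable C -> measurable D ->
    P ((fun u => (S1 u + W1 u)%R) @^-1` B `&` (S2 @^-1` C `&` W2 @^-1` D `&` E)) =
    normal_prob 0 q B * (normal_prob 0 s C * normal_prob 0 t D * P E).
  move=> mB mC mD.
  have mE' : measurable (S2 @^-1` C `&` W2 @^-1` D `&` E).
    by apply: measurableI => //; apply: measurableI; exact: measurable_preimage.
  have H' (A' B' : set mR) : measurable A' -> measurable B' ->
      P (S1 @^-1` A' `&` W1 @^-1` B' `&` (S2 @^-1` C `&` W2 @^-1` D `&` E)) =
      normal_prob 0 s A' * normal_prob 0 t B' * (normal_prob 0 s C * normal_prob 0 t D * P E).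
    move=> mA' mB'; transitivity
      (P (S1 @^-1` A' `&` S2 @^-1` C `&` (W1 @^-1` B' `&` W2 @^-1` D `&` E))).
      by congr (P _); apply/seteqP; split=> u /=; tauto.
    rewrite (H _ _ _ _ mA' mC mB' mD); exact: mule_regroup.
  (* Full sets for [S1] and [W1] give the probability of the auxiliary event itself. *)
  have PE' : P (S2 @^-1` C `&` W2 @^-1` D `&` E) = normal_prob 0 s C * normal_prob 0 t D * P E.
    have := H' setT setT measurableT measurableT.
    by rewrite !preimage_setT !setTI !NT !mul1e.
  rewrite -PE' -normal_prob_sum//; apply: joint_law_sum => //.
  by move=> A' B' mA' mB'; rewrite PE' H'.
have mE' : measurable ((fun u => (S1 u + W1 u)%R) @^-1` A1 `&` E).
  by apply: measurableI => //; apply: measurable_preimage => //; exact: measurable_funD.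
have PE' : P ((fun u => (S1 u + W1 u)%R) @^-1` A1 `&` E) = normal_prob 0 q A1 * P E.
  have := first_sum A1 setT setT mA1 measurableT measurableT.
  by rewrite !preimage_setT !setTI !NT !mul1e.
transitivity (normal_prob 0 q A2 * P ((fun u => (S1 u + W1 u)%R) @^-1` A1 `&` E)); last first.
  by rewrite PE' muleCA muleA.
transitivity (P ((fun u => (S2 u + W2 u)%R) @^-1` A2 `&` ((fun u => (S1 u + W1 u)%R) @^-1` A1 `&` E))).
  by congr (P _); apply/seteqP; split=> u /=; tauto.
rewrite -normal_prob_sum//; apply: joint_law_sum => //.
move=> A' B' mA' mB'; rewrite PE'.
transitivity (P ((fun u => (S1 u + W1 u)%R) @^-1` A1 `&` (S2 @^-1` A' `&` W2 @^-1` B' `&` E))).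
  by congr (P _); apply/seteqP; split=> u /=; tauto.
by rewrite first_sum// muleCA muleA.
Qed.

Variables (M : nat) (a : R) (h : T -> 'cV[R[i]]_M).
Hypotheses (a0 : (0 < a)%R) (hG : complex_gaussian P a h).

Local Notation coord := (coordinate h).
Local Notation sg := (Num.sqrt (a / 2)).
Local Notation box A := (\bigcap_k (coord k @^-1` (A k))).

Lemma sg_gt0 : (0 < sg)%R. Proof. by rewrite sqrtr_gt0 divr_gt0. Qed.

Lemma sqr_sg : (sg ^+ 2 *+ 2 = a)%R.
Proof. by rewrite sqr_sqrtr ?divr_ge0 ?ltW// -mulr_natr divfK. Qed.

Lemma measurable_coord k : measurable_fun setT (coord k : T -> mR).
Proof. by have [H _ _] := hG; exact: H. Qed.

Lemma measurable_box (A : 'I_M * bool -> set mR) : (forall k, measurable (A k)) ->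
  measurable (box A).
Proof.
move=> mA; apply: fin_bigcap_measurable => //.
by move=> k _; apply: measurable_preimage => //; exact: measurable_coord.
Qed.

Lemma prob_box (A : 'I_M * bool -> set mR) : (forall k, measurable (A k)) ->
  P (box A) = \prod_k normal_prob 0 sg (A k).
Proof.
have [_ H2 H3] := hG => mA; rewrite H3//.
by apply: eq_bigr => k _; exact: H2 (mA k).
Qed.

Lemma box_coord (A : 'I_M * bool -> set mR) k (B : set mR) : (forall k, measurable (A k)) ->
  measurable B -> A k = setT ->
  coord k @^-1` B `&` box A = box (fun j => if j == k then B else A j).
Proof.
move=> mA mB Ak; apply/seteqP; split=> t /=.
  move=> [Bt At] j _ /=; case: eqP => [->//|_]; exact: At.
move=> At; split; first by have := At k I; rewrite /= eqxx.
move=> j _ /=; have := At j I; rewrite /=; case: eqP => [-> _|//].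
by rewrite Ak.
Qed.

Lemma prob_coord_box (A : 'I_M * bool -> set mR) k (B : set mR) : (forall k, measurable (A k)) ->
  measurable B -> A k = setT ->
  P (coord k @^-1` B `&` box A) = normal_prob 0 sg B * P (box A).
Proof.
move=> mA mB Ak; rewrite box_coord// !prob_box//; last by move=> j; case: ifP.
rewrite (bigD1 k)//= eqxx [X in _ = _ * X](bigD1 k)//= Ak.
rewrite [X in _ = _ * (X * _)](_ : _ = 1); last exact: probability_setT.
rewrite mul1e; congr (_ * _); apply: eq_bigr => j /negbTE jk.
by rewrite jk.
Qed.

(** A box of this kind is an event from which the entries in [l] are independent. *)
Definition free_on (l : seq 'I_M) (A : 'I_M * bool -> set mR) :=
  (forall k, measurable (A k)) /\ forall j b, j \in l -> A (j, b) = setT.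

Lemma prob_pair_box (A : 'I_M * bool -> set mR) j (B1 B2 : set mR) :
  free_on [:: j] A -> measurable B1 -> measurable B2 ->
  P (coord (j, false) @^-1` B1 `&` coord (j, true) @^-1` B2 `&` box A) =
  normal_prob 0 sg B1 * normal_prob 0 sg B2 * P (box A).
Proof.
move=> [mA fA] mB1 mB2.
have Aj b : A (j, b) = setT by apply: fA; rewrite inE.
rewrite -setIA box_coord// prob_coord_box//.
- by rewrite -box_coord// prob_coord_box// muleA.
- by move=> k; case: ifP.
- by rewrite xpair_eqE andbF.
Qed.

(** The last hypothesis ranges over all boxes that differ from [A] only at entry [j]; it expresses
    that [F] is independent of that entry. Both inductions on lists of entries add an entry through
    this lemma. *)
Lemma pair_event_box (A : 'I_M * bool -> set mR) j (F : set T) (p : \bar R)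
    (C : set (mR * mR)) : free_on [:: j] A -> measurable F -> measurable C ->
  (forall A', (forall k, measurable (A' k)) ->
    (forall i b, i != j -> A' (i, b) = A (i, b)) ->
    P (F `&` box A') = p * P (box A')) ->
  P ([set t | C (coord (j, false) t, coord (j, true) t)] `&` (F `&` box A)) =
  (normal_prob 0 sg \x normal_prob 0 sg) C * (p * P (box A)).
Proof.
move=> [mA fA] mF mC H.
have Aj b : A (j, b) = setT by apply: fA; rewrite inE.
have PE : P (F `&` box A) = p * P (box A) by exact: H.
rewrite -PE; apply: (@joint_law _ _ _ P (normal_prob 0 sg) (normal_prob 0 sg) _ _ _
  (measurable_coord (j, false)) (measurable_coord (j, true)) _ _ _ mC).
  by apply: measurableI => //; exact: measurable_box.
move=> D1 D2 mD1 mD2; rewrite PE.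
have boxE : coord (j, false) @^-1` D1 `&` (coord (j, true) @^-1` D2 `&` box A) =
    box (fun k => if k == (j, false) then D1 else if k == (j, true) then D2 else A k).
  rewrite box_coord// box_coord//.
  - by move=> k; case: ifP.
  - by rewrite xpair_eqE andbF.
transitivity (P (F `&` (coord (j, false) @^-1` D1 `&` (coord (j, true) @^-1` D2 `&` box A)))).
  by congr (P _); apply/seteqP; split=> t /=; tauto.
rewrite boxE H//; last 2 first.
- by move=> k; case: ifP => // _; case: ifP.
- by move=> i b /negbTE ij; rewrite !xpair_eqE ij.
rewrite -boxE setIA (prob_pair_box (conj mA fA) mD1 mD2).
exact: muleCA.
Qed.

Lemma rotated_pair_box (A : 'I_M * bool -> set mR) j (c e : R) (B1 B2 : set mR) :
  free_on [:: j] A -> (0 < c ^+ 2 + e ^+ 2)%R -> measurable B1 -> measurable B2 ->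
  P ((fun t => (c * coord (j, false) t - e * coord (j, true) t)%R) @^-1` B1 `&`
     (fun t => (e * coord (j, false) t + c * coord (j, true) t)%R) @^-1` B2 `&` box A) =
  normal_prob 0 (Num.sqrt (c ^+ 2 + e ^+ 2) * sg) B1 *
  normal_prob 0 (Num.sqrt (c ^+ 2 + e ^+ 2) * sg) B2 * P (box A).
Proof.
move=> fA ce0 mB1 mB2.
rewrite -normal_prob_similarity//; last exact: sg_gt0.
have mC := measurable_rotated c e mB1 mB2.
apply: (@joint_law _ _ _ P (normal_prob 0 sg) (normal_prob 0 sg) _ _ _
  (measurable_coord (j, false)) (measurable_coord (j, true)) _ _ _ mC).
- by apply: measurable_box; case: fA.
- by move=> C D mC' mD; exact: prob_pair_box.
Qed.

Lemma radius_box (A : 'I_M * bool -> set mR) j (B : set mR) :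
  free_on [:: j] A -> measurable B ->
  P ((fun t => ((coord (j, false) t ^+ 2 + coord (j, true) t ^+ 2) / a)%R) @^-1` B `&` box A) =
  (\int[lebesgue_measure]_(t in B) (gamma_pdf 0 t)%:E) * P (box A).
Proof.
move=> fA mB.
rewrite -radial_mass_gamma// -(normal_radius sg_gt0 mB).
have mr : measurable_fun [set: mR * mR] (fun z : mR * mR => (z.1 ^+ 2 + z.2 ^+ 2) / (sg ^+ 2 *+ 2))%R.
  by apply: measurable_funM => //; apply: measurable_funD; exact: measurable_funX.
have := @joint_law _ _ _ P (normal_prob 0 sg) (normal_prob 0 sg) _ _ _
  (measurable_coord (j, false)) (measurable_coord (j, true))
  (measurable_box (proj1 fA)) _
  [set z : mR * mR | B ((z.1 ^+ 2 + z.2 ^+ 2) / (sg ^+ 2 *+ 2))%R].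
rewrite [X in P ([set t | X t] `&` _)](_ : _ = (fun t => B ((coord (j, false) t ^+ 2 + coord (j, true) t ^+ 2) / a)%R)); last first.
  by apply/funext => t /=; rewrite sqr_sg.
apply.
- by move=> C D mC mD; exact: prob_pair_box.
- by rewrite -[X in measurable X]setTI; exact: mr.
Qed.

Let V (l : seq 'I_M) (t : T) : R :=
  (\sum_(j <- l) ((coord (j, false) t ^+ 2 + coord (j, true) t ^+ 2) / a))%R.

(* Intersecting with a box in the other coordinates carries independence through the
   induction on [l]. *)
Lemma radius_sum_box (j0 : 'I_M) (l : seq 'I_M) : uniq (j0 :: l) ->
  forall A, free_on (j0 :: l) A -> forall B : set mR, measurable B ->
  P (V (j0 :: l) @^-1` B `&` box A) =
  (\int[lebesgue_measure]_(t in B) (gamma_pdf (size l) t)%:E) * P (box A).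
Proof.
have mW j : measurable_fun setT (fun t => (coord (j, false) t ^+ 2 + coord (j, true) t ^+ 2) / a : mR)%R.
  by apply: measurable_funM => //; apply: measurable_funD; apply: measurable_funX; exact: measurable_coord.
have mV l' : measurable_fun setT (V l' : T -> mR) by apply: measurable_sum => j; exact: mW.
elim: l j0 => [|j l IH] j0.
  move=> _ A fA B mB; rewrite -(radius_box fA mB); congr (P (_ `&` _)).
  by apply/seteqP; split=> t; rewrite /= /V big_seq1.
move=> ul; have /andP[j0l ul'] : (j0 \notin j :: l) && uniq (j :: l) by exact: ul.
have {}IH := IH j ul'.
move=> A [mA fA] B mB.
have fT l' : free_on l' (fun=> setT) by [].
have boxT : box (fun=> setT) = setT by apply/seteqP; split.
have VE : V [:: j0, j & l] = (fun t => V (j :: l) t + ((coord (j0, false) t ^+ 2 + coord (j0, true) t ^+ 2) / a))%R.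
  by apply/funext => t; rewrite /V big_cons addrC.
(* Bundled as random variables, the partial sum and the new term have distributions of type
   [probability], as [density_sum] asks. *)
pose mixV := isMeasurableFun.Build _ _ _ _ _ (mV (j :: l)).
pose X : {mfun T >-> mR} := HB.pack (V (j :: l) : T -> mR) mixV.
pose mixW := isMeasurableFun.Build _ _ _ _ _ (mW j0).
pose Y : {mfun T >-> mR} := HB.pack ((fun t => (coord (j0, false) t ^+ 2 + coord (j0, true) t ^+ 2) / a)%R : T -> mR) mixW.
have XE (D : set mR) : measurable D -> distribution P X D = \int[lebesgue_measure]_(t in D) (gamma_pdf (size l) t)%:E.
  by move=> mD; have := IH _ (fT _) D mD; rewrite boxT probability_setT mule1 setIT.
have YE (D : set mR) : measurable D -> distribution P Y D = \int[lebesgue_measure]_(t in D) (gamma_pdf 0 t)%:E.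
  by move=> mD; have := radius_box (fT [:: j0]) mD; rewrite boxT probability_setT mule1 setIT.
rewrite VE -(density_sum (@gamma_pdf_ge0 R (size l)) (@measurable_gamma_pdf R (size l))
  (@gamma_pdf_ge0 R 0) (@measurable_gamma_pdf R 0) XE YE (gamma_pdf_conv (size l)) mB).
apply: joint_law_sum => //; first exact: measurable_box.
move=> C D mC mD.
transitivity ((\int[lebesgue_measure]_(t in C) (gamma_pdf (size l) t)%:E) *
    (\int[lebesgue_measure]_(t in D) (gamma_pdf 0 t)%:E) * P (box A)); last first.
  by congr (_ * _ * _); [exact/esym/XE|exact/esym/YE].
have mDr : measurable [set z : mR * mR | D ((z.1 ^+ 2 + z.2 ^+ 2) / a)%R].
  rewrite -[X in measurable X]setTI.
  suff mr : measurable_fun [set: mR * mR] ((fun z : mR * mR => (z.1 ^+ 2 + z.2 ^+ 2) / a)%R : _ -> mR) by exact: mr.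
  by apply: measurable_funM => //; apply: measurable_funD; exact: measurable_funX.
transitivity (P ([set t | D ((coord (j0, false) t ^+ 2 + coord (j0, true) t ^+ 2) / a)%R] `&`
    (V (j :: l) @^-1` C `&` box A))).
  by congr (P _); apply/seteqP; split=> t /=; tauto.
have fj : free_on [:: j0] A.
  by split=> // i b; rewrite inE => /eqP ->; apply: fA; rewrite inE eqxx.
rewrite (pair_event_box (C := [set z : mR * mR | D ((z.1 ^+ 2 + z.2 ^+ 2) / a)%R])
  (p := \int[lebesgue_measure]_(t in C) (gamma_pdf (size l) t)%:E) fj)//.
- rewrite -radial_mass_gamma// -(normal_radius sg_gt0 mD).
  by rewrite sqr_sg muleCA muleA.
- exact: measurable_preimage.
- move=> A' mA' A'E; apply: IH => //.
  split=> // i b il; rewrite A'E; last by apply: contraNneq j0l => <-.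
  by apply: fA; rewrite inE il orbT.
Qed.

Variable u : 'cV[R[i]]_M.
Let w2 (l : seq 'I_M) : R :=
  (\sum_(j <- l) (complex.Re (u j 0) ^+ 2 + complex.Im (u j 0) ^+ 2))%R.
Let S1 (l : seq 'I_M) (t : T) : R :=
  (\sum_(j <- l) (complex.Re (u j 0) * coord (j, false) t + complex.Im (u j 0) * coord (j, true) t))%R.
Let S2 (l : seq 'I_M) (t : T) : R :=
  (\sum_(j <- l) (complex.Re (u j 0) * coord (j, true) t - complex.Im (u j 0) * coord (j, false) t))%R.

(** Entry [j] contributes its coordinate pair multiplied by the conjugate of [u j], a normal pair by
    [normal_prob_similarity]; [normal_pair_sum] adds the contributions. Both ask for positive
    variances, so zero entries are treated apart. *)
Lemma projection_box (l : seq 'I_M) : uniq l -> (0 < w2 l)%R ->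
  forall A, free_on l A -> forall B1 B2 : set mR, measurable B1 -> measurable B2 ->
  P (S1 l @^-1` B1 `&` S2 l @^-1` B2 `&` box A) =
  normal_prob 0 (Num.sqrt (w2 l) * sg) B1 * normal_prob 0 (Num.sqrt (w2 l) * sg) B2 * P (box A).
Proof.
have mS1 l' : measurable_fun setT (S1 l' : T -> mR).
  apply: measurable_sum => j; apply: measurable_funD; apply: measurable_funM => //; exact: measurable_coord.
have mS2 l' : measurable_fun setT (S2 l' : T -> mR).
  apply: measurable_sum => j; apply: measurable_funB; apply: measurable_funM => //; exact: measurable_coord.
elim: l => [|j l IH] /=; first by rewrite /w2 big_nil ltxx.
move=> /andP[jl ul] wl A [mA fA] B1 B2 mB1 mB2.
pose x : R := complex.Re (u j 0%R); pose y : R := complex.Im (u j 0%R).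
have S1E t : S1 (j :: l) t = ((x * coord (j, false) t - - y * coord (j, true) t) + S1 l t)%R.
  by rewrite /S1 big_cons mulNr opprK.
have S2E t : S2 (j :: l) t = ((- y * coord (j, false) t + x * coord (j, true) t) + S2 l t)%R.
  by rewrite /S2 big_cons mulNr [(- _ + _)%R]addrC.
have w2E : w2 (j :: l) = (x ^+ 2 + (- y) ^+ 2 + w2 l)%R by rewrite /w2 big_cons sqrrN.
have fj : free_on [:: j] A.
  by split=> // i b; rewrite inE => /eqP ->; apply: fA; rewrite inE eqxx.
have fl : free_on l A by split=> // i b il; apply: fA; rewrite inE il orbT.
have wl0 : (0 <= w2 l)%R by apply: sumr_ge0 => i _; rewrite addr_ge0 ?sqr_ge0.
have xy0 : (0 <= x ^+ 2 + (- y) ^+ 2)%R by rewrite addr_ge0 ?sqr_ge0.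
have [/eqP uj|uj] := eqVneq (x ^+ 2 + (- y) ^+ 2)%R 0%R.
  have [x0 y0] : x = 0%R /\ y = 0%R.
    by move: uj; rewrite paddr_eq0 ?sqr_ge0// !sqrf_eq0 oppr_eq0 => /andP[/eqP ? /eqP ?].
  rewrite (_ : S1 (j :: l) = S1 l); last first.
    by apply/funext => t; rewrite S1E x0 y0 oppr0 !mul0r subr0 add0r.
  rewrite (_ : S2 (j :: l) = S2 l); last first.
    by apply/funext => t; rewrite S2E x0 y0 oppr0 !mul0r !add0r.
  move: wl; rewrite w2E (eqP uj) add0r => wl.
  exact: IH.
have {uj}xy : (0 < x ^+ 2 + (- y) ^+ 2)%R by rewrite lt_neqAle eq_sym uj.
(* If [u] vanishes on the rest of the list, the new entry carries the whole sum. *)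
have [wl00|wln] := eqVneq (w2 l) 0%R.
  have z0 i : i \in l -> complex.Re (u i 0%R) = 0%R /\ complex.Im (u i 0%R) = 0%R.
    move=> il; move: wl00 => /eqP; rewrite /w2 psumr_eq0; last first.
      by move=> k _; rewrite addr_ge0 ?sqr_ge0.
    by move=> /allP /(_ i il) /=; rewrite paddr_eq0 ?sqr_ge0// !sqrf_eq0 => /andP[/eqP ? /eqP ?].
  rewrite w2E wl00 addr0 -(rotated_pair_box fj xy mB1 mB2); congr (P (_ `&` _ `&` _)).
    apply/seteqP; split=> t /=; rewrite S1E /S1 big_seq big1 ?addr0// => i il;
      by rewrite !(z0 i il).1 !(z0 i il).2 !mul0r addr0.
  apply/seteqP; split=> t /=; rewrite S2E /S2 big_seq big1 ?addr0// => i il;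
    by rewrite !(z0 i il).1 !(z0 i il).2 !mul0r subr0.
have {wln}wlp : (0 < w2 l)%R by rewrite lt_neqAle eq_sym wln.
have qE : (Num.sqrt (w2 (j :: l)) * sg = Num.sqrt ((Num.sqrt (x ^+ 2 + (- y) ^+ 2) * sg) ^+ 2 + (Num.sqrt (w2 l) * sg) ^+ 2))%R.
  rewrite w2E !exprMn (sqr_sqrtr xy0) (sqr_sqrtr wl0) -mulrDl.
  by rewrite (sqrtrM _ (addr_ge0 xy0 wl0)) sqrtr_sqr ger0_norm ?sqrtr_ge0.
rewrite qE.
rewrite (_ : S1 (j :: l) = (fun t => (x * coord (j, false) t - - y * coord (j, true) t) + S1 l t)%R); last exact/funext.
rewrite (_ : S2 (j :: l) = (fun t => (- y * coord (j, false) t + x * coord (j, true) t) + S2 l t)%R); last exact/funext.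
apply: normal_pair_sum => //.
- by rewrite mulr_gt0// ?sg_gt0// sqrtr_gt0.
- by rewrite mulr_gt0// ?sg_gt0// sqrtr_gt0.
- by apply: measurable_funB; apply: measurable_funM => //; exact: measurable_coord.
- by apply: measurable_funD; apply: measurable_funM => //; exact: measurable_coord.
- exact: measurable_box.
move=> C1 C2 A1 A2 mC1 mC2 mA1 mA2.
transitivity (P ([set t | C1 (x * coord (j, false) t - - y * coord (j, true) t)%R /\
      C2 (- y * coord (j, false) t + x * coord (j, true) t)%R] `&`
    ((S1 l @^-1` A1 `&` S2 l @^-1` A2) `&` box A))).
  by congr (P _); apply/seteqP; split=> t /=; tauto.
have mC := measurable_rotated x (- y) mC1 mC2.
rewrite (pair_event_box (C := [set z : mR * mR | C1 (x * z.1 - - y * z.2)%R /\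
      C2 (- y * z.1 + x * z.2)%R]) (p := normal_prob 0 (Num.sqrt (w2 l) * sg) A1 *
  normal_prob 0 (Num.sqrt (w2 l) * sg) A2) fj)//.
- by rewrite (normal_prob_similarity xy sg_gt0 mC1 mC2).
- by apply: measurableI; exact: measurable_preimage.
- move=> A' mA' A'E; apply: IH => //.
  split=> // i b il; rewrite A'E; last by apply: contraNneq jl => <-.
  by apply: fA; rewrite inE il orbT.
Qed.

End gaussian_vector.

Section gaussian_laws.
Context d (T : measurableType d) (R : realType) (P : probability T R).
Local Open Scope ereal_scope.
Local Notation mR := (measurableTypeR R).
Variables (M : nat) (a : R) (h : T -> 'cV[R[i]]_M).
Hypotheses (a0 : (0 < a)%R) (hG : complex_gaussian P a h).

Lemma measurable_Re_cdot (u : 'cV[R[i]]_M) :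
  measurable_fun setT (fun t => complex.Re (cdot u (h t)) : mR).
Proof.
under eq_fun do rewrite Re_cdot.
apply: measurable_sum => j; apply: measurable_funD; apply: measurable_funM => //.
  exact: (measurable_coord hG (j, false)).
exact: (measurable_coord hG (j, true)).
Qed.

Lemma measurable_Im_cdot (u : 'cV[R[i]]_M) :
  measurable_fun setT (fun t => complex.Im (cdot u (h t)) : mR).
Proof.
under eq_fun do rewrite Im_cdot.
apply: measurable_sum => j; apply: measurable_funB; apply: measurable_funM => //.
  exact: (measurable_coord hG (j, true)).
exact: (measurable_coord hG (j, false)).
Qed.

Lemma measurable_gain (u : 'cV[R[i]]_M) : measurable_fun setT (fun t => gain u (h t) : mR).
Proof.
under eq_fun do rewrite gainE.
by apply: measurable_funD; apply: measurable_funX;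
  [exact: measurable_Re_cdot|exact: measurable_Im_cdot].
Qed.

Lemma measurable_sqnorm : measurable_fun setT (fun t => sqnorm (h t) : mR).
Proof.
under eq_fun do rewrite sqnormE.
apply: measurable_sum => j; apply: measurable_funD; apply: measurable_funX.
  exact: (measurable_coord hG (j, false)).
exact: (measurable_coord hG (j, true)).
Qed.

(** The real and imaginary parts of the projection are independent normal variables of variance
    [sqnorm u * a / 2], so the normalized squared modulus is exponential. *)
Lemma gain_law (u : 'cV[R[i]]_M) (B : set mR) : u != 0%R -> measurable B ->
  P ((fun t => (gain u (h t) / sqnorm u / a)%R) @^-1` B) =
  \int[lebesgue_measure]_(t in B) (gamma_pdf 0 t)%:E.
Proof.
move=> u0 mB; set q := sqnorm u.
have q0 : (0 < q)%R by rewrite sqnorm_gt0.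
pose sg : R := (Num.sqrt q * Num.sqrt (a / 2))%R.
have sg0 : (0 < sg)%R by rewrite mulr_gt0// sqrtr_gt0// divr_gt0.
have sg2 : (sg ^+ 2 *+ 2 = q * a)%R.
  by rewrite exprMn !sqr_sqrtr ?ltW ?divr_gt0// -mulr_natr; field.
have qE : q = (\sum_(j <- index_enum 'I_M) (complex.Re (u j 0) ^+ 2 + complex.Im (u j 0) ^+ 2))%R.
  exact: sqnormE.
have H B1 B2 : measurable B1 -> measurable B2 ->
    P ((fun t => complex.Re (cdot u (h t))) @^-1` B1 `&`
       (fun t => complex.Im (cdot u (h t))) @^-1` B2 `&` setT) =
    normal_prob 0 sg B1 * normal_prob 0 sg B2 * P setT.
  move=> mB1 mB2.
  have /= := @projection_box _ _ _ _ _ _ _ a0 hG u (index_enum 'I_M)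
    (index_enum_uniq _) _ (fun=> setT) _ B1 B2 mB1 mB2.
  rewrite -qE => /(_ q0) H.
  have boxT : \bigcap_k coordinate h k @^-1` (setT : set mR) = setT by apply/seteqP; split.
  have {}H := H (conj (fun=> measurableT) (fun _ _ _ => erefl)).
  move: H; rewrite boxT => <-; congr (P (_ `&` _ `&` _)).
    by apply/seteqP; split=> t /=; rewrite Re_cdot.
  by apply/seteqP; split=> t /=; rewrite Im_cdot.
rewrite -radial_mass_gamma// -(normal_radius sg0 mB).
have mr : measurable_fun [set: mR * mR] (fun z : mR * mR => (z.1 ^+ 2 + z.2 ^+ 2) / (sg ^+ 2 *+ 2))%R.
  by apply: measurable_funM => //; apply: measurable_funD; exact: measurable_funX.
have mC : measurable [set z : mR * mR | B ((z.1 ^+ 2 + z.2 ^+ 2) / (sg ^+ 2 *+ 2))%R].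
  by rewrite -[X in measurable X]setTI; exact: mr.
have := @joint_law _ _ _ P (normal_prob 0 sg) (normal_prob 0 sg) _ _ _
  (measurable_Re_cdot u) (measurable_Im_cdot u) measurableT H _ mC.
rewrite probability_setT mule1 setIT => <-; congr (P _).
apply/seteqP; split=> t /=; rewrite gainE sg2;
  by rewrite (_ : (_ / (q * a) = (complex.Re (cdot u (h t)) ^+ 2 + complex.Im (cdot u (h t)) ^+ 2) / q / a)%R)// invfM mulrA.
Qed.

Lemma sqnorm_law (B : set mR) : (0 < M)%N -> measurable B ->
  P ((fun t => (sqnorm (h t) / a)%R) @^-1` B) =
  \int[lebesgue_measure]_(t in B) (gamma_pdf M.-1 t)%:E.
Proof.
move=> M0 mB.
have szE : size (index_enum 'I_M) = M.
  by rewrite -[RHS]card_ord cardT enumT /index_enum unlock.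
have : index_enum 'I_M = index_enum 'I_M by [].
case: {1}(index_enum 'I_M) => [|j0 l] lE; first by exfalso; move: M0; rewrite -{1}szE -lE.
have ul : uniq (j0 :: l) by rewrite lE index_enum_uniq.
have /= := @radius_sum_box _ _ _ P _ _ _ a0 hG j0 l ul (fun=> setT) _ B mB.
have boxT : \bigcap_k coordinate h k @^-1` (setT : set mR) = setT by apply/seteqP; split.
rewrite boxT probability_setT mule1 setIT.
have -> : size l = M.-1 by move: (congr1 predn szE); rewrite -lE.
move=> /(_ (conj (fun=> measurableT) (fun _ _ _ => erefl))) <-.
congr (P _); apply/seteqP; split=> t /=; by rewrite lE sqnormE mulr_suml.
Qed.

End gaussian_laws.

(** * Logarithmic moments of the Gamma law *)

Section log_moments.
Variable R : realType.
Local Notation mR := (measurableTypeR R).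
Local Notation lambda := (@lebesgue_measure R).

Lemma ln_le_id (x : R) : 0 < x -> ln x <= x.
Proof.
move=> x0; have x1 : -1 < x - 1 by lra.
by have := le_ln1Dx x1; rewrite (_ : 1 + (x - 1) = x); [lra|ring].
Qed.

Lemma gamma_pdf_pos k (t : R) : 0 < t -> gamma_pdf k t = t ^+ k * expR (- t) / k`!%:R.
Proof. by move=> t0; rewrite /gamma_pdf indicE mem_setE in_itv /= andbT (ltW t0) mul1r. Qed.

Lemma gamma_pdf_neg k (t : R) : t < 0 -> gamma_pdf k t = 0.
Proof. by move=> t0; rewrite /gamma_pdf indicE mem_setE in_itv /= andbT leNgt t0 mul0r. Qed.

(** By [gamma_pdf_conv] and an exchange of integrals, each total mass is the product of the
    preceding one and of that of the exponential density. *)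
Lemma integral_gamma_pdf k : (\int[lambda]_t (gamma_pdf k t)%:E = 1)%E.
Proof.
elim: k => [|k IH]; first by rewrite gamma_pdf0E integral_exponential_pdf.
have mg : measurable_fun [set: mR * mR]
    (fun z : mR * mR => gamma_pdf k z.1 * gamma_pdf 0 (z.2 - z.1)).
  apply: measurable_funM; first exact: (measurableT_comp (@measurable_gamma_pdf R k) measurable_fst).
  by apply: (measurableT_comp (@measurable_gamma_pdf R 0)); exact: measurable_funB.
under eq_integral do rewrite -gamma_pdf_conv.
rewrite -(@tonelli_lebesgue _ (fun x v => gamma_pdf k x * gamma_pdf 0 (v - x)) mg); last first.
  by move=> x y; rewrite mulr_ge0// gamma_pdf_ge0.
rewrite -[RHS]IH; apply: eq_integral => x _.
rewrite -(@ge0_integral_affine_pos R 1 x (fun v => (gamma_pdf k x * gamma_pdf 0 (v - x))%:E))//.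
- rewrite mul1e; under eq_integral do rewrite mul1r addrK EFinM.
  rewrite ge0_integralZl//.
  + by rewrite gamma_pdf0E integral_exponential_pdf// mule1.
  + by apply/measurable_EFinP; exact: measurable_gamma_pdf.
  + by move=> y _; rewrite lee_fin gamma_pdf_ge0.
  + by rewrite lee_fin gamma_pdf_ge0.
- by apply/measurable_EFinP; exact: (measurableT_comp mg (measurable_pair1 x)).
- by move=> y; rewrite lee_fin mulr_ge0// gamma_pdf_ge0.
Qed.

Lemma integrable_gamma_pdf k : lambda.-integrable setT (EFin \o gamma_pdf k).
Proof.
apply/integrableP; split; first by apply/measurable_EFinP; exact: measurable_gamma_pdf.
under eq_integral do rewrite /= ger0_norm ?gamma_pdf_ge0//.
by rewrite integral_gamma_pdf ltry.
Qed.

(* [4 * t ^ (- 3 / 4)] dominates [`|ln t| * t ^ (x - 1)] on ]0, 1] for [x >= 1 / 2]. *)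
Definition log_bound_near0 (t : R) : R := \1_`]0, 1] t * (4 * expR (- (3 / 4) * ln t)).

Lemma measurable_log_bound_near0 : measurable_fun [set: mR] log_bound_near0.
Proof.
apply: measurable_funM; first exact: measurable_indic.
apply: measurable_funM => //; apply: measurableT_comp => //.
by apply: measurable_funM => //; exact: measurable_ln.
Qed.

Lemma log_bound_near0_ge0 t : 0 <= log_bound_near0 t.
Proof. by rewrite !mulr_ge0// expR_ge0. Qed.

Lemma is_derive_rpow (t : R) : 0 < t ->
  is_derive t 1 (fun t => 16 * expR (4^-1 * ln t)) (4 * expR (- (3 / 4) * ln t)).
Proof.
move=> t0; have dln := is_derive1_ln t0.
apply: is_derive_eq; rewrite /GRing.scale /=.
have -> : - (3 / 4) * ln t = 4^-1 * ln t - ln t by field.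
by rewrite expRB lnK ?posrE//; field; rewrite gt_eqF.
Qed.

Lemma integrable_log_bound_near0 : lambda.-integrable setT (EFin \o log_bound_near0).
Proof.
have mf : measurable_fun [set: mR] (EFin \o log_bound_near0).
  by apply/measurable_EFinP; exact: measurable_log_bound_near0.
apply/integrableP; split => //.
under eq_integral do rewrite /= ger0_norm ?log_bound_near0_ge0//.
(* Away from zero the antiderivative of [is_derive_rpow] applies and bounds every integral by [16].
   The index [n.+2] puts the left end strictly below [1]. *)
pose S (n : nat) : set R := `[n.+2%:R^-1, 1]%classic.
have mS n : measurable (S n : set mR) by exact: measurable_itv.
have UE : `]0, 1]%classic = \bigcup_n S n :> set R.
  apply/seteqP; split=> [t|t [n _]]; rewrite /S /= !in_itv /=; last first.
    by move=> /andP[t0 ->]; rewrite andbT (lt_le_trans _ t0)// invr_gt0.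
  move=> /andP[t0 t1]; exists (Num.truncn t^-1) => //=; rewrite in_itv /= t1 andbT.
  rewrite -[leRHS]invrK lef_pV2 ?posrE ?invr_gt0//.
  have /ltW/le_trans : t^-1 < (Num.truncn t^-1).+1%:R by exact: truncnS_gt.
  by apply; rewrite ler_nat.
have -> : (\int[lambda]_t (log_bound_near0 t)%:E = \int[lambda]_(t in \bigcup_n S n) (log_bound_near0 t)%:E)%E.
  rewrite [RHS]integral_mkcond; apply: eq_integral => t _; rewrite patchE -UE.
  by rewrite /log_bound_near0 indicE; case: (t \in _); rewrite ?mul0r.
apply: (@le_lt_trans _ _ 16%:E); last exact: ltry.
have := @ge0_nondecreasing_set_cvg_integral _ mR R S (EFin \o log_bound_near0) lambda.
move=> /(_ _ _ _ _)/cvg_lim <- //.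
- apply: lime_le.
    apply: ereal_nondecreasing_is_cvgn => m n mn.
    apply: ge0_subset_integral => //.
    + exact: measurable_funTS mf.
    + by move=> t _; rewrite lee_fin log_bound_near0_ge0.
    + move=> t; rewrite /S /= !in_itv /= => /andP[t0 ->]; rewrite andbT (le_trans _ t0)//.
      by rewrite lef_pV2 ?posrE// ler_nat.
  apply: nearW => n.
  have n1 : n.+2%:R^-1 < 1 :> R by rewrite invf_lt1 ?ltr1n.
  have n0 : 0 < n.+2%:R^-1 :> R by rewrite invr_gt0.
  have -> : (\int[lambda]_(t in S n) (EFin \o log_bound_near0) t =
      \int[lambda]_(t in `[n.+2%:R^-1%R, 1%R]) (4 * expR (- (3 / 4) * ln t))%:E)%E.
    apply: eq_integral => t; rewrite inE /S /= in_itv /= => /andP[t0 t1].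
    by rewrite /log_bound_near0 indicE mem_setE in_itv /= t1 (lt_le_trans n0 t0) mul1r.
  have dt (t : R) : 0 < t -> derivable (fun t : R => 16 * expR (4^-1 * ln t)) t 1.
    by move=> t0; have [] := is_derive_rpow t0.
  rewrite (@continuous_FTC2 _ _ (fun t => 16 * expR (4^-1 * ln t)))//.
  + rewrite ln1 mulr0 expR0 mulr1 -EFinB lee_fin gerBl.
    by rewrite mulr_ge0// expR_ge0.
  + apply: derivable_within_continuous => t; rewrite in_itv /= => /andP[t0 _].
    have dln := is_derive1_ln (lt_le_trans n0 t0).
    exact: ex_derive.
  + split.
    * by move=> t; rewrite in_itv /= => /andP[t0 _]; apply: dt; exact: lt_trans t0.
    * by apply: cvg_at_right_filter; apply: derivable1_cvg; exact: dt.
    * by apply: cvg_at_left_filter; apply: derivable1_cvg; exact: dt.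
  + move=> t; rewrite in_itv /= => /andP[t0 _]; rewrite derive1E.
    by have [_ ->] := is_derive_rpow (lt_trans n0 t0).
- move=> m n mn; apply/subsetPset => t; rewrite /S /= !in_itv /= => /andP[t0 ->].
  by rewrite andbT (le_trans _ t0)// lef_pV2 ?posrE// ler_nat.
- by move=> n; exact: measurable_funTS.
- by move=> n t _; rewrite lee_fin log_bound_near0_ge0.
Qed.

(** The second summand is [t ^+ n.+2 * expR (- t)] for [t > 0], written as a multiple of a density
    so that its integrability is known. *)
Definition log_bound (n : nat) (t : R) : R :=
  log_bound_near0 t + n.+2`!%:R * gamma_pdf n.+2 t.

Lemma log_bound_ge0 n t : 0 <= log_bound n t.
Proof. by rewrite addr_ge0 ?log_bound_near0_ge0// mulr_ge0// gamma_pdf_ge0. Qed.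

Lemma integrable_log_bound n : lambda.-integrable setT (EFin \o log_bound n).
Proof.
rewrite (_ : EFin \o log_bound n = fun t => ((EFin \o log_bound_near0) t + (n.+2`!%:R)%:E * (EFin \o gamma_pdf n.+2) t)%E); last first.
  by apply/funext => t.
apply: integrableD => //; first exact: integrable_log_bound_near0.
by apply: integrableZl => //; exact: integrable_gamma_pdf.
Qed.

(** The integrand of [Gamma] for [t > 0], in a form that the chain rule differentiates in [x]. *)
Definition gamma_kernel (x t : R) : R := expR ((x - 1) * ln t - t).

(** On []0, 1]] the kernel is at most [t] to the power [- 1 / 2], and [- ln t] is at most four times
    [t] to the power [- 1 / 4]. Beyond [1] the kernel is at most [t ^+ n.+1 * expR (- t)], and
    [ln t <= t]. *)
Lemma gamma_kernel_le n (x t : R) : 2^-1 <= x <= n.+2%:R -> 0 < t ->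
  gamma_kernel x t <= log_bound n t /\ `|ln t| * gamma_kernel x t <= log_bound n t.
Proof.
move=> /andP[x1 x2] t0.
have g0 k : 0 <= gamma_pdf k t by exact: gamma_pdf_ge0.
have [t1|t1] := leP t 1.
  have l0 : 0 <= - ln t by rewrite oppr_ge0 ln_le0.
  have kb : gamma_kernel x t <= expR (- (2^-1) * ln t).
    rewrite ler_expR; nra.
  have lb : log_bound_near0 t <= log_bound n t by rewrite lerDl mulr_ge0.
  have lE : log_bound_near0 t = 4 * (expR (- (4^-1) * ln t) * expR (- (2^-1) * ln t)).
    rewrite /log_bound_near0 indicE mem_setE in_itv /= t0 t1 mul1r -expRD; congr (4 * expR _).
    by field.
  have e0 := expR_ge0 (- (2^-1) * ln t).
  have e1 : 1 - 4^-1 * ln t <= expR (- (4^-1) * ln t).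
    by rewrite -mulNr; exact: expR_ge1Dx.
  split; apply: (le_trans _ lb); rewrite lE.
    nra.
  rewrite ler0_norm; last by rewrite -oppr_ge0.
  have := ler_wpM2l l0 kb; nra.
have lt0 : 0 < ln t by rewrite ln_gt0.
have kb : gamma_kernel x t <= t ^+ n.+1 * expR (- t).
  have -> : t ^+ n.+1 = expR (n.+1%:R * ln t).
    by rewrite mulrC expRM_natr lnK.
  rewrite -expRD ler_expR lerD2r ler_wpM2r ?(ltW lt0)// lerBlDr.
  by rewrite (le_trans x2)// -natr1.
have lb : t ^+ n.+2 * expR (- t) <= log_bound n t.
  rewrite /log_bound gamma_pdf_pos// [_ * (_ / _)]mulrC divfK ?lerDr ?log_bound_near0_ge0//.
have e0 := expR_ge0 (- t).
have tn : t ^+ n.+1 <= t ^+ n.+2 by rewrite [leRHS]exprS ler_peMl ?exprn_ge0// ltW.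
split; first by apply: (le_trans kb); apply: le_trans lb; exact: ler_wpM2r.
rewrite gtr0_norm//; apply: le_trans lb; rewrite exprS -mulrA.
apply: ler_pM => //; [exact: ltW|exact: expR_ge0|exact: ln_le_id].
Qed.

Lemma gamma_kernel_nat n (t : R) : 0 < t ->
  gamma_kernel n.+1%:R t = n`!%:R * gamma_pdf n t.
Proof.
move=> t0; rewrite gamma_pdf_pos// [RHS]mulrC divfK; last by rewrite pnatr_eq0 -lt0n fact_gt0.
rewrite /gamma_kernel expRD; congr (_ * _).
by rewrite -natr1 addrK mulrC expRM_natr lnK.
Qed.

Lemma measurable_gamma_kernel x : measurable_fun [set: mR] (gamma_kernel x).
Proof.
apply: measurableT_comp => //; apply: measurable_funB => //.
by apply: measurable_funM => //; exact: measurable_ln.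
Qed.

Lemma GammaE (x : R) : Gamma x = \int[lambda]_(t in `]0, +oo[) gamma_kernel x t.
Proof.
apply: eq_Rintegral => t; rewrite inE /= in_itv /= andbT => t0.
by rewrite /gamma_kernel expRD /powR gt_eqF.
Qed.

Lemma integrable_ln_gamma_pdf n :
  lambda.-integrable setT (fun t => (ln t * gamma_pdf n t)%:E).
Proof.
have f1 : 1 <= n`!%:R :> R by rewrite ler1n fact_gt0.
apply: (le_integrable _ _ _ (integrable_log_bound n)) => //.
  apply/measurable_EFinP; apply: measurable_funM; first exact: measurable_ln.
  exact: measurable_gamma_pdf.
move=> t _ /=; rewrite lee_fin [leRHS]ger0_norm ?log_bound_ge0//.
have [t0|t0] := leP t 0; first by rewrite ln0// mul0r normr0 log_bound_ge0.
have n12 : 2^-1 <= (n.+1%:R : R) <= n.+2%:R.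
  rewrite ler_nat leqnSn andbT (@le_trans _ R 1)//; last by rewrite ler1n.
  by rewrite invf_le1 ?ler1n.
have [_] := gamma_kernel_le n12 t0.
rewrite gamma_kernel_nat// normrM [`|gamma_pdf n t|]ger0_norm ?gamma_pdf_ge0//.
by apply: le_trans; rewrite ler_wpM2l// ler_peMl// gamma_pdf_ge0.
Qed.

Lemma integral_gt0E (f g : R -> R) : (forall t, 0 < t -> f t = g t) ->
  (forall t, t < 0 -> g t = 0) -> measurable_fun [set: mR] g ->
  (\int[lambda]_(t in `]0%R, +oo[) (f t)%:E = \int[lambda]_t (g t)%:E)%E.
Proof.
move=> fg g0 mg; transitivity (\int[lambda]_(t in `[0%R, +oo[) (g t)%:E)%E.
  rewrite -integral_itv_obnd_cbnd; last by apply/measurable_EFinP; exact: measurable_funTS.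
  by apply: eq_integral => t; rewrite inE /= in_itv /= andbT => t0; rewrite fg.
rewrite [LHS]integral_mkcond; apply: eq_integral => t _.
by rewrite patchE mem_setE in_itv /= andbT; case: leP => // t0; rewrite g0.
Qed.

(** Differentiation under the integral sign: [log_bound n] dominates the kernel and its derivative
    in [x] throughout an interval around [n.+1]. The logarithmic derivative divides by the value of
    [Gamma], a factorial, which normalizes the density. *)
Lemma digamma_nat n :
  ((digamma n.+1%:R)%:E = \int[lambda]_t (ln t * gamma_pdf n t)%:E)%E.
Proof.
pose B : set R := `]0, +oo[%classic.
have mB : measurable (B : set mR) by exact: measurable_itv.
have Ia : (n.+1%:R : R) \in `]2^-1, n.+2%:R[.
  rewrite in_itv /= ltr_nat ltnSn andbT (@lt_le_trans _ R 1)//; last by rewrite ler1n.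
  by rewrite invf_lt1 ?ltr1n.
have intG : lambda.-integrable B (EFin \o log_bound n).
  exact: (integrableS measurableT mB (@subsetT _ _) (integrable_log_bound n)).
have Itv (x : R) : x \in `]2^-1, n.+2%:R[ -> 2^-1 <= x <= n.+2%:R.
  by rewrite in_itv /= => /andP[/ltW -> /ltW ->].
have dk (x t : R) : 0 < t -> is_derive x 1 (gamma_kernel ^~ t) (ln t * gamma_kernel x t).
  move=> t0; rewrite /gamma_kernel; apply: is_derive_eq; rewrite /GRing.scale /=; ring.
have intf x : x \in `]2^-1, n.+2%:R[ -> lambda.-integrable B (EFin \o gamma_kernel x).
  move=> Ix; apply: (le_integrable _ _ _ intG) => //.
    by apply/measurable_EFinP; apply: measurable_funTS; exact: measurable_gamma_kernel.
  move=> t; rewrite /B /= in_itv /= andbT => t0.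
  rewrite lee_fin !ger0_norm ?log_bound_ge0 ?expR_ge0//.
  by have [] := gamma_kernel_le (Itv _ Ix) t0.
have derf (x t : R) : x \in `]2^-1, n.+2%:R[ -> B t -> derivable (gamma_kernel ^~ t) x 1.
  by move=> _; rewrite /B /= in_itv /= andbT => t0; have [] := dk x t t0.
have d1E (x t : R) : 0 < t -> partial1of2 gamma_kernel x t = ln t * gamma_kernel x t.
  by move=> t0; rewrite partial1of2E; have [_ ->] := dk x t t0.
have Gub (x t : R) : x \in `]2^-1, n.+2%:R[ -> B t -> `|partial1of2 gamma_kernel x t| <= log_bound n t.
  move=> Ix; rewrite /B /= in_itv /= andbT => t0; rewrite d1E//.
  have [_] := gamma_kernel_le (Itv _ Ix) t0.
  by rewrite normrM [`|gamma_kernel x t|]ger0_norm ?expR_ge0.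
have dG := @derivable_under_integral R _ _ lambda gamma_kernel B mB _ _ _ Ia intf derf _ (log_bound_ge0 n) intG Gub.
have dGE := @differentiation_under_integral R _ _ lambda gamma_kernel B mB _ _ _ Ia intf derf _ (log_bound_ge0 n) intG Gub.
have GE : @Gamma R = (fun x => \int[lambda]_(t in B) gamma_kernel x t).
  by apply/funext => x; exact: GammaE.
have G1 : Gamma n.+1%:R = n`!%:R :> R.
  rewrite GE /Rintegral (integral_gt0E (g := fun t => n`!%:R * gamma_pdf n t)).
  - under eq_integral do rewrite EFinM.
    rewrite integralZl//; last exact: integrable_gamma_pdf.
    by rewrite integral_gamma_pdf mule1.
  - by move=> t; exact: gamma_kernel_nat.
  - by move=> t t0; rewrite gamma_pdf_neg// mulr0.
  - by apply: measurable_funM => //; exact: measurable_gamma_pdf.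
have f0 : 0 < n`!%:R :> R by rewrite ltr0n fact_gt0.
rewrite /digamma (_ : (fun y => ln (Gamma y)) = @ln R \o @Gamma R)//.
have dln : is_derive (Gamma n.+1%:R : R) 1 (@ln R) (Gamma n.+1%:R)^-1.
  by apply: is_derive1_ln; rewrite G1.
rewrite derive1_comp; [|by rewrite GE|by case: dln].
have -> : derive1 (@ln R) (Gamma n.+1%:R) = (Gamma n.+1%:R)^-1.
  by rewrite derive1E; have [_ ->] := dln.
rewrite G1 GE dGE /Rintegral.
rewrite (integral_gt0E (g := fun t => n`!%:R * (ln t * gamma_pdf n t))).
- under eq_integral do rewrite EFinM.
  have fin := integrable_fin_num measurableT (integrable_ln_gamma_pdf n).
  rewrite integralZl//; last exact: integrable_ln_gamma_pdf.
  by rewrite fineM// mulKf ?gt_eqF// fineK.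
- by move=> t t0; rewrite d1E// gamma_kernel_nat//; ring.
- by move=> t t0; rewrite gamma_pdf_neg// !mulr0.
- apply: measurable_funM => //; apply: measurable_funM; first exact: measurable_ln.
  exact: measurable_gamma_pdf.
Qed.

(* [F] is an antiderivative of [g] that vanishes at both ends of the half-line, so the
   integral of [g] is [0]. *)
Let F n (t : R) := - (t ^+ n.+1 * expR (- t) / n.+1`!%:R * ln t).

Let g n (t : R) :=
  ln t * gamma_pdf n.+1 t - ln t * gamma_pdf n t - n.+1%:R^-1 * gamma_pdf n t.

Let is_derive_F n (t : R) : 0 < t -> is_derive t 1 (F n) (g n t).
Proof.
move=> t0; have dln := is_derive1_ln t0.
have e (x : R) : is_derive x 1 (fun x => expR (- x)) (- expR (- x)).
  by apply: is_derive_eq; rewrite /GRing.scale /=; ring.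
have ex := is_derive_exprn n.+1 t.
have -> : F n = (fun t => - (t ^+ n.+1 * expR (- t) / n.+1`!%:R * ln t)) by [].
apply: is_derive_eq; rewrite /GRing.scale /= /g !gamma_pdf_pos//.
rewrite factS natrM !exprS; field.
by rewrite (gt_eqF t0) addrC natr1 !pnatr_eq0 -lt0n fact_gt0.
Qed.

(** The ends are exponentials so that the logarithm in [F] is exactly plus or minus [m.+1]; the
    other factor decays fast enough on either side. *)
Let F_bound n (m : nat) :
  `|F n (expR m.+1%:R) - F n (expR (- m.+1%:R))| <= (n.+3`!%:R + 2) / m.+1%:R.
Proof.
set x : R := m.+1%:R; have x1 : 1 <= x by rewrite ler1n.
have x0 : 0 < x by rewrite ltr0n.
have f1 k : 1 <= k`!%:R :> R by rewrite ler1n fact_gt0.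
have small : `|F n (expR (- x))| <= 2 / x.
  have e0 : 0 < expR (- x) by exact: expR_gt0.
  rewrite /F normrN normrM expRK normrN [`|x|]gtr0_norm//.
  rewrite ger0_norm; last by rewrite divr_ge0// mulr_ge0 ?exprn_ge0 ?expR_ge0.
  apply: (@le_trans _ _ (expR (- x) * x)).
    rewrite ler_wpM2r ?(ltW x0)// ler_pdivrMr ?(lt_le_trans ltr01)//.
    rewrite exprS -!mulrA ler_wpM2l ?(ltW e0)//.
    apply: (@le_trans _ _ 1); last exact: f1.
    rewrite mulr_ile1 ?exprn_ge0 ?(ltW e0) ?expR_ge0//.
      by rewrite exprn_ile1 ?(ltW e0)// -expR0 ler_expR oppr_le0 ltW.
  (* From [x ^+ 2 / 2 <= expR x] follows [expR (- x) * x <= 2 / x]. *)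
  have := @expR_ge1Dxn R x 1 (ltW x0); rewrite -[2`!]/2%N => ex.
  rewrite expRN mulrC ler_pdivlMr// mulrAC ler_pdivrMr ?expR_gt0//.
  lra.
have large : `|F n (expR x)| <= n.+3`!%:R / x.
  set b := expR x; have b0 : 0 < b by exact: expR_gt0.
  have xb : x <= b by have := expR_ge1Dx x; rewrite -/b; lra.
  rewrite /F normrN normrM expRK [`|x|]gtr0_norm//.
  rewrite ger0_norm; last by rewrite divr_ge0// mulr_ge0 ?exprn_ge0 ?expR_ge0// ltW.
  (* [b ^+ n.+3] is at most the factorial times [expR b]; two of its factors absorb [x * x] because
     [x <= b]. *)
  have := @expR_ge1Dxn R b n.+2 (ltW b0) => eb.
  have h1 : b ^+ n.+3 <= n.+3`!%:R * expR b.
    rewrite -ler_pdivrMl ?(lt_le_trans ltr01)// mulrC; lra.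
  apply: (@le_trans _ _ (b ^+ n.+1 * expR (- b) * x)).
    rewrite ler_wpM2r ?(ltW x0)// ler_pdivrMr ?(lt_le_trans ltr01)//.
    by rewrite ler_peMr// mulr_ge0 ?exprn_ge0 ?expR_ge0// ltW.
  rewrite ler_pdivlMr// expRN.
  apply: (@le_trans _ _ (b ^+ n.+3 / expR b)).
    have -> : b ^+ n.+1 / expR b * x * x = b ^+ n.+1 * (x * x) / expR b by ring.
    rewrite ler_wpM2r ?invr_ge0 ?expR_ge0// -[n.+3]/(2 + n.+1)%N exprD mulrC.
    by rewrite ler_wpM2r ?exprn_ge0 ?(ltW b0)// expr2 ler_pM// ltW.
  by rewrite ler_pdivrMr ?expR_gt0.
by rewrite (le_trans (ler_normB _ _))// mulrDl lerD.
Qed.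

(** Integrated term by term with [digamma_nat], [g n] gives the difference of the two sides;
    integrated over growing intervals, it gives increments of [F n] that tend to zero by
    [F_bound]. *)
Lemma digamma_rec n : digamma n.+2%:R = digamma n.+1%:R + n.+1%:R^-1 :> R.
Proof.
have ig k : lambda.-integrable setT (fun t => (ln t * gamma_pdf k t)%:E).
  exact: integrable_ln_gamma_pdf.
have mg : measurable_fun [set: mR] (g n).
  have ml k : measurable_fun [set: mR] (fun t : mR => ln t * gamma_pdf k t).
    by apply: measurable_funM; [exact: measurable_ln|exact: measurable_gamma_pdf].
  apply: measurable_funB; first by apply: measurable_funB; exact: ml.
  by apply: measurable_funM => //; exact: measurable_gamma_pdf.
have i3 : lambda.-integrable setT (fun t => ((n.+1%:R^-1)%:E * (gamma_pdf n t)%:E)%E).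
  by apply: integrableZl => //; exact: integrable_gamma_pdf.
have i12 : lambda.-integrable setT (fun t => ((ln t * gamma_pdf n.+1 t)%:E - (ln t * gamma_pdf n t)%:E)%E).
  by apply: integrableB.
have intg : lambda.-integrable setT (EFin \o g n) by exact: (integrableB measurableT i12 i3).
have intgE : (\int[lambda]_t (g n t)%:E = (digamma n.+2%:R - digamma n.+1%:R - n.+1%:R^-1)%:E)%E.
  have d1 := digamma_nat n; have d2 := digamma_nat n.+1.
  move: (digamma n.+1%:R) (digamma n.+2%:R) d1 d2 => x y d1 d2.
  have d3 : (\int[lambda]_t ((n.+1%:R^-1)%:E * (gamma_pdf n t)%:E) = (n.+1%:R^-1)%:E)%E.
    rewrite integralZl//; last exact: integrable_gamma_pdf.
    by rewrite integral_gamma_pdf mule1.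
  under eq_integral do rewrite /g EFinB EFinB [X in (_ - X)%E]EFinM.
  by rewrite integralB// integralB// -d1 -d2 d3.
pose B : set R := `]0, +oo[%classic.
have mB : measurable (B : set mR) by exact: measurable_itv.
pose S (m : nat) : set R := `[expR (- m.+1%:R), expR m.+1%:R]%classic.
have mS m : measurable (S m : set mR) by exact: measurable_itv.
have Sg m : (\int[lambda]_(t in B) (\1_(S m) t * g n t)%:E =
    (F n (expR m.+1%:R) - F n (expR (- m.+1%:R)))%:E)%E.
  have dF (t : R) : expR (- m.+1%:R) <= t -> is_derive t 1 (F n) (g n t).
    by move=> t0; apply: is_derive_F; apply: lt_le_trans t0; exact: expR_gt0.
  rewrite EFinB -(@continuous_FTC2 _ (fun t => - (- (g n t)))).
  - rewrite [LHS]integral_mkcond [RHS]integral_mkcond; apply: eq_integral => t _.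
    rewrite !patchE opprK indicE; case: ifPn => [tB|tB].
      by case: ifP => _; rewrite ?mul1r ?mul0r.
    case: ifPn => // tS; move: tB; rewrite /B mem_setE in_itv /= andbT -leNgt.
    move: tS; rewrite mem_setE in_itv /= => /andP[t1 _] t0.
    by have := lt_le_trans (lt_le_trans (expR_gt0 _) t1) t0; rewrite ltxx.
  - by rewrite ltr_expR gtrN.
  (* Inside the interval the indicators hidden in [g] equal [1]; the expression without them is
     differentiable. *)
  - apply: (@subspace_eq_continuous _ _ _ (fun t => ln t * (t ^+ n.+1 * expR (- t) / n.+1`!%:R)
        - ln t * (t ^+ n * expR (- t) / n`!%:R) - n.+1%:R^-1 * (t ^+ n * expR (- t) / n`!%:R))).
      move=> t; rewrite inE /= in_itv /= => /andP[t1 _].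
      rewrite /from_subspace /= opprK.
      by rewrite /g !gamma_pdf_pos// (lt_le_trans (expR_gt0 _) t1).
    apply: derivable_within_continuous => t; rewrite in_itv /= => /andP[t1 _].
    have dln := is_derive1_ln (lt_le_trans (expR_gt0 _) t1).
    have e1 := is_derive_exprn n.+1 t; have e2 := is_derive_exprn n t.
    pose G (t : R) := ln t * (t ^+ n.+1 * expR (- t) / n.+1`!%:R) -
      ln t * (t ^+ n * expR (- t) / n`!%:R) - n.+1%:R^-1 * (t ^+ n * expR (- t) / n`!%:R).
    suff: derivable G t 1 by [].
    exact: ex_derive.
  - have dd (t : R) : expR (- m.+1%:R) <= t -> derivable (F n) t 1.
      by move=> t0; have [] := dF t t0.
    split.
    + by move=> t; rewrite in_itv /= => /andP[t0 _]; apply: dd; exact: ltW.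
    + by apply: cvg_at_right_filter; apply: derivable1_cvg; exact: dd.
    + apply: cvg_at_left_filter; apply: derivable1_cvg; apply: dd.
      by apply: ltW; rewrite ltr_expR gtrN.
  - by move=> t; rewrite in_itv /= => /andP[/ltW t0 _]; rewrite derive1E opprK; have [_ ->] := dF t t0.
have c1 : (\int[lambda]_(t in B) (\1_(S m) t * g n t)%:E)%E @[m --> \oo] -->
    (\int[lambda]_(t in B) (g n t)%:E)%E.
  apply: (@dominated_cvg _ mR R lambda B mB (fun m t => (\1_(S m) t * g n t)%:E)
    (EFin \o g n) (fun t => `|(g n t)%:E|)%E) => //.
  - move=> m; apply/measurable_EFinP; apply: measurable_funM; first exact: measurable_indic.
    exact: measurable_funTS.
  - move=> t; rewrite /B /= in_itv /= andbT => t0.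
    apply: cvg_near_cst; near=> m; rewrite indicE mem_set ?mul1r//.
    rewrite /S /= in_itv /= -[X in _ <= X <= _](lnK t0) !ler_expR -ler_norml.
    near: m; exists (Num.truncn `|ln t|) => // m /= Hm.
    rewrite (le_trans (ltW (truncnS_gt _)))// ler_nat ltnS//.
  - apply: integrable_abse; exact: (integrableS measurableT mB (@subsetT _ _) intg).
  - move=> m t _; rewrite /= lee_fin normrM; apply: ler_piMl => //.
    by rewrite indicE; case: (t \in _); rewrite /= ?normr0 ?normr1.
have c2 : (\int[lambda]_(t in B) (\1_(S m) t * g n t)%:E)%E @[m --> \oo] --> 0%E.
  under eq_cvg do rewrite Sg.
  apply: cvg_EFin; first exact: nearW.
  apply: norm_cvg0; apply: (@squeeze_cvgr _ _ _ _ (cst 0) (fun m => (n.+3`!%:R + 2) * harmonic m)).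
  - by near=> m; rewrite normr_ge0 /= F_bound.
  - exact: cvg_cst.
  - by rewrite -[X in _ --> X](mulr0 (n.+3`!%:R + 2)); apply: cvgMr; exact: cvg_harmonic.
have : (\int[lambda]_(t in B) (g n t)%:E = 0)%E by exact: (cvg_unique _ c1 c2).
rewrite (integral_gt0E (g := g n))//; last first.
  by move=> t t0; rewrite /g !gamma_pdf_neg// !mulr0 !subr0.
rewrite intgE => -[].
by move=> /eqP; rewrite subr_eq add0r subr_eq => /eqP ->; rewrite addrC.
Unshelve. all: by end_near. Qed.

Lemma digamma_sum n : digamma n.+1%:R - digamma 1 = \sum_(1 <= i < n.+1) i%:R^-1 :> R.
Proof.
elim: n => [|n IH]; first by rewrite big_geq// subrr.
by rewrite big_nat_recr//= -IH digamma_rec addrAC.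
Qed.

End log_moments.

(** * Max-min beams *)

Section max_min_beam.
Variables (R : realType) (M : nat).
Implicit Types (h w v : 'cV[R[i]]_M) (u z : R -> R) (r q : R).

(** [u r] and [z r] are the gains that the rate [r] demands from the two channels. The form is
    symmetric in the two, so a statement about one gain gives the other through [beam_optimalC]. *)
Definition beam_feasible u z h h' w r :=
  [/\ u r <= gain w h, z r <= gain w h' & sqnorm w = 1].

Definition beam_optimal u z h h' w r :=
  beam_feasible u z h h' w r /\
  forall w' r', beam_feasible u z h h' w' r' -> r' <= r.

Lemma beam_feasibleC u z h h' w r :
  beam_feasible u z h h' w r -> beam_feasible z u h' h w r.
Proof. by case. Qed.

Lemma beam_optimalC u z h h' w r :
  beam_optimal u z h h' w r -> beam_optimal z u h' h w r.
Proof. by move=> [/beam_feasibleC f m]; split=> // w' r' /beam_feasibleC; exact: m. Qed.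

(** By continuity of the thresholds, a beam with slack in both constraints would carry a slightly
    larger rate. *)
Lemma beam_strictly_feasible u z h h' w w' r : {for r, continuous u} ->
  {for r, continuous z} -> beam_optimal u z h h' w r -> sqnorm w' = 1 ->
  u r < gain w' h -> z r < gain w' h' -> False.
Proof.
move=> cu cz [_ opt] w1 hu hz.
have nu : \forall x \near r, u x < gain w' h by apply: (cvgr_lt (u r) cu).
have nz : \forall x \near r, z x < gain w' h' by apply: (cvgr_lt (z r) cz).
have : \forall x \near r, u x < gain w' h /\ z x < gain w' h'.
  by near=> x; split; near: x.
move=> /nbhs_ballP[e /= e0 He].
have /He[/ltW H1 /ltW H2] : ball r e (r + e / 2).
  by rewrite /ball /= opprD addNKr normrN gtr0_norm ?divr_gt0// ltr_pdivrMr// ltr_pMr// ltr1n.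
have : r + e / 2 <= r by apply: (opt w').
by rewrite gerDl leNgt divr_gt0.
Unshelve. all: by end_near. Qed.

(* Otherwise [gain_improve] tilts [w] towards [h'] and makes both constraints slack. *)
Lemma beam_slack u z h h' w r : {for r, continuous u} -> {for r, continuous z} ->
  beam_optimal u z h h' w r -> u r < gain w h -> gain w h' = sqnorm h'.
Proof.
move=> cu cz opt su; have [[_ zr w1] _] := opt.
apply/eqP; rewrite eq_le; apply/andP; split; first by have := gain_le w h'; rewrite w1 mul1r.
rewrite leNgt; apply/negP => slack.
have mid : (u r + gain w h) / 2 < gain w h by lra.
have [v [v1 v2 v3]] := gain_improve w1 slack (or_introl mid).
apply: (beam_strictly_feasible cu cz opt v1); last exact: le_lt_trans v2.
by apply: lt_le_trans v3; lra.
Qed.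

(** If the constraint on [h] is slack, [w] is matched to [h'] by [beam_slack]; otherwise the gain is
    [u r]. The right side does not mention [w], so all optimal beams share this gain. *)
Lemma beam_optimal_gain u z h h' w r : {for r, continuous u} -> {for r, continuous z} ->
  h' != 0 -> beam_optimal u z h h' w r ->
  gain w h = Num.max (u r) (gain h' h / sqnorm h').
Proof.
move=> cu cz h'0 opt; have [[ur zr w1] _] := opt.
have [su|] := ltP (u r) (gain w h).
  have e := @gain_eq_max _ _ w h' h h'0 w1 (beam_slack cu cz opt su).
  by rewrite -e max_r// ltW.
move=> uge; have {uge ur}uE : gain w h = u r by apply/eqP; rewrite eq_le uge ur.
rewrite uE; apply/esym/max_idPl; rewrite leNgt; apply/negP => lt.
(* If [u r] were below the gain of the beam [v] matched to [h'], then [v] would satisfy both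
   constraints strictly, unless [w] already attains the full gain at [h']. *)
have n1 := normalized_sqnorm h'0; set v := (X in sqnorm X) in n1.
have vh g : gain v g = gain h' g / sqnorm h' by exact: normalized_gain.
have X0 : sqnorm h' != 0 by rewrite sqnorm_eq0.
have vh' : gain v h' = sqnorm h' by rewrite vh gain_vv expr2 mulfK.
have le : gain w h' <= sqnorm h' by have := gain_le w h'; rewrite w1 mul1r.
have [e|ne] := eqVneq (gain w h') (sqnorm h').
  by move: lt; rewrite -(@gain_eq_max _ _ w h' h h'0 w1 e) uE ltxx.
apply: (beam_strictly_feasible cu cz opt n1); first by rewrite vh.
by rewrite vh' (le_lt_trans zr)// lt_neqAle ne.
Qed.

Lemma beam_optimal_bounds u z h h' w r : {for r, continuous u} ->
  {for r, continuous z} -> h' != 0 -> beam_optimal u z h h' w r ->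
  gain h' h / sqnorm h' <= gain w h <= sqnorm h.
Proof.
move=> cu cz h'0 opt; rewrite {1}(beam_optimal_gain cu cz h'0 opt) le_max lexx orbT /=.
by have [[_ _ w1] _] := opt; have := gain_le w h; rewrite w1 mul1r.
Qed.

(* Rational beams and rational rates decide whether the optimal rate exceeds [c]. *)
Lemma beam_optimal_gt u z h h' w r c :
  (forall q r, q < r -> u q < u r \/ u q <= 0) ->
  (forall q r, q < r -> z q < z r \/ z q <= 0) ->
  beam_optimal u z h h' w r ->
  c < r <-> exists (q : rat) (f : {ffun 'I_M -> rat * rat}), [/\ c < ratr q, rat_vector R f != 0,
    u (ratr q) * sqnorm (rat_vector R f) <= gain (rat_vector R f) h &
    z (ratr q) * sqnorm (rat_vector R f) <= gain (rat_vector R f) h'].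
Proof.
move=> su sz [[ur zr w1] opt]; split=> [cr|[q [f [cq f0 uf zf]]]].
  have [q /andP[cq qr]] := rat_in_itvoo cr.
  have near g (s : R -> R) : (forall q r, q < r -> s q < s r \/ s q <= 0) ->
      s r <= gain w g -> exists2 e : R, 0 < e & forall v, sqnorm (v - w) <= e ->
        s (ratr q) * sqnorm v <= gain v g.
    move=> ss sr; apply: gain_near => //.
    by case: (ss _ _ qr) => [lt|]; [left; apply: lt_le_trans sr|right].
  have [e1 e10 H1] := near h u su ur; have [e2 e20 H2] := near h' z sz zr.
  (* A squared distance of at most [1 / 4] from the unit vector [w] keeps the rational vector away
     from zero. *)
  pose e := Num.min (4^-1) (Num.min e1 e2).
  have e0 : 0 < e by rewrite !lt_min e10 e20 !andbT invr_gt0 ltr0n.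
  have [f Hf] := rat_vector_dense w e0; exists q, f; split => //.
  - apply/eqP => f0; move: Hf; rewrite f0 sub0r -scaleN1r sqnormZ w1 mulr1.
    have -> : Normc.normc (-1 : R[i]) ^+ 2 = 1 by rewrite sqr_normc /= sqrrN expr1n oppr0 expr0n addr0.
    rewrite !le_min => /andP[+ _].
    by rewrite leNgt invf_lt1 ?ltr1n.
  - by apply: H1; rewrite (le_trans Hf)// !ge_min lexx !orbT.
  - by apply: H2; rewrite (le_trans Hf)// !ge_min lexx !orbT.
apply: (lt_le_trans cq); apply: (opt ((Num.sqrt (sqnorm (rat_vector R f)))^-1%:C%C *: rat_vector R f)).
have f1 : 0 < sqnorm (rat_vector R f) by rewrite sqnorm_gt0.
by split; [rewrite normalized_gain ler_pdivlMr|rewrite normalized_gain ler_pdivlMr|exact: normalized_sqnorm].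
Qed.

End max_min_beam.

(** * Exponential thresholds and the dependence on the power *)

Section exponential_thresholds.
Variables (R : realType) (M : nat).
Implicit Types (h w v : 'cV[R[i]]_M) (A B a b p r q : R).

(* The gain [g] for which [A * r = ln (1 + p * a * g)]. *)
Definition threshold A a p r : R := (expR (A * r) - 1) / (p * a).

Lemma threshold_continuous A a p r : {for r, continuous (threshold A a p)}.
Proof.
apply: differentiable_continuous; apply/derivable1_diffP.
exact: ex_derive.
Qed.

Lemma threshold_homo A a p : 0 <= A -> 0 < a -> 0 < p -> {homo threshold A a p : q r / q <= r}.
Proof.
move=> A0 a0 p0 q r qr; rewrite ler_wpM2r ?invr_ge0 ?mulr_ge0 ?(ltW a0) ?(ltW p0)//.
by rewrite lerD2r ler_expR ler_wpM2l.
Qed.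

(** A zero exponent gives a threshold that vanishes identically, so strict growth fails there; the
    second alternative is the one that [gain_near] accepts. *)
Lemma threshold_strict A a p q r : 0 <= A -> 0 < a -> 0 < p -> q < r ->
  threshold A a p q < threshold A a p r \/ threshold A a p q <= 0.
Proof.
rewrite le_eqVlt => /predU1P[<-|A0] a0 p0 qr; [right|left].
  by rewrite /threshold mul0r expR0 subrr mul0r.
by rewrite ltr_pM2r ?invr_gt0 ?mulr_gt0// ltrD2r ltr_expR ltr_pM2l.
Qed.

Lemma threshold0 A a p : threshold A a p 0 = 0.
Proof. by rewrite /threshold mulr0 expR0 subrr mul0r. Qed.

Lemma beam_optimal_ge0 A B a b p h h' w r :
  beam_optimal (threshold A a p) (threshold B b p) h h' w r -> 0 <= r.
Proof.
by move=> [[_ _ w1] opt]; apply: (opt w); split; rewrite ?threshold0 ?gain_ge0.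
Qed.

(* The rate is limited by the exponent [B]: [expR (B * r)] is at most linear in [p], hence
   [expR (A * r)] is sublinear. *)
Lemma beam_dominant A B a b h h' : 0 <= A < B -> 0 < a -> 0 < b -> h' != 0 ->
  0 < gain h' h -> exists p0 : R, forall p w r, p0 < p ->
  beam_optimal (threshold A a p) (threshold B b p) h h' w r ->
  gain w h = gain h' h / sqnorm h' /\ gain w h' = sqnorm h'.
Proof.
move=> /andP[A0 AB] a0 b0 h'0 g0; set X := sqnorm h'; set G := gain h' h / X.
have X0 : 0 < X by rewrite sqnorm_gt0.
have G0 : 0 < G by rewrite divr_gt0.
have bX0 : 0 < b * X by rewrite mulr_gt0.
have B0 : 0 < B by exact: le_lt_trans AB.
(* Since [A * r <= (1 - th) * ln Q], the exponential of [A * r] is at most [Q] to the power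
   [1 - th]. [C] is the value that [Q] to the power [th] must exceed to bring the threshold below
   [G]. *)
pose th := 1 - A / B; have th0 : 0 < th by rewrite subr_gt0 ltr_pdivrMr ?mul1r.
pose C := (b * X + 1) / (a * G); have C0 : 0 < C.
  by apply: divr_gt0; [exact: addr_gt0|exact: mulr_gt0].
(* The second bound makes [p * (b * X)], hence [Q], larger than [C] to the power [1 / th]. *)
exists (Num.max 1 (expR (ln C / th) / (b * X))) => p w r; rewrite gt_max => /andP[p1 pC] opt.
have p0 : 0 < p by exact: lt_trans p1.
have cu := @threshold_continuous A a p r; have cz := @threshold_continuous B b p r.
have [[_ zr w1] _] := opt.
have wX : gain w h' <= X by have := gain_le w h'; rewrite w1 mul1r.
have r0 := beam_optimal_ge0 opt.
pose Q := 1 + p * (b * X); have Q1 : 1 < Q by rewrite ltrDl mulr_gt0.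
have Q0 : 0 < Q by exact: lt_trans Q1.
have EQ : expR (B * r) <= Q.
  have := le_trans zr wX; rewrite ler_pdivrMr ?mulr_gt0// /Q; nra.
have lQ : B * r <= ln Q by rewrite -ler_expR lnK.
have AE : expR (A * r) <= expR (- (th * ln Q)) * Q.
  rewrite -[X in _ <= _ * X](lnK Q0) -expRD ler_expR.
  have -> : - (th * ln Q) + ln Q = A / B * ln Q by rewrite /th; ring.
  have -> : A * r = A / B * (B * r) by field; rewrite gt_eqF.
  by rewrite ler_wpM2l// divr_ge0// ltW.
have CQ : C * expR (- (th * ln Q)) < 1.
  rewrite -[X in X * _](lnK C0) -expRD -expR0 ltr_expR subr_lt0.
  rewrite mulrC -ltr_pdivrMr// -ltr_expR lnK//.
  by move: pC; rewrite ltr_pdivrMr// => /lt_trans; apply; rewrite /Q; lra.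
have ltG : threshold A a p r < G.
  rewrite ltr_pdivrMr ?mulr_gt0//.
  have e0 := expR_gt0 (- (th * ln Q)); set e := expR (- (th * ln Q)) in AE CQ e0.
  have : (b * X + 1) * e < a * G.
    have aG0 : 0 < a * G by exact: mulr_gt0.
    have -> : (b * X + 1) * e = C * e * (a * G) by rewrite mulrAC /C divfK ?gt_eqF.
    by rewrite gtr_pMl.
  have : e * Q <= e * (p * (b * X + 1)) by rewrite ler_wpM2l ?(ltW e0)// /Q; lra.
  move=> H1 H2; have := ler_wpM2l (ltW p0) (ltW H2); lra.
have e1 := beam_optimal_gain cu cz h'0 opt.
have gE : gain w h = G by rewrite e1 max_r// ltW.
by split => //; apply: (beam_slack cu cz opt); rewrite gE.
Qed.

(* With equal exponents [r] can be traded for [(expR (A * r) - 1) / p], which removes [p]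
   from the problem. *)
Lemma beam_balanced A a b h h' p p' w w' r r' : 0 < A -> 0 < a -> 0 < b ->
  h != 0 -> h' != 0 -> 0 < p -> 0 < p' ->
  beam_optimal (threshold A a p) (threshold A b p) h h' w r ->
  beam_optimal (threshold A a p') (threshold A b p') h h' w' r' ->
  gain w h = gain w' h /\ gain w h' = gain w' h'.
Proof.
move=> A0 a0 b0 h0 h'0 p0 p'0.
pose s p r := (expR (A * r) - 1) / p.
have tE c q x : threshold A c q x = s q x / c by rewrite /threshold /s invfM mulrA.
have le p1 p2 w1 w2 r1 r2 : 0 < p1 -> 0 < p2 ->
    beam_optimal (threshold A a p1) (threshold A b p1) h h' w1 r1 ->
    beam_optimal (threshold A a p2) (threshold A b p2) h h' w2 r2 ->
    s p1 r1 <= s p2 r2.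
  move=> p10 p20 o1 [_ o2].
  have s0 : 0 <= s p1 r1.
    rewrite divr_ge0 ?(ltW p10)// subr_ge0 -expR0 ler_expR mulr_ge0 ?(ltW A0)//.
    exact: beam_optimal_ge0 o1.
  have q0 : 0 < 1 + p2 * s p1 r1 by rewrite ltr_pwDl// mulr_ge0// ltW.
  (* The rate that has at power [p2] the same value of [s] as [r1] at power [p1], so that [w1] is
     feasible at it. *)
  pose x := ln (1 + p2 * s p1 r1) / A.
  have sx : s p2 x = s p1 r1.
    rewrite {1}/s /x [A * _]mulrC divfK ?gt_eqF// lnK// addrC addKr.
    by rewrite mulrC mulKf ?gt_eqF.
  have /o2 xr : beam_feasible (threshold A a p2) (threshold A b p2) h h' w1 x.
    by case: o1 => -[f1 f2 f3] _; split => //; rewrite tE sx -tE.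
  rewrite -sx ler_wpM2r ?invr_ge0 ?(ltW p20)// lerD2r ler_expR ler_wpM2l//; exact: ltW.
move=> o o'.
have sE : s p r = s p' r' by apply/eqP; rewrite eq_le (le _ _ _ _ _ _ p0 p'0 o o') (le _ _ _ _ _ _ p'0 p0 o' o).
have cc := threshold_continuous.
split.
  rewrite (beam_optimal_gain (cc _ _ _ _) (cc _ _ _ _) h'0 o).
  by rewrite (beam_optimal_gain (cc _ _ _ _) (cc _ _ _ _) h'0 o') !tE sE.
rewrite (beam_optimal_gain (cc _ _ _ _) (cc _ _ _ _) h0 (beam_optimalC o)).
by rewrite (beam_optimal_gain (cc _ _ _ _) (cc _ _ _ _) h0 (beam_optimalC o')) !tE sE.
Qed.

Lemma feasible_beamE (N L : nat) (alphas alpha p : R) hs hc w r : (0 < N)%N -> (0 < L)%N ->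
  0 < alphas -> 0 < p ->
  feasible N L alphas alpha p hs hc w r <->
  beam_feasible (threshold (L%:R * alpha * ln 2) (N%:R * L%:R * alphas) p)
    (threshold ((1 - alpha) * ln 2) 1 p) hs hc w r.
Proof.
move=> N0 L0 as0 p0; have l2 : 0 < ln 2 :> R by rewrite ln_gt0// ltr1n.
have a0 : 0 < N%:R * L%:R * alphas by rewrite !mulr_gt0 ?ltr0n.
have key (x c g : R) : 0 < c -> 0 <= g ->
    (x <= log2 (1 + p * c * g)) = ((expR (x * ln 2) - 1) / (p * c) <= g).
  move=> c0 g0; have q0 : 0 < 1 + p * c * g by rewrite ltr_pwDl// !mulr_ge0// ltW.
  rewrite /log2 ler_pdivlMr// -[x * _ <= _]ler_expR lnK ?posrE// ler_pdivrMr ?mulr_gt0//.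
  by rewrite lerBlDr addrC [g * _]mulrC.
rewrite /feasible /beam_feasible.
have -> : sens_rate N L alphas p hs w = L%:R^-1 * log2 (1 + p * (N%:R * L%:R * alphas) * gain w hs).
  by rewrite /sens_rate !mulrA.
have -> : comm_rate p hc w = log2 (1 + p * 1 * gain w hc) by rewrite /comm_rate mulr1.
have E1 : (alpha * r <= L%:R^-1 * log2 (1 + p * (N%:R * L%:R * alphas) * gain w hs)) =
    (threshold (L%:R * alpha * ln 2) (N%:R * L%:R * alphas) p r <= gain w hs).
  rewrite ler_pdivlMl ?ltr0n// key ?gain_ge0// /threshold.
  by congr ((expR _ - 1) / _ <= _); ring.
have E2 : ((1 - alpha) * r <= log2 (1 + p * 1 * gain w hc)) =
    (threshold ((1 - alpha) * ln 2) 1 p r <= gain w hc).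
  by rewrite key ?gain_ge0// /threshold; congr ((expR _ - 1) / _ <= _); ring.
by rewrite E1 E2.
Qed.

Lemma optimal_beamformerE (N L : nat) (alphas alpha p : R) hs hc w : (0 < N)%N -> (0 < L)%N ->
  0 < alphas -> 0 < p -> optimal_beamformer N L alphas alpha p hs hc w ->
  exists r, beam_optimal (threshold (L%:R * alpha * ln 2) (N%:R * L%:R * alphas) p)
    (threshold ((1 - alpha) * ln 2) 1 p) hs hc w r.
Proof.
move=> N0 L0 as0 p0 [r f m]; exists r; split; first exact/(feasible_beamE alpha hs hc w r N0 L0 as0 p0).
by move=> w' r' /(feasible_beamE alpha hs hc w' r' N0 L0 as0 p0); exact: m.
Qed.

End exponential_thresholds.

(** * High-SNR asymptotics *)

Section high_snr.
Context (R : realType) d (T : measurableType d) (P : probability T R).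
Local Notation mR := (measurableTypeR R).
Implicit Types (G : set T) (p K : R).

Lemma integral_full_set G (f : T -> \bar R) : measurable G -> P (~` G) = 0%E ->
  measurable_fun setT f -> (\int[P]_t f t = \int[P]_(t in G) f t)%E.
Proof.
move=> mG G0 mf; rewrite [RHS]integral_mkcond; apply: ae_eq_integral => //.
  by apply/(measurable_restrictT _ mG); exact: measurable_funTS.
exists (~` G); split => //; first exact: measurableC.
move=> t /= H Gt; apply: H => _.
by rewrite patchE mem_set.
Qed.

(** [b + 1] is at most [2] or at most [2 * b], whence the term [ln 2]. This bounds [ln (p^-1 + g)]
    uniformly in [p >= 1] when [a <= g <= b]. *)
Lemma ln_shift_bound (a b x : R) : 0 < a -> a <= x <= b + 1 ->
  `|ln x| <= `|ln a| + `|ln b| + ln 2.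
Proof.
move=> a0 /andP[ax xb]; have x0 : 0 < x by exact: lt_le_trans ax.
have l2 : 0 <= ln 2 :> R by rewrite ln_ge0// ler1n.
have la : ln a <= ln x by rewrite ler_ln.
have ha := ler_norm (- ln a); rewrite normrN in ha.
have na := normr_ge0 (ln a); have nb := normr_ge0 (ln b); have hb := ler_norm (ln b).
suff lx : ln x <= `|ln b| + ln 2 by rewrite ler_norml; apply/andP; split; lra.
have [b1|b1] := leP b 1.
  have : ln x <= ln 2 by rewrite ler_ln ?posrE//; lra.
  lra.
have : ln x <= ln (b * 2) by rewrite ler_ln ?posrE//; [lra|rewrite mulr_gt0//; lra].
by rewrite lnM ?posrE//; lra.
Qed.

(** [ln (1 + p * g) - ln p] equals [ln (p^-1 + g)]. For [p >= 1] an integrable function free of [p]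
    bounds it, and it converges at each point of [G] because [g] is eventually constant there. The
    integrals of the logarithms of [lo] and [hi] frame the limit. *)
Lemma high_snr_expansion_dominated G (g : R -> T -> R) (lo hi : T -> R)
    (K l1 l2 : R) : measurable G -> P (~` G) = 0%E ->
  (forall p, 0 < p -> measurable_fun setT (g p)) ->
  (forall p t, 0 < p -> G t -> 0 < lo t /\ lo t <= g p t <= hi t) ->
  (forall t, G t -> exists x p0, forall p, p0 < p -> g p t = x) ->
  P.-integrable G (fun t => (ln (lo t))%:E) ->
  P.-integrable G (fun t => (ln (hi t))%:E) ->
  (\int[P]_(t in G) (ln (lo t))%:E = l1%:E)%E ->
  (\int[P]_(t in G) (ln (hi t))%:E = l2%:E)%E ->
  exists Lo, high_snr_expansion (fun p => ('E_P[fun t => (K * log2 (1 + p * g p t))%R])%E) K Lo /\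
    - (l2 / ln 2) <= Lo <= - (l1 / ln 2).
Proof.
move=> mG G0 mg glh glim ilo ihi El1 El2.
have /choice[ginf ginfE] t : exists x, G t -> exists p0, forall p, p0 < p -> g p t = x.
  have [/glim[x Hx]|nG] := pselect (G t); first by exists x.
  by exists 0.
have ln20 : 0 < ln 2 :> R by rewrite ln_gt0// ltr1n.
have PG : P G = 1%E by have := probability_setC P mG; rewrite G0 => /esym/eqP; rewrite sube_eq// add0e => /eqP ->.
pose f p t := ln (1 + p * g p t) - ln p.
have mf p : 0 < p -> measurable_fun setT (f p).
  move=> p0; apply: measurable_funB => //.
  apply: measurableT_comp; first exact: measurable_ln.
  by apply: measurable_funD => //; apply: measurable_funM => //; exact: mg.
have fE p t : 0 < p -> G t -> f p t = ln (p^-1 + g p t).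
  move=> p0 Gt; have [lo0 /andP[log _]] := glh p t p0 Gt.
  have g0 : 0 < g p t by exact: lt_le_trans log.
  rewrite /f -ln_div ?posrE ?addr_gt0 ?mulr_gt0//; congr ln.
  by field; rewrite gt_eqF.
pose D t := `|ln (lo t)| + `|ln (hi t)| + ln 2.
have iD : P.-integrable G (fun t => (D t)%:E).
  have -> : (fun t => (D t)%:E) = (fun t => (`|(ln (lo t))%:E| + `|(ln (hi t))%:E| + (ln 2)%:E)%E) by [].
  apply: integrableD => //; first by apply: integrableD => //; exact: integrable_abse.
  exact: finite_measure_integrable_cst.
have fD p t : 1 <= p -> G t -> `|f p t| <= D t.
  move=> p1 Gt; have p0 : 0 < p by exact: lt_le_trans p1.
  have [lo0 /andP[log ghi]] := glh p t p0 Gt.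
  rewrite fE//; apply: ln_shift_bound => //.
  have ip : 0 <= p^-1 by rewrite invr_ge0 ltW.
  have ip1 : p^-1 <= 1 by rewrite invf_le1.
  by apply/andP; split; lra.
have iF p : 1 <= p -> P.-integrable G (fun t => (f p t)%:E).
  move=> p1; have p0 : 0 < p by exact: lt_le_trans p1.
  apply: (le_integrable mG _ _ iD).
    by apply/measurable_EFinP; apply: measurable_funTS; exact: mf.
  move=> t Gt; rewrite lee_fin [leRHS]ger0_norm; first exact: fD.
  exact: le_trans (fD p t p1 Gt).
pose h t := ln (ginf t).
have ginf_lh t : G t -> 0 < lo t /\ lo t <= ginf t <= hi t.
  move=> Gt; have [p0 Hp0] := ginfE t Gt; pose q := Num.max 1 (p0 + 1).
  have <- : g q t = ginf t by apply: Hp0; rewrite /q lt_max ltrDl ltr01 orbT.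
  by apply: glh => //; rewrite /q lt_max ltr01.
have cvgf (u : R^nat) : (forall n, 1 <= u n) -> u n @[n --> \oo] --> +oo ->
    forall t, G t -> (f (u n) t)%:E @[n --> \oo] --> (h t)%:E.
  move=> u1 uoo t Gt; apply: cvg_EFin; first exact: nearW.
  have [lo0 /andP[log _]] := ginf_lh t Gt.
  have -> : (fine \o fun n => (f (u n) t)%:E) = (fun n => ln ((u n)^-1 + g (u n) t)).
    by apply/funext => n; rewrite /= fE// (lt_le_trans _ (u1 n)).
  have [p0 Hp0] := ginfE t Gt.
  apply: (@cvg_trans _ (ln ((u n)^-1 + ginf t) @[n --> \oo])).
    apply: near_eq_cvg; near=> n; rewrite Hp0//; near: n.
    by move/cvgryPgt : uoo; apply.
  have c0 : (u n)^-1 + ginf t @[n --> \oo] --> ginf t.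
    rewrite -[X in _ --> X]add0r; apply: cvgD; last exact: cvg_cst.
    by apply/gtr0_cvgV0 => //; apply: nearW => n; rewrite (lt_le_trans _ (u1 n)).
  apply: (cvg_comp _ _ c0); apply: continuous_ln; exact: lt_le_trans log.
pose F p := fine (\int[P]_(t in G) (f p t)%:E).
have FE p : 1 <= p -> (\int[P]_(t in G) (f p t)%:E = (F p)%:E)%E.
  by move=> p1; rewrite fineK//; exact: integrable_fin_num (iF p p1).
have mfn (u : R^nat) : (forall n, 1 <= u n) -> forall n, measurable_fun G (EFin \o f (u n)).
  move=> u1 n; apply/measurable_EFinP; apply: measurable_funTS; apply: mf.
  exact: lt_le_trans (u1 n).
have fDn (u : R^nat) : (forall n, 1 <= u n) -> forall n t, G t -> (`|(f (u n) t)%:E| <= (D t)%:E)%E.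
  by move=> u1 n t Gt; rewrite lee_fin; exact: fD.
have n1 (n : nat) : 1 <= n.+1%:R :> R by rewrite ler1n.
have noo : (n.+1%:R : R) @[n --> \oo] --> +oo.
  by apply/cvgryPge => A; near=> n; rewrite (le_trans (ltW (truncnS_gt A)))// ler_nat ltnS; near: n; exact: nbhs_infty_ge.
(* [ginf] comes from the axiom of choice; its logarithm is measurable as a pointwise limit along the
   integers. *)
have ih : P.-integrable G (EFin \o h).
  apply: (le_integrable mG _ _ iD).
    apply: (emeasurable_fun_cvg (fun n => EFin \o f n.+1%:R)); [exact: (mfn _ n1)|exact: (cvgf _ n1 noo)].
  move=> t Gt; have [lo0 /andP[log ghi]] := ginf_lh t Gt.
  have D0 : 0 <= D t by rewrite !addr_ge0// ltW.
  rewrite lee_fin [leRHS]ger0_norm//.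
  by apply: ln_shift_bound => //; apply/andP; split=> //; lra.
pose H := fine (\int[P]_(t in G) (h t)%:E).
have HE : (\int[P]_(t in G) (h t)%:E = H%:E)%E.
  by rewrite fineK//; exact: integrable_fin_num ih.
have Fcvg : F p @[p --> +oo] --> H.
  (* Dominated convergence is applied along sequences. The bounds are stated for [p >= 1], hence the
     clamped sequence [v]. *)
  apply/cvg_pinftyP => u uoo; pose v n := Num.max 1 (u n).
  have v1 n : 1 <= v n by rewrite le_max lexx.
  have uv : \forall n \near \oo, v n = u n.
    near=> n; apply/max_idPr; apply: ltW; near: n.
    by move/cvgryPgt : uoo; apply.
  have voo : v n @[n --> \oo] --> +oo.
    apply: cvg_trans uoo; apply: near_eq_cvg; near=> n; apply/esym; near: n; exact: uv.
  apply: (@cvg_trans _ (F (v n) @[n --> \oo])).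
    by apply: near_eq_cvg; near=> n; congr F; near: n; exact: uv.
  have := @dominated_cvg _ T R P G mG (fun n => EFin \o f (v n)) (EFin \o h) (EFin \o D)
    (mfn v v1) (cvgf v v1 voo) (fun _ _ => erefl) iD (fDn v v1).
  rewrite /= HE => /fine_cvg.
  by [].
exists (- (H / ln 2)); split; last first.
  rewrite !lerN2 !ler_pM2r ?invr_gt0// -!lee_fin -El1 -El2 -HE; apply/andP; split.
    apply: le_integral => // t /set_mem Gt; have [lo0 /andP[log ghi]] := ginf_lh t Gt.
    have g0 := lt_le_trans lo0 log.
    by rewrite lee_fin ler_ln ?posrE// (lt_le_trans g0 ghi).
  apply: le_integral => // t /set_mem Gt; have [lo0 /andP[log ghi]] := ginf_lh t Gt.
  by rewrite lee_fin ler_ln ?posrE// (lt_le_trans lo0 log).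
have rateE p : 1 <= p -> ('E_P[fun t => (K * log2 (1 + p * g p t))%R] =
    (K / ln 2 * F p + K * log2 p)%:E)%E.
  move=> p1; have p0 : 0 < p by exact: lt_le_trans p1.
  rewrite unlock (@integral_full_set G)//; last first.
    apply/measurable_EFinP; apply: measurable_funM => //; apply: measurable_funM => //.
    apply: measurableT_comp; first exact: measurable_ln.
    by apply: measurable_funD => //; apply: measurable_funM => //; exact: mg.
  transitivity (\int[P]_(t in G) ((K / ln 2)%:E * (f p t)%:E + (K * log2 p)%:E))%E.
    by apply: eq_integral => t _; rewrite -EFinM -EFinD /f /log2; congr EFin; field; rewrite gt_eqF.
  rewrite integralD//; last 2 first.
  - by apply: integrableZl => //; exact: iF.
  - exact: finite_measure_integrable_cst.
  rewrite integralZl//; last exact: iF.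
  have -> : (\int[P]_(_ in G) (K * log2 p)%:E = (K * log2 p)%:E)%E.
    by rewrite -[RHS]mule1 -PG; exact: integral_cst.
  by rewrite FE.
rewrite /high_snr_expansion.
apply: (@cvg_trans _ ((K / ln 2 * (F p - H))%:E @[p --> +oo])).
  apply: near_eq_cvg; near=> p; rewrite rateE; last by near: p; exact: nbhs_pinfty_ge.
  by rewrite -EFinB; congr EFin; rewrite /log2; field; rewrite gt_eqF.
apply: cvg_EFin; first exact: nearW.
rewrite -(mulr0 (K / ln 2)); apply: cvgMr; rewrite -(subrr H).
by apply: cvgB => //; exact: cvg_cst.
Unshelve. all: by end_near. Qed.

(** After division by [ln p] the constants contribute [ln C1 / ln p] and [ln C2 / ln p], which
    vanish in the limit. *)
Lemma diversity_order_bounds (pr : R -> \bar R) (D : nat) (C1 C2 : R) : 0 < C1 -> 0 < C2 ->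
  (exists p0, forall p, p0 < p -> C1 * p ^- D <= fine (pr p) <= C2 * p ^- D) ->
  diversity_order pr D%:R.
Proof.
move=> C10 C20 [p0 Hp].
have lnoo : ln p @[p --> (+oo : set_system R)] --> (+oo : set_system R).
  apply/cvgryPgt => A; near=> p.
  have : expR A < p by near: p; exact: nbhs_pinfty_gt.
  by move=> Ap; rewrite -ltr_expR lnK// posrE (lt_trans (expR_gt0 A)).
have lim C : D%:R - ln C * (ln p)^-1 @[p --> +oo] --> (D%:R : R).
  rewrite -[X in _ --> X]subr0; apply: cvgB; first exact: cvg_cst.
  rewrite -(mulr0 (ln C)); apply: cvgMr; apply/gtr0_cvgV0.
    by near=> p; rewrite ln_gt0//; near: p; exact: nbhs_pinfty_gt.
  exact: lnoo.
apply: (@squeeze_cvgr _ _ _ _ (fun p => D%:R - ln C2 * (ln p)^-1)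
  (fun p => D%:R - ln C1 * (ln p)^-1)) => //.
near=> p; have p1 : 1 < p by near: p; exact: nbhs_pinfty_gt.
have /Hp/andP[h1 h2] : p0 < p.
  by near: p; apply: nbhs_pinfty_gt; exact: num_real.
have pp : 0 < p by exact: lt_trans p1.
have lp : 0 < ln p by rewrite ln_gt0.
have pD : 0 < p ^- D by rewrite invr_gt0 exprn_gt0.
have f0 : 0 < fine (pr p) by apply: lt_le_trans h1; exact: mulr_gt0.
have lE C : 0 < C -> ln (C * p ^- D) = ln C - D%:R * ln p.
  by move=> C0; rewrite lnM ?posrE// lnV ?posrE ?exprn_gt0// lnXn// mulr_natl.
have : ln (C1 * p ^- D) <= ln (fine (pr p)) by rewrite ler_ln ?posrE ?mulr_gt0.
have : ln (fine (pr p)) <= ln (C2 * p ^- D) by rewrite ler_ln ?posrE ?mulr_gt0.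
rewrite !lE// => k2 k1.
have e C : D%:R - ln C * (ln p)^-1 = - ((ln C - D%:R * ln p) / ln p).
  by field; rewrite gt_eqF.
by rewrite !e !lerN2 !ler_pM2r ?invr_gt0// k1 k2.
Unshelve. all: by end_near. Qed.

End high_snr.

(** * Variables with a Gamma law: small values and mean logarithm *)

Section gamma_variable.
Context (R : realType) d (T : measurableType d) (P : probability T R).
Local Notation mR := (measurableTypeR R).
Local Notation lambda := (@lebesgue_measure R).
Variables (k : nat) (U : T -> mR).
Hypothesis mU : measurable_fun setT U.
Hypothesis lawU : forall B : set mR, measurable B ->
  P (U @^-1` B) = (\int[lambda]_(t in B) (gamma_pdf k t)%:E)%E.

(** The density is at most [e ^+ k] on [[0, e[] and zero on the negative half-line. *)
Lemma gamma_variable_le (e : R) : 0 < e -> (P (U @^-1` `]-oo, e[) <= (e ^+ k.+1)%:E)%E.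
Proof.
move=> e0; rewrite lawU; last exact: measurable_itv.
have f1 : 1 <= k`!%:R :> R by rewrite ler1n fact_gt0.
rewrite integral_mkcond.
apply: (@le_trans _ (\bar R) (\int[lambda]_(t in `[0%R, e[) (cst (e ^+ k)%:E t))%E); last first.
  rewrite integral_cst; last exact: measurable_itv.
  by rewrite /= lebesgue_measure_itv /= lte_fin e0 -EFinD subr0 -EFinM -exprSr.
rewrite [leRHS]integral_mkcond; apply: ge0_le_integral => //.
- by move=> t _; rewrite patchE; case: ifP => // _; rewrite lee_fin gamma_pdf_ge0.
- apply/(measurable_restrictT _ _).1; first exact: measurable_itv.
  by apply: measurable_funTS; apply/measurable_EFinP; exact: measurable_gamma_pdf.
- by apply/(measurable_restrictT _ _).1; first exact: measurable_itv.
- move=> t _; rewrite !patchE !mem_setE !in_itv /=.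
  have [te|//] := ltP t e; last by rewrite andbF.
  rewrite andbT; have [t0|t0] := leP 0 t; last by rewrite gamma_pdf_neg.
  rewrite lee_fin /gamma_pdf indicE mem_setE in_itv /= andbT t0 mul1r.
  rewrite ler_pdivrMr ?(lt_le_trans ltr01)//.
  have et : expR (- t) <= 1 by rewrite -expR0 ler_expR oppr_le0.
  apply: (@le_trans _ _ (e ^+ k * 1)); last by rewrite ler_wpM2l ?exprn_ge0 ?(ltW e0).
  by apply: ler_pM => //; [exact: exprn_ge0|rewrite lerXn2r ?nnegrE ?(ltW e0) ?(ltW te)].
Qed.

(** Only [[e / 2, e[] is kept, where [t ^+ k] is at least [(e / 2) ^+ k] and [expR (- t)] at least
    [expR (- 1)]. *)
Lemma gamma_variable_ge (e : R) : 0 < e <= 1 ->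
  (((e / 2) ^+ k.+1 * (expR (- 1) / k`!%:R))%:E <= P (U @^-1` `]-oo, e[))%E.
Proof.
move=> /andP[e0 e1]; rewrite lawU; last exact: measurable_itv.
have f0 : 0 < k`!%:R :> R by rewrite ltr0n fact_gt0.
have e2 : e / 2 < e by lra.
have e20 : 0 < e / 2 by lra.
pose a : R := e / 2.
apply: (@le_trans _ (\bar R) (\int[lambda]_(t in `[a, e[) (cst (a ^+ k * (expR (- 1) / k`!%:R))%:E t))%E).
  rewrite integral_cst; last exact: measurable_itv.
  rewrite /= lebesgue_measure_itv /= lte_fin e2 -EFinD -EFinM lee_fin.
  by rewrite /a (_ : e - e / 2 = e / 2); [rewrite exprSr mulrAC|lra].
apply: (@le_trans _ (\bar R) (\int[lambda]_(t in `[a, e[) (gamma_pdf k t)%:E)%E).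
  apply: ge0_le_integral => //.
  - by move=> t _; rewrite lee_fin mulr_ge0// ?exprn_ge0 ?divr_ge0 ?expR_ge0 ?(ltW e0)// ltW.
  - by apply: measurable_funTS; apply/measurable_EFinP; exact: measurable_gamma_pdf.
  - move=> t /=; rewrite in_itv /= => /andP[t1 t2].
    have t0 : 0 < t by exact: lt_le_trans t1.
    rewrite lee_fin gamma_pdf_pos// -mulrA; apply: ler_pM.
    + by rewrite exprn_ge0// ltW.
    + by rewrite divr_ge0 ?expR_ge0// ltW.
    + by rewrite lerXn2r ?nnegrE ?(ltW e20) ?(ltW t0).
    + by rewrite ler_wpM2r ?invr_ge0 ?(ltW f0)// ler_expR lerN2 (le_trans (ltW t2)).
apply: ge0_subset_integral => //.
- by apply: measurable_funTS; apply/measurable_EFinP; exact: measurable_gamma_pdf.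
- by move=> t _; rewrite lee_fin gamma_pdf_ge0.
- by move=> t /=; rewrite !in_itv /= => /andP[].
Qed.

Lemma gamma_variable_gt0 : P [set t | U t <= 0] = 0%E.
Proof.
have mN : measurable [set t | U t <= 0].
  rewrite (_ : [set t | U t <= 0] = U @^-1` `]-oo, 0]); first by rewrite -[_ @^-1` _]setTI; apply: mU => //; exact: measurable_itv.
  by apply/seteqP; split => t /=; rewrite in_itv.
apply/eqP; rewrite eq_le measure_ge0 andbT; apply/lee_addgt0Pr => e e0.
rewrite add0e; pose x := Num.min 1 e; have x0 : 0 < x by rewrite lt_min ltr01.
apply: (@le_trans _ (\bar R) (P (U @^-1` `]-oo, x[))).
  apply: le_measure; rewrite ?inE//.
    by rewrite -[_ @^-1` _]setTI; apply: mU => //; exact: measurable_itv.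
  by move=> t /= t0; rewrite in_itv /= (le_lt_trans t0).
apply: (le_trans (gamma_variable_le x0)); rewrite lee_fin exprS.
apply: (@le_trans _ _ (x * 1)); last by rewrite mulr1 /x ge_min lexx orbT.
by rewrite ler_wpM2l ?(ltW x0)// exprn_ile1 ?(ltW x0)// /x ge_min lexx.
Qed.

Let mln : measurable_fun [set: mR] (fun t : mR => ln t : mR).
Proof. exact: measurable_ln. Qed.

Lemma gamma_variable_ln_integrable : P.-integrable setT (fun t => (ln (U t))%:E).
Proof.
apply/integrableP; split.
  by apply/measurable_EFinP; exact: measurableT_comp.
have := @ge0_integral_pushforward _ _ T mR R U mU P setT (fun t => `|(ln t)%:E|%E).
rewrite preimage_setT => <- //; last first.
  by apply: measurableT_comp => //; exact/measurable_EFinP.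
have := (@integrable_density _ mR R lambda (pushforward P U) _
  (@gamma_pdf_ge0 R k) (@measurable_gamma_pdf R k) lawU _ mln).2 (integrable_ln_gamma_pdf R k).
by move=> /(_ mU)/integrableP[].
Qed.

Lemma gamma_variable_ln_integral : (\int[P]_t (ln (U t))%:E = (digamma k.+1%:R)%:E)%E.
Proof.
have := @integral_pushforward _ _ T mR R U mU P setT (fun t => (ln t)%:E).
rewrite preimage_setT => <- //.
- have := @integral_density _ mR R lambda (pushforward P U) _
    (@gamma_pdf_ge0 R k) (@measurable_gamma_pdf R k) lawU _ mln.
  by move=> /(_ mU) ->; rewrite (digamma_nat R k).
- exact/measurable_EFinP.
- exact: gamma_variable_ln_integrable.
Qed.

(** Near zero the distribution function of [U] is of order [e ^+ k.+1], so both bracketing events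
    have probability of order [p ^- k.+1]. *)
Lemma gamma_variable_diversity (c : R) (E : R -> set T) : 0 < c ->
  (forall p, 0 < p -> measurable (E p)) ->
  (exists p0, forall p, p0 < p -> U @^-1` `]-oo, c / p[ `<=` E p /\
    E p `<=` U @^-1` `]-oo, 2 * c / p[) ->
  diversity_order (fun p => P (E p)) k.+1%:R.
Proof.
move=> c0 mE [p0 Hp].
have f0 : 0 < k`!%:R :> R by rewrite ltr0n fact_gt0.
apply: (@diversity_order_bounds R (fun p => P (E p)) k.+1
  ((c / 2) ^+ k.+1 * (expR (- 1) / k`!%:R)) ((2 * c) ^+ k.+1)).
- by rewrite mulr_gt0 ?exprn_gt0 ?divr_gt0 ?expR_gt0.
- by rewrite exprn_gt0 ?mulr_gt0.
(* [c < p] brings [c / p] into the range of [gamma_variable_ge]. *)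
exists (Num.max p0 c) => p; rewrite gt_max => /andP[/Hp[s1 s2] cp].
have pp : 0 < p by exact: lt_trans cp.
have mp (x : R) : measurable (U @^-1` `]-oo, x[).
  by rewrite -[_ @^-1` _]setTI; apply: mU => //; exact: measurable_itv.
have fin : P (E p) \is a fin_num by apply: fin_num_measure; exact: mE.
rewrite -!lee_fin fineK//; apply/andP; split.
  have -> : (c / 2) ^+ k.+1 * (expR (- 1) / k`!%:R) * p ^- k.+1 =
      (c / p / 2) ^+ k.+1 * (expR (- 1) / k`!%:R).
    by rewrite mulrAC -exprVn -exprMn; congr (_ ^+ _ * _); ring.
  apply: (le_trans (gamma_variable_ge _)).
    by rewrite divr_gt0//= ler_pdivrMr// mul1r ltW.
  by apply: le_measure => //; rewrite inE; [exact: mp|exact: mE].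
rewrite -exprVn -exprMn; apply: le_trans (gamma_variable_le _).
  by apply: le_measure => //; rewrite inE; [exact: mE|exact: mp].
by rewrite !mulr_gt0 ?invr_gt0.
Qed.

End gamma_variable.

(** * The optimal beam over a Gaussian channel *)

Section optimal_beam_over_gaussian_channel.
Context (R : realType) d (T : measurableType d) (P : probability T R).
Local Notation mR := (measurableTypeR R).
Variables (m N L : nat) (alphac alphas alpha : R).
Variables (hs : 'cV[R[i]]_m.+1) (hc : T -> 'cV[R[i]]_m.+1).
Variable (w : R -> 'cV[R[i]]_m.+1 -> 'cV[R[i]]_m.+1).
Hypotheses (N_gt0 : (0 < N)%N) (L_gt0 : (0 < L)%N).
Hypotheses (alphac_gt0 : 0 < alphac) (alphas_gt0 : 0 < alphas).
Hypotheses (alpha01 : 0 <= alpha <= 1) (hs_neq0 : hs != 0).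
Hypothesis hc_gaussian : complex_gaussian P alphac hc.
Hypothesis w_optimal : forall (p : R) (h : 'cV[R[i]]_m.+1), 0 < p ->
  optimal_beamformer N L alphas alpha p hs h (w p h).

Let A := L%:R * alpha * ln 2.
Let B := (1 - alpha) * ln 2.
Let a := N%:R * L%:R * alphas.
Let u := threshold A a.
Let z := threshold B 1.
Let S := sqnorm hs.
Let UX t := sqnorm (hc t) / alphac.
Let UY t := gain hs (hc t) / S / alphac.
Let gs p t := gain (w p (hc t)) hs.
Let gc p t := gain (w p (hc t)) (hc t).

Let ln2_gt0 : 0 < ln 2 :> R. Proof. by rewrite ln_gt0// ltr1n. Qed.
Let a_gt0 : 0 < a. Proof. by rewrite !mulr_gt0 ?ltr0n. Qed.
Let A_ge0 : 0 <= A.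
Proof. by case/andP: alpha01 => a0 _; rewrite !mulr_ge0// ltW. Qed.
Let B_ge0 : 0 <= B.
Proof. by case/andP: alpha01 => _ a1; rewrite mulr_ge0 ?subr_ge0// ltW. Qed.
Let S_gt0 : 0 < S. Proof. by rewrite sqnorm_gt0. Qed.

Let optimal_rate : exists r : R -> 'cV[R[i]]_m.+1 -> R,
  forall p h, 0 < p -> beam_optimal (u p) (z p) hs h (w p h) (r p h).
Proof.
have H (ph : R * 'cV[R[i]]_m.+1) :
    exists x, 0 < ph.1 -> beam_optimal (u ph.1) (z ph.1) hs ph.2 (w ph.1 ph.2) x.
  (* The rate [0] is a dummy for the powers at which no optimality is assumed. *)
  case: ph => p h /=; have [p0|] := ltP 0 p; last by exists 0.
  by have [x Hx] := optimal_beamformerE N_gt0 L_gt0 alphas_gt0 p0 (w_optimal h p0); exists x.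
have [f Hf] := choice H; exists (fun p h => f (p, h)) => p h; exact: (Hf (p, h)).
Qed.

Let r := sval (cid optimal_rate).
Let rP : forall p h, 0 < p -> beam_optimal (u p) (z p) hs h (w p h) (r p h).
Proof. exact: svalP (cid optimal_rate). Qed.

Let cu p x : {for x, continuous (u p)}. Proof. exact: threshold_continuous. Qed.
Let cz p x : {for x, continuous (z p)}. Proof. exact: threshold_continuous. Qed.

Let mgain v : measurable_fun setT (fun t => gain v (hc t) : mR).
Proof. exact: (measurable_gain hc_gaussian). Qed.

Let mUX : measurable_fun setT (UX : T -> mR).
Proof. by apply: measurable_funM => //; exact: (measurable_sqnorm hc_gaussian). Qed.

Let mUY : measurable_fun setT (UY : T -> mR).
Proof. by apply: measurable_funM => //; apply: measurable_funM => //; exact: mgain. Qed.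

Let lawX (C : set mR) : measurable C ->
  P (UX @^-1` C) = (\int[lebesgue_measure]_(t in C) (gamma_pdf m t)%:E)%E.
Proof. exact: (sqnorm_law alphac_gt0 hc_gaussian). Qed.

Let lawY (C : set mR) : measurable C ->
  P (UY @^-1` C) = (\int[lebesgue_measure]_(t in C) (gamma_pdf 0 t)%:E)%E.
Proof. exact: (gain_law alphac_gt0 hc_gaussian). Qed.

(** The half-lines above [c] generate the Borel sets, and [beam_optimal_gt] writes each preimage as
    a countable union of conditions on gains of fixed beams. *)
Let measurable_rate p : 0 < p -> measurable_fun setT (fun t => r p (hc t) : mR).
Proof.
move=> p0 _; apply: (measurability _ (RGenOInfty.measurableE R)).
move=> _ [_ [c ->] <-]; rewrite setTI.
rewrite (_ : _ @^-1` _ = \bigcup_(q : rat) \bigcup_(f : {ffun 'I_m.+1 -> rat * rat})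
  [set t | [/\ c < ratr q, rat_vector R f != 0,
    u p (ratr q) * sqnorm (rat_vector R f) <= gain (rat_vector R f) hs &
    z p (ratr q) * sqnorm (rat_vector R f) <= gain (rat_vector R f) (hc t)]]).
  apply: bigcupT_measurable_rat => q; apply: countable_bigcupT_measurable => // f.
  (* The conditions free of [t] either hold or make the event empty. *)
  have [Q|nQ] := pselect ([/\ c < ratr q, rat_vector R f != 0 &
      u p (ratr q) * sqnorm (rat_vector R f) <= gain (rat_vector R f) hs]).
    rewrite (_ : mkset _ = (fun t => gain (rat_vector R f) (hc t)) @^-1`
        `[z p (ratr q) * sqnorm (rat_vector R f), +oo[).
      by rewrite -[_ @^-1` _]setTI; apply: mgain => //; exact: measurable_itv.
    apply/seteqP; split => t /=; rewrite in_itv /= andbT; first by case.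
    by case: Q.
  rewrite (_ : mkset _ = set0)//; apply/seteqP; split => t //= -[q1 q2 q3 _].
  by apply: nQ.
have key t : c < r p (hc t) <-> _ := beam_optimal_gt c
  (fun _ _ => threshold_strict A_ge0 a_gt0 p0) (fun _ _ => threshold_strict B_ge0 ltr01 p0) (rP (hc t) p0).
apply/seteqP; split => t /=.
  by rewrite in_itv /= andbT => /key[q [f H]]; exists q => //; exists f.
by move=> [q _ [f _ H]]; rewrite in_itv /= andbT; apply/key; exists q, f.
exact: measurableT.
Qed.

Let measurable_threshold p C c : 0 < p ->
  measurable_fun setT (fun t => threshold C c p (r p (hc t)) : mR).
Proof.
move=> p0; apply: (measurableT_comp (f := threshold C c p : mR -> mR)).
  by apply: continuous_measurable_fun => x; exact: threshold_continuous.
exact: measurable_rate.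
Qed.

Let gcE p t : 0 < p -> gc p t = Num.max (z p (r p (hc t))) (gain hs (hc t) / S).
Proof.
move=> p0; have H := beam_optimal_gain (@cz p _) (@cu p _) hs_neq0 (beam_optimalC (rP (hc t) p0)).
exact H.
Qed.

Let gsE p t : 0 < p -> hc t != 0 ->
  gs p t = Num.max (u p (r p (hc t))) (gain (hc t) hs / sqnorm (hc t)).
Proof. move=> p0 h0; have H := beam_optimal_gain (@cu p _) (@cz p _) h0 (rP (hc t) p0).
exact H. Qed.

Let measurable_gc p : 0 < p -> measurable_fun setT (gc p : T -> mR).
Proof.
move=> p0; rewrite (_ : gc p = (fun t => z p (r p (hc t))) \max (fun t => gain hs (hc t) / S)).
  apply: measurable_maxr; first exact: measurable_threshold.
  by apply: measurable_funM => //; exact: mgain.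
by apply/funext => t /=; exact: gcE.
Qed.

(** [gsE] covers the nonzero channels. Where the channel vanishes the beam is the single vector
    [w p 0], so a constant times the indicator of that event corrects the formula. *)
Let measurable_gs p : 0 < p -> measurable_fun setT (gs p : T -> mR).
Proof.
move=> p0; pose Z : set T := [set t | hc t = 0].
have mX := measurable_sqnorm hc_gaussian.
have mZ : measurable Z.
  rewrite (_ : Z = (fun t => sqnorm (hc t)) @^-1` [set 0]).
    by rewrite -[_ @^-1` _]setTI; apply: mX => //; exact: measurable_set1.
  apply/seteqP; split => t /=; first by move=> ->; apply/eqP; rewrite sqnorm_eq0.
  by move/eqP; rewrite sqnorm_eq0 => /eqP.
pose c := gain (w p 0) hs - Num.max (u p (r p 0)) 0.
(* [expR (- ln x)] stands for the inverse of [x]; at [x = 0] it multiplies a zero gain. *)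
rewrite (_ : gs p = ((fun t => u p (r p (hc t))) \max
  (fun t => gain hs (hc t) * expR (- ln (sqnorm (hc t))))) \+ (fun t => c * \1_Z t)).
  apply: measurable_funD; last by apply: measurable_funM => //; exact: measurable_indic.
  apply: measurable_maxr; first exact: measurable_threshold.
  apply: measurable_funM; first exact: mgain.
  apply: measurableT_comp => //; apply: measurableT_comp => //.
  by apply: measurableT_comp; [exact: measurable_ln|exact: mX].
apply/funext => t /=; rewrite indicE; have [h0|h0] := eqVneq (hc t) 0.
  have g0 : gain hs (hc t) = 0.
    apply/eqP; rewrite eq_le gain_ge0 andbT (le_trans (gain_le _ _))//.
    by rewrite mulr_ge0_le0 ?sqnorm_ge0// h0 le_eqVlt sqnorm_eq0 eqxx.
  by rewrite g0 mul0r mem_set// mulr1 /gs h0 addrC /c subrK.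
rewrite memNset; last by move/eqP; exact/negP.
rewrite mulr0 addr0 gsE// expRN lnK ?posrE ?sqnorm_gt0//.
by rewrite [gain hs _]gainC.
Qed.

(** The event on which both matched beams have positive gain towards the other channel, so that all
    the logarithms are genuine. *)
Let G : set T := [set t | 0 < gain hs (hc t)].

Let measurable_G : measurable G.
Proof.
rewrite (_ : G = (fun t => gain hs (hc t)) @^-1` `]0, +oo[).
  by rewrite -[_ @^-1` _]setTI; apply: mgain => //; exact: measurable_itv.
by apply/seteqP; split => t /=; rewrite in_itv /= andbT.
Qed.

Let G_full : P (~` G) = 0%E.
Proof.
rewrite -(gamma_variable_gt0 mUY lawY); congr (P _).
apply/seteqP; split => t /=; rewrite /G /UY /=.
  by move/negP; rewrite -leNgt => g0; rewrite -mulrA mulr_le0_ge0// mulr_ge0// invr_ge0 ltW.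
by move=> g0 g1; move: g0; rewrite leNgt !divr_gt0.
Qed.

Let G_neq0 t : G t -> hc t != 0.
Proof.
rewrite /G /= => g0; apply/eqP => h0; move: g0; rewrite ltNge => /negP; apply.
by rewrite (le_trans (gain_le _ _))// mulr_ge0_le0 ?sqnorm_ge0// h0 le_eqVlt sqnorm_eq0 eqxx.
Qed.

Let gain_limits t : G t -> exists x y p0, forall p, p0 < p -> gs p t = x /\ gc p t = y.
Proof.
move=> Gt; have h0 := G_neq0 Gt.
have [AB|BA|E] := ltgtP A B.
- have AB' : 0 <= A < B by rewrite A_ge0.
  have g0 : 0 < gain (hc t) hs by rewrite gainC.
  have [p0 H] := beam_dominant AB' a_gt0 (@ltr01 R) h0 g0.
  exists (gain (hc t) hs / sqnorm (hc t)), (sqnorm (hc t)), (Num.max 0 p0) => p.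
  by rewrite gt_max => /andP[pp p0p]; exact: (H _ _ _ p0p (rP (hc t) pp)).
- have BA' : 0 <= B < A by rewrite B_ge0.
  have [p0 H] := beam_dominant BA' (@ltr01 R) a_gt0 hs_neq0 Gt.
  exists S, (gain hs (hc t) / S), (Num.max 0 p0) => p.
  rewrite gt_max => /andP[pp p0p].
  by have [] := H _ _ _ p0p (beam_optimalC (rP (hc t) pp)).
(* Equal exponents are positive: [A = 0] forces [alpha = 0], whereas [B = 0] forces [alpha = 1]. *)
- have A0 : 0 < A.
    rewrite lt_neqAle A_ge0 andbT eq_sym; apply/eqP => A0.
    move: E; rewrite A0 /B => /esym/eqP; rewrite mulf_eq0 (gt_eqF ln2_gt0) orbF subr_eq0 => /eqP a1.
    move: A0; rewrite /A -a1 mulr1 => /eqP; rewrite mulf_eq0 (gt_eqF ln2_gt0) orbF pnatr_eq0.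
    by rewrite gtn_eqF.
  (* Any two positive powers give the same gains, so the power [1] serves as reference. *)
  exists (gs 1 t), (gc 1 t), 0 => p pp.
  have o1 := rP (hc t) pp; have o2 := rP (hc t) (@ltr01 R).
  rewrite /u /z -E in o1 o2.
  exact: (beam_balanced A0 a_gt0 (@ltr01 R) hs_neq0 h0 pp (@ltr01 R) o1 o2).
Qed.

Let ln_integrals (U : T -> R) k : measurable_fun setT (U : T -> mR) ->
  (forall C : set mR, measurable C ->
    P (U @^-1` C) = (\int[lebesgue_measure]_(t in C) (gamma_pdf k t)%:E)%E) ->
  P.-integrable G (fun t => (ln (U t))%:E) /\
  (\int[P]_(t in G) (ln (U t))%:E = (digamma k.+1%:R)%:E)%E.
Proof.
move=> mU lU; have i := gamma_variable_ln_integrable mU lU; split.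
  exact: (integrableS measurableT measurable_G (@subsetT _ _) i).
rewrite -(gamma_variable_ln_integral mU lU) (@integral_full_set _ _ _ P G)//.
by have /integrableP[] := i.
Qed.

Let integral_affine (f : T -> R) (c l : R) : P.-integrable G (EFin \o f) ->
  (\int[P]_(t in G) (f t)%:E = l%:E)%E ->
  P.-integrable G (fun t => (c + f t)%:E) /\
  (\int[P]_(t in G) (c + f t)%:E = (c + l)%:E)%E.
Proof.
move=> i e.
have ic : P.-integrable G (cst c%:E) by exact: finite_measure_integrable_cst.
split; first exact: (integrableD measurable_G ic i).
have PG : P G = 1%E.
  by have := probability_setC P measurable_G; rewrite G_full => /esym/eqP; rewrite sube_eq// add0e => /eqP ->.
transitivity (\int[P]_(t in G) (c%:E + (f t)%:E))%E; first by [].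
rewrite integralD// e.
have -> : (\int[P]_(t in G) c%:E = c%:E)%E.
  by rewrite -[RHS]mule1 -PG; exact: integral_cst.
by [].
Qed.

Let UX_gt0 t : G t -> 0 < UX t.
Proof. by move=> /G_neq0 h0; rewrite divr_gt0// sqnorm_gt0. Qed.

Let UY_gt0 t : G t -> 0 < UY t.
Proof. by move=> Gt; rewrite !divr_gt0. Qed.

Let sqnormUX t : sqnorm (hc t) = alphac * UX t.
Proof. by rewrite /UX mulrC divfK// gt_eqF. Qed.

Let gainUY t : gain hs (hc t) / S = alphac * UY t.
Proof. by rewrite /UY [alphac * _]mulrC divfK// gt_eqF. Qed.

(** The gain towards [hs] lies between that of the beam matched to [hc], which is [S * (UY / UX)],
    and [S]. The mean logarithm of the ratio is [digamma 1 - digamma m.+1], which [digamma_sum]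
    turns into the harmonic sum. *)
Lemma sens_rate_expansion : exists Ls,
  high_snr_expansion
    (fun p => 'E_P[fun t => sens_rate N L alphas p hs (w p (hc t))])%E L%:R^-1 Ls /\
  - log2 (L%:R * N%:R * alphas * sqnorm hs) <= Ls <=
    - log2 (L%:R * N%:R * alphas * sqnorm hs) + \sum_(1 <= i < m.+1) (i%:R * ln 2)^-1.
Proof.
have [x xE] : {x : R | x = digamma m.+1%:R} := exist _ _ erefl.
have [y yE] : {y : R | y = digamma 1} := exist _ _ erefl.
have [iX eX] := ln_integrals mUX lawX; have [iY eY] := ln_integrals mUY lawY.
rewrite -xE in eX; rewrite -[0.+1%:R]/(1 : R) -yE in eY.
have aS0 : 0 < a * S by exact: mulr_gt0.
have i1 : P.-integrable G (EFin \o (fun t => ln (UY t) - ln (UX t))).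
  exact: (integrableB measurable_G iY iX).
have e1 : (\int[P]_(t in G) (ln (UY t) - ln (UX t))%:E =
    (y - x)%:E)%E.
  by rewrite EFinB -eX -eY -integralB.
have [i2 e2] := integral_affine (ln (a * S)) i1 e1.
have i0 : P.-integrable G (EFin \o (fun=> 0 : R)) by exact: finite_measure_integrable_cst.
have e0 : (\int[P]_(t in G) ((fun=> 0 : R) t)%:E = 0%:E)%E by rewrite integral0.
have [i3 e3] := integral_affine (ln (a * S)) i0 e0.
pose lo t := a * S * (UY t / UX t).
have loE t : G t -> ln (lo t) = ln (a * S) + (ln (UY t) - ln (UX t)).
  move=> Gt; have x0 := UX_gt0 Gt; have y0 := UY_gt0 Gt.
  have r0 : 0 < UY t / UX t by exact: divr_gt0.
  by rewrite /lo (lnM aS0 r0) ln_div ?posrE.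
have h1 p : 0 < p -> measurable_fun setT (fun t => a * gs p t : mR).
  by move=> p0; apply: measurable_funM => //; exact: measurable_gs.
have h2 p t : 0 < p -> G t -> 0 < lo t /\ lo t <= a * gs p t <= a * S.
  move=> p0 Gt; have x0 := UX_gt0 Gt; have y0 := UY_gt0 Gt.
  split; first by rewrite mulr_gt0// divr_gt0.
  have := beam_optimal_bounds (@cu p _) (@cz p _) (G_neq0 Gt) (rP (hc t) p0).
  rewrite -/(gs p t) -/S => /andP[b1 b2].
  rewrite /lo -mulrA !ler_pM2l// b2 andbT (le_trans _ b1)// gainC.
  rewrite /UX /UY le_eqVlt; apply/orP; left; apply/eqP; field.
  by rewrite !gt_eqF// sqnorm_gt0 G_neq0.
have h3 t : G t -> exists x p0, forall p, p0 < p -> a * gs p t = x.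
  move=> Gt; have [s [c [p0 H]]] := gain_limits Gt; exists (a * s), p0 => p pp.
  by have [-> _] := H p pp.
have h4 : P.-integrable G (fun t => (ln (lo t))%:E).
  by apply: eq_integrable i2 => // t /set_mem Gt; rewrite /= loE.
have h5 : P.-integrable G (fun t : T => (ln (a * S))%:E).
  by apply: eq_integrable i3 => // t _; rewrite /= addr0.
have h6 : (\int[P]_(t in G) (ln (lo t))%:E = (ln (a * S) + (y - x))%:E)%E.
  by rewrite -e2; apply: eq_integral => t /set_mem Gt; rewrite loE.
have h7 : (\int[P]_(t in G) (ln (a * S))%:E = (ln (a * S) + 0)%:E)%E.
  by rewrite -e3; apply: eq_integral => t _; rewrite /= addr0.
have [Ls [HLs bLs]] := high_snr_expansion_dominated L%:R^-1 measurable_G G_full h1 h2 h3 h4 h5 h6 h7.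
exists Ls; split.
  rewrite (_ : (fun p => _) = (fun p => ('E_P[fun t => (L%:R^-1 * log2 (1 + p * (a * gs p t)))%R])%E))//.
  apply/funext => p; congr expectation; apply/funext => t.
  by rewrite /sens_rate /a !mulrA.
have -> : L%:R * N%:R * alphas * sqnorm hs = a * S by rewrite /a [N%:R * _]mulrC.
have sumE : \sum_(1 <= i < m.+1) (i%:R * ln 2)^-1 = (x - y) / ln 2 :> R.
  by rewrite xE yE digamma_sum mulr_suml; apply: eq_bigr => i _; rewrite invfM.
rewrite sumE; move: bLs; rewrite addr0 /log2.
by rewrite (_ : - (ln (a * S) / ln 2) + (x - y) / ln 2 = - ((ln (a * S) + (y - x)) / ln 2)); [|ring].
Qed.

(** Both bounds of the gain are random here: [alphac * UY] from the beam matched to [hs] and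
    [alphac * UX] from the one matched to [hc]. The larger gain gives the smaller offset. *)
Lemma comm_rate_expansion : exists Lc,
  high_snr_expansion (fun p => 'E_P[fun t => comm_rate p (hc t) (w p (hc t))])%E 1 Lc /\
  - log2 alphac - digamma m.+1%:R / ln 2 <= Lc <= - log2 alphac - digamma 1 / ln 2.
Proof.
have [x xE] : {x : R | x = digamma m.+1%:R} := exist _ _ erefl.
have [y yE] : {y : R | y = digamma 1} := exist _ _ erefl.
have [iX eX] := ln_integrals mUX lawX; have [iY eY] := ln_integrals mUY lawY.
rewrite -xE in eX; rewrite -[0.+1%:R]/(1 : R) -yE in eY.
have [i2 e2] := integral_affine (ln alphac) iX eX.
have [i1 e1] := integral_affine (ln alphac) iY eY.
have lX t : G t -> ln (alphac * UX t) = ln alphac + ln (UX t).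
  by move=> Gt; rewrite lnM ?posrE ?UX_gt0.
have lY t : G t -> ln (alphac * UY t) = ln alphac + ln (UY t).
  by move=> Gt; rewrite lnM ?posrE ?UY_gt0.
have h2 p t : 0 < p -> G t -> 0 < alphac * UY t /\ alphac * UY t <= gc p t <= alphac * UX t.
  move=> p0 Gt; rewrite -gainUY -sqnormUX; split; first by rewrite divr_gt0.
  exact: (beam_optimal_bounds (@cz p _) (@cu p _) hs_neq0 (beam_optimalC (rP (hc t) p0))).
have h3 t : G t -> exists x p0, forall p, p0 < p -> gc p t = x.
  by move=> Gt; have [s [c [p0 H]]] := gain_limits Gt; exists c, p0 => p /H[].
have h4 : P.-integrable G (fun t => (ln (alphac * UY t))%:E).
  by apply: eq_integrable i1 => // t /set_mem Gt; rewrite /= lY.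
have h5 : P.-integrable G (fun t => (ln (alphac * UX t))%:E).
  by apply: eq_integrable i2 => // t /set_mem Gt; rewrite /= lX.
have h6 : (\int[P]_(t in G) (ln (alphac * UY t))%:E = (ln alphac + y)%:E)%E.
  by rewrite -e1; apply: eq_integral => t /set_mem Gt; rewrite lY.
have h7 : (\int[P]_(t in G) (ln (alphac * UX t))%:E = (ln alphac + x)%:E)%E.
  by rewrite -e2; apply: eq_integral => t /set_mem Gt; rewrite lX.
have [Lc [HLc bLc]] := high_snr_expansion_dominated 1 measurable_G G_full measurable_gc h2 h3 h4 h5 h6 h7.
exists Lc; split.
  rewrite (_ : (fun p => _) = (fun p => ('E_P[fun t => (1 * log2 (1 + p * gc p t))%R])%E))//.
  by apply/funext => p; congr expectation; apply/funext => t; rewrite mul1r.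
rewrite -xE -yE; move: bLc; rewrite /log2.
by rewrite !mulrDl !opprD.
Qed.

Lemma comm_outage_diversity R0 : 0 < R0 -> exists2 k : nat,
  diversity_order (fun p => P [set t | comm_rate p (hc t) (w p (hc t)) < R0]) k.+1%:R &
  (k <= m)%N.
Proof.
(* An outage means that the gain is below [c0 / p]. *)
move=> R0_gt0; pose c0 := expR (R0 * ln 2) - 1.
have c00 : 0 < c0 by rewrite subr_gt0 -[X in X < _]expR0 ltr_expR mulr_gt0.
have outE p t : 0 < p -> (comm_rate p (hc t) (w p (hc t)) < R0) = (gc p t < c0 / p).
  move=> p0; have q0 : 0 < 1 + p * gc p t by rewrite ltr_pwDl// mulr_ge0 ?gain_ge0// ltW.
  rewrite /comm_rate -/(gc p t) /log2 ltr_pdivrMr// -[ln _ < _]ltr_expR lnK//.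
  by rewrite ltr_pdivlMr// [gc p t * p]mulrC ltrBrDl.
have mE p : 0 < p -> measurable [set t | comm_rate p (hc t) (w p (hc t)) < R0].
  move=> p0; rewrite (_ : mkset _ = gc p @^-1` `]-oo, c0 / p[).
    by rewrite -[_ @^-1` _]setTI; apply: measurable_gc => //; exact: measurable_itv.
  by apply/seteqP; split => t /=; rewrite in_itv /= outE.
pose c := c0 / alphac; have c_gt0 : 0 < c by exact: divr_gt0.
have ltU (U e p : R) : (U < e * c / p) = (alphac * U < e * c0 / p).
  rewrite (_ : e * c / p = e * c0 / p / alphac); last by rewrite /c; ring.
  by rewrite ltr_pdivlMr// mulrC.
have ltU1 (U p : R) : (U < c / p) = (alphac * U < c0 / p).
  by have := ltU U 1 p; rewrite !mul1r.
have [a1|a1] := eqVneq alpha 1.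
  (* For [alpha = 1] the communication threshold is zero at every rate, so the gain is exactly that
     of the beam matched to [hs]. *)
  exists 0 => //; apply: (gamma_variable_diversity mUY lawY c_gt0 mE); exists 0 => p p0.
  have gY t : gc p t = alphac * UY t.
    rewrite gcE// gainUY /z /B a1 subrr mul0r /threshold mul0r expR0 subrr mul0r.
    by apply/max_idPr; rewrite -gainUY divr_ge0 ?gain_ge0// ltW.
  split => t /=; rewrite in_itv /= outE// gY ?ltU1// ltU => H.
  by apply: (lt_trans H); rewrite ltr_pM2r ?invr_gt0//; lra.
have b0 : 0 < 1 - alpha.
  by rewrite subr_gt0 lt_neqAle a1; case/andP: alpha01.
exists m => //; apply: (gamma_variable_diversity mUX lawX c_gt0 mE).
(* The common rate at which the communication constraint demands exactly [R0]. For large [p] the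
   sensing threshold at [q] is at most [S / 2], within reach of the balanced beam. *)
pose q := R0 / (1 - alpha).
exists (Num.max 0 (2 * (expR (A * q) - 1) / (a * S))) => p; rewrite gt_max => /andP[p0 pS].
have gX t : gc p t <= sqnorm (hc t).
  by have := beam_optimal_bounds (@cz p _) (@cu p _) hs_neq0 (beam_optimalC (rP (hc t) p0)) => /andP[].
split => t /=; rewrite in_itv /= outE// ?ltU1 ?ltU -sqnormUX.
  exact: le_lt_trans.
(* If [2 * c0 / p <= sqnorm (hc t)], the balanced beam is feasible at [q]; the optimal rate is then
   at least [q], and the gain at least [c0 / p]. *)
apply: contraTT; rewrite -!leNgt => Xge.
have X0 : 0 < sqnorm (hc t) by apply: lt_le_trans Xge; rewrite divr_gt0// mulr_gt0.
have h0 : hc t != 0 by rewrite -sqnorm_gt0.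
have [v [v1 vs vc]] := balanced_beam hs_neq0 h0.
have zq : z p q = c0 / p.
  rewrite /z /threshold mulr1 /c0 /B /q; congr ((expR _ - 1) / _).
  by field; rewrite gt_eqF.
have uq : u p q <= S / 2.
  have aS0 : 0 < a * S by exact: mulr_gt0.
  have pa0 : 0 < p * a by exact: mulr_gt0.
  rewrite /u /threshold ler_pdivrMr//.
  by move: pS; rewrite ltr_pdivrMr// => /ltW; lra.
have [_ opt] := rP (hc t) p0.
have qr : q <= r p (hc t).
  apply: (opt v); split => //; first exact: (le_trans uq vs).
  rewrite zq (le_trans _ vc)// ler_pdivlMr//.
  by rewrite (le_trans _ Xge)// mulrAC [c0 * 2]mulrC.
rewrite -zq; apply: (le_trans (threshold_homo B_ge0 ltr01 p0 qr)).
by have [[_ ? _] _] := rP (hc t) p0.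
Qed.

End optimal_beam_over_gaussian_channel.

Theorem corollary2 (R : realType) (d : measure_display) (T : measurableType d)
    (P : probability T R) (M N L : nat) (alphac alphas R0 alpha : R)
    (hs : 'cV[R[i]]_M) (hc : T -> 'cV[R[i]]_M)
    (w : R -> 'cV[R[i]]_M -> 'cV[R[i]]_M)
    (M_gt0 : (0 < M)%N) (N_gt0 : (0 < N)%N) (L_gt0 : (0 < L)%N)
    (alphac_gt0 : 0 < alphac) (alphas_gt0 : 0 < alphas) (R0_gt0 : 0 < R0)
    (alpha01 : 0 <= alpha <= 1) (hs_neq0 : hs != 0)
    (hc_gaussian : complex_gaussian P alphac hc)
    (w_optimal : forall (p : R) (h : 'cV[R[i]]_M), 0 < p ->
       optimal_beamformer N L alphas alpha p hs h (w p h)) :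
  exists Ls Lc Dc : R,
    [/\ high_snr_expansion
          (fun p => 'E_P[fun t => sens_rate N L alphas p hs (w p (hc t))])%E
          L%:R^-1 Ls,
        high_snr_expansion
          (fun p => 'E_P[fun t => comm_rate p (hc t) (w p (hc t))])%E 1 Lc
      & diversity_order
          (fun p => P [set t | comm_rate p (hc t) (w p (hc t)) < R0]) Dc] /\
    [/\ - log2 (L%:R * N%:R * alphas * sqnorm hs) <= Ls <=
          - log2 (L%:R * N%:R * alphas * sqnorm hs) +
          \sum_(1 <= i < M) (i%:R * ln 2)^-1,
        - log2 alphac - digamma M%:R / ln 2 <= Lc <=
          - log2 alphac - digamma 1 / ln 2
      & 1 <= Dc <= M%:R].
Proof.
case: M M_gt0 hs hc w hs_neq0 hc_gaussian w_optimal => // m _ hs hc w h0 hG opt.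
have [Ls [Es Bs]] := sens_rate_expansion N_gt0 L_gt0 alphac_gt0 alphas_gt0 alpha01 h0 hG opt.
have [Lc [Ec Bc]] := comm_rate_expansion N_gt0 L_gt0 alphac_gt0 alphas_gt0 alpha01 h0 hG opt.
have [k Ek km] := comm_outage_diversity N_gt0 L_gt0 alphac_gt0 alphas_gt0 alpha01 h0 hG opt R0_gt0.
exists Ls, Lc, k.+1%:R; split; split => //.
by rewrite ler1n ler_nat /= ltnS.
Qed.
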